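(* Let $0<\rho\le1$ and $a\in\Gamma_\rho^0(\mathbb{R}^{2n})$. Then $\widehat{A}_{\mathrm{BJ}}=\operatorname{Op}_{\mathrm{BJ}}(a)$ is a bounded operator on $L^2(\mathbb{R}^n)$.
   Context: Notation: $\hbar\in(0,1]$ is a fixed parameter; $z=(x,p)\in\mathbb{R}^n\times\mathbb{R}^n=\mathbb{R}^{2n}$; $\langle z\rangle=\sqrt{1+|z|^2}$. Shubin classes: for $m\in\mathbb{R}$, $0<\rho\le1$, $\Gamma_\rho^m(\mathbb{R}^{2n})$ is the space of complex functions $a\in C^\infty(\mathbb{R}^{2n})$ such that for every $\alpha\in\mathbb{N}^{2n}$ there is $C_\alpha\ge0$ with $|\partial_z^\alpha a(z)|\le C_\alpha\langle z\rangle^{m-\rho|\alpha|}$ for all $z\in\mathbb{R}^{2n}$. Born-Jordan operators: $\operatorname{Op}_{\mathrm{BJ}}(a)=\int_0^1\operatorname{Op}_\tau(a)\,d\tau$, where $$\operatorname{Op}_\tau(a)\psi(x)=\left(\tfrac{1}{2\pi\hbar}\right)^n\iint e^{\frac{i}{\hbar}p\cdot(x-y)}a((1-\tau)x+\tau y,p)\psi(y)\,d^ny\,d^np$$ for $\psi\in\mathcal{S}(\mathbb{R}^n)$, understood as an oscillatory integral (in the sense of distributional kernels). For $a\in\Gamma_\rho^m(\mathbb{R}^{2n})$ these operators are continuous on $\mathcal{S}(\mathbb{R}^n)$ and extend to continuous operators on $\mathcal{S}'(\mathbb{R}^n)$; the extension is denoted by the same symbol. *)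

(* Defs.v *)
From HB Require Import structures.
From mathcomp Require Import all_boot all_order all_algebra.
From mathcomp Require Import complex.
From mathcomp Require Import all_classical all_reals all_analysis.

Set Implicit Arguments.
Unset Strict Implicit.
Unset Printing Implicit Defensive.

Import Order.TTheory GRing.Theory Num.Theory.
Import numFieldNormedType.Exports.

Local Open Scope classical_set_scope.
Local Open Scope ring_scope.
Local Open Scope complex_scope.

(* Borel sigma-algebra of 'rV[T]_n, generated by the coordinates, as the library
   does for n.-tuple T. *)
Definition measure_rV_display : measure_display -> measure_display.
Proof. exact. Qed.

Section measurable_rV.
Context {d : measure_display} {T : measurableType d}.
Variable n : nat.

Definition coord_rV (i : 'I_n) (v : 'rV[T]_n) : T := v ord0 i.

Let rV_set0 : g_sigma_preimage coord_rV set0.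
Proof. exact: sigma_algebra0. Qed.

Let rV_setC A : g_sigma_preimage coord_rV A -> g_sigma_preimage coord_rV (~` A).
Proof. exact: sigma_algebraC. Qed.

Let rV_bigcup (F : _^nat) : (forall i, g_sigma_preimage coord_rV (F i)) ->
  g_sigma_preimage coord_rV (\bigcup_i (F i)).
Proof. exact: sigma_algebra_bigcup. Qed.

HB.instance Definition _ := @isMeasurable.Build (measure_rV_display d)
  'rV[T]_n (g_sigma_preimage coord_rV) rV_set0 rV_setC rV_bigcup.
End measurable_rV.


Lemma measurable_coord_rV d (T : measurableType d) n (i : 'I_n) :
  measurable_fun [set: 'rV[T]_n] (coord_rV i).
Proof.
move=> _ Y mY; rewrite setTI; apply: sub_sigma_algebra => /=.
rewrite -bigcup_seq/=; exists i => /=; first by rewrite mem_index_enum.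
by exists Y => //; rewrite setTI.
Qed.

Lemma measurable_fun_rVP d d' (S : measurableType d) (T : measurableType d')
    n (f : S -> 'rV[T]_n) :
  (forall i, measurable_fun [set: S] (coord_rV i \o f)) ->
  measurable_fun [set: S] f.
Proof.
move=> mf.
suff sub : g_sigma_preimage (fun i => coord_rV i \o f) `<=` measurable.
  by move=> _ A mA; apply: sub; rewrite g_sigma_preimage_comp; exists A.
apply: smallest_sub; first exact: sigma_algebra_measurable.
rewrite -bigcup_seq; apply: bigcup_sub => i _ A [B mB <-].
exact: mf.
Qed.

Definition rV_cons (R : realType) n (z : measurableTypeR R * 'rV[R]_n) :
  'rV[R]_n.+1 := \row_i oapp (fun j => z.2 ord0 j) z.1 (unlift ord0 i).

Definition rV_uncons (R : realType) n (v : 'rV[R]_n.+1) :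
  measurableTypeR R * 'rV[R]_n :=
  (v ord0 ord0, \row_j v ord0 (lift ord0 j)).

Lemma rV_consK (R : realType) n : cancel (@rV_cons R n) (@rV_uncons R n).
Proof.
move=> [x v]; rewrite /rV_uncons mxE unlift_none; congr (_, _).
by apply/rowP => j; rewrite !mxE liftK.
Qed.

Lemma measurable_rV_cons (R : realType) n : measurable_fun setT (@rV_cons R n).
Proof.
apply: measurable_fun_rVP => i; case: (unliftP ord0 i) => [j|] ->.
  rewrite (_ : _ \o _ = coord_rV j \o snd).
    exact: measurableT_comp (measurable_coord_rV j) measurable_snd.
  by apply/funext => z /=; rewrite /coord_rV mxE liftK.
rewrite (_ : _ \o _ = fst); first exact: measurable_fst.
by apply/funext => z /=; rewrite /coord_rV mxE unlift_none.
Qed.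

Lemma measurable_rV_uncons (R : realType) n :
  measurable_fun setT (@rV_uncons R n).
Proof.
apply/measurable_fun_pairP; split; first exact: (measurable_coord_rV ord0).
apply: measurable_fun_rVP => i.
rewrite (_ : _ \o _ = coord_rV (lift ord0 i)); first exact: measurable_coord_rV.
by apply/funext => v /=; rewrite /coord_rV mxE.
Qed.


Section lebesgue_rV_step.
Variables (R : realType) (n : nat).
Variable mu : {sigma_finite_measure set 'rV[R]_n -> \bar R}.

Definition lebesgue_rV_step : set 'rV[R]_n.+1 -> \bar R :=
  pushforward (@lebesgue_measure R \x mu)%E (@rV_cons R n).

Let preimage_consK (A : set (measurableTypeR R * 'rV[R]_n)) :
  @rV_cons R n @^-1` (@rV_uncons R n @^-1` A) = A.
Proof. by apply/seteqP; split=> z /=; rewrite rV_consK. Qed.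

Let step0 : lebesgue_rV_step set0 = 0%E.
Proof. by rewrite /lebesgue_rV_step /pushforward preimage_set0 measure0. Qed.

Let step_ge0 A : (0 <= lebesgue_rV_step A)%E.
Proof. exact: (measure_ge0 (@lebesgue_measure R \x mu)%E). Qed.

Let step_sigma_additive : semi_sigma_additive lebesgue_rV_step.
Proof.
move=> F mF tF mUF; rewrite /lebesgue_rV_step /pushforward preimage_bigcup.
apply: measure_semi_sigma_additive.
- by move=> k; rewrite -[X in measurable X]setTI; exact: measurable_rV_cons.
- apply/trivIsetP => /= i j _ _ ij; rewrite -preimage_setI.
  by move/trivIsetP : tF => /(_ _ _ _ _ ij) ->//; rewrite preimage_set0.
- rewrite -preimage_bigcup -[X in measurable X]setTI.
  exact: measurable_rV_cons.
Qed.

HB.instance Definition _ := isMeasure.Build _ _ _ lebesgue_rV_step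
  step0 step_ge0 step_sigma_additive.

Let step_sigma_finite : sigma_finite setT lebesgue_rV_step.
Proof.
have /sigma_finiteP[F [TF ndF Foo]] := sigma_finiteT (@lebesgue_measure R).
have /sigma_finiteP[G [TG ndG Goo]] := sigma_finiteT mu.
exists (fun k => @rV_uncons R n @^-1` (F k `*` G k)).
  rewrite -preimage_bigcup; apply/seteqP; split=> // v _ /=.
  have [k _ Fk] : (\bigcup_k F k) (rV_uncons v).1 by rewrite -TF.
  have [l _ Gl] : (\bigcup_k G k) (rV_uncons v).2 by rewrite -TG.
  exists (maxn k l) => //; split.
    by move: Fk; exact/subsetPset/ndF/leq_maxl.
  by move: Gl; exact/subsetPset/ndG/leq_maxr.
move=> k; have [mF Fk] := Foo k; have [mG Gk] := Goo k; split.
  rewrite -[X in measurable X]setTI; apply: measurable_rV_uncons => //.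
  exact: measurableX.
rewrite /lebesgue_rV_step /pushforward preimage_consK product_measure1E//.
by rewrite lte_mul_pinfty// ge0_fin_numE.
Qed.

HB.instance Definition _ := Measure_isSigmaFinite.Build _ _ _
  lebesgue_rV_step step_sigma_finite.

End lebesgue_rV_step.

(* Lebesgue measure on R^n, by R^(n+1) = R * R^n. *)
Fixpoint lebesgue_rV (R : realType) (n : nat) :
    {sigma_finite_measure set 'rV[R]_n -> \bar R} :=
  match n with
  | 0 => \d_(0 : 'rV[R]_0)
  | m.+1 => lebesgue_rV_step (lebesgue_rV R m)
  end.

Lemma lebesgue_rV_box (R : realType) k (a b : 'rV[R]_k) :
  (forall i, a ord0 i <= b ord0 i) ->
  lebesgue_rV R k
    [set v : 'rV[R]_k | forall i, a ord0 i <= v ord0 i <= b ord0 i] =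
  (\prod_(i < k) (b ord0 i - a ord0 i))%:E.
Proof.
elim: k a b => [|k IH] a b ab.
  by rewrite big_ord0 /= diracE mem_set//= => -[].
set A := [set v | _].
change ((@lebesgue_measure R \x lebesgue_rV R k)%E (@rV_cons R k @^-1` A) =
  (\prod_(i < k.+1) (b ord0 i - a ord0 i))%:E).
pose a' : 'rV[R]_k := \row_j a ord0 (lift ord0 j).
pose b' : 'rV[R]_k := \row_j b ord0 (lift ord0 j).
pose A' := [set v : 'rV[R]_k | forall i, a' ord0 i <= v ord0 i <= b' ord0 i].
have -> : @rV_cons R k @^-1` A =
    ([set` `[a ord0 ord0, b ord0 ord0]] : set (measurableTypeR R)) `*` A'.
  apply/seteqP; split => -[x v] /=; rewrite in_itv /=.
    move=> H; split; first by move: (H ord0); rewrite mxE unlift_none.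
    by move=> i; move: (H (lift ord0 i)); rewrite !mxE liftK.
  move=> [H1 H2] i; rewrite mxE; case: unliftP => [j|] -> //=.
  by move: (H2 j); rewrite !mxE.
have mA' : measurable A'.
  rewrite (_ : A' = \bigcap_(i in [set: 'I_k])
      (coord_rV i @^-1` `[a' ord0 i, b' ord0 i])).
    apply: fin_bigcap_measurable => // i _.
    by rewrite -[X in measurable X]setTI; exact: measurable_coord_rV.
  apply/seteqP; split => v /= H i; move: (H i); rewrite ?in_itv//=.
  by move/(_ I).
rewrite product_measure1E//= IH; last by move=> i; rewrite !mxE.
rewrite (lebesgue_measure_itv `[_, _]) /= lte_fin big_ord_recl EFinM.
congr (_ * _)%E; last by congr EFin; apply: eq_bigr => i _; rewrite !mxE.
by case: ltgtP (ab ord0) => // ->; rewrite subrr.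
Qed.

Local Notation normc := ComplexField.Normc.normc.

Section complex_calculus.
Variable R : realType.

(* A multi-index alpha is given by the list s of the directions of the
   successive partial derivatives, so that |alpha| = size s; the head of s is
   differentiated last. *)
Definition partials k (s : seq 'I_k) (g : 'rV[R]_k -> R) : 'rV[R]_k -> R :=
  foldr (fun j h x => 'D_(delta_mx 0 j) h x) g s.

(* C^oo: the partial derivatives of all orders exist and are continuous. *)
Definition smooth k (g : 'rV[R]_k -> R) : Prop :=
  forall s : seq 'I_k, continuous (partials s g) /\
    forall x j, derivable (partials s g) x (delta_mx 0 j).

Definition csmooth k (f : 'rV[R]_k -> R[i]) : Prop :=
  smooth (fun x => complex.Re (f x)) /\ smooth (fun x => complex.Im (f x)).

Definition cpartials k (s : seq 'I_k) (f : 'rV[R]_k -> R[i]) :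
    'rV[R]_k -> R[i] :=
  fun x => partials s (fun y => complex.Re (f y)) x +i*
           partials s (fun y => complex.Im (f y)) x.

Definition cintegral d (T : measurableType d)
    (mu : {measure set T -> \bar R}) (D : set T) (f : T -> R[i]) : R[i] :=
  (\int[mu]_(x in D) complex.Re (f x)) +i*
  (\int[mu]_(x in D) complex.Im (f x)).

Definition expi (t : R) : R[i] := cos t +i* sin t.

(* Not the norm `|_| of 'rV[R]_k, which is the sup norm. *)
Definition dotp k (x y : 'rV[R]_k) : R := \sum_(j < k) x 0 j * y 0 j.

Definition japanese k (x : 'rV[R]_k) : R := Num.sqrt (1 + dotp x x).

(* A point z = (x, p) of phase space is row_mx x p : 'rV[R]_(n + n) . *)
Definition shubin n (m rho : R) (a : 'rV[R]_(n + n) -> R[i]) : Prop :=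
  csmooth a /\
  forall s : seq 'I_(n + n), exists C : R, 0 <= C /\
    forall z, normc (cpartials s a z) <= C * japanese z `^ (m - rho * (size s)%:R).

Definition schwartz n (f : 'rV[R]_n -> R[i]) : Prop :=
  csmooth f /\
  forall (N : nat) (s : seq 'I_n), exists C : R,
    forall x, japanese x ^+ N * normc (cpartials s f x) <= C.

Record schwartzFun n := SchwartzFun {
  sfun :> 'rV[R]_n -> R[i];
  sfunP : schwartz sfun }.

(* For a Shubin symbol a and a Schwartz function psi, integrating by parts in y
   shows that the y-integral is O(<p>^-N) for every N; taken in the order y, then
   p, the integrals converge absolutely and give the value of the oscillatory
   integral, whereas the integrand need not be integrable in (y, p). *)
Definition op_tau n (hbar tau : R) (a : 'rV[R]_(n + n) -> R[i])
    (psi : 'rV[R]_n -> R[i]) (x : 'rV[R]_n) : R[i] :=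
  (((2 * pi * hbar)^-1) ^+ n)%:C *
  cintegral (lebesgue_rV R n) setT (fun p =>
    cintegral (lebesgue_rV R n) setT (fun y =>
      expi (hbar^-1 * dotp p (x - y)) *
      a (row_mx ((1 - tau) *: x + tau *: y) p) * psi y)).

Definition op_BJ n (hbar : R) (a : 'rV[R]_(n + n) -> R[i])
    (psi : 'rV[R]_n -> R[i]) (x : 'rV[R]_n) : R[i] :=
  cintegral (@lebesgue_measure R) `[0, 1]
    (fun tau => op_tau hbar tau a psi x).

(* With the topology of pointwise convergence, that is, the weak-* topology. *)
Notation functional n := {ptws (schwartzFun n) -> (R[i])^o}.

(* Linear and continuous for the seminorms of the Schwartz space. Its elements
   carry a proof, hence the linearity clause is stated through the values. *)
Definition tempered n (u : functional n) : Prop :=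
  (forall (c : R[i]) (f g h : schwartzFun n),
     (forall x, h x = c * f x + g x) -> u h = c * u f + u g) /\
  (exists (N : nat) (C : R), forall (f : schwartzFun n) (M : R),
     (forall (s : seq 'I_n) x, (size s <= N)%N ->
        japanese x ^+ N * normc (cpartials s f x) <= M) ->
     normc (u f) <= C * M).

Definition regular_dist n (g : 'rV[R]_n -> R[i]) : functional n :=
  fun phi : schwartzFun n =>
    cintegral (lebesgue_rV R n) setT (fun x => g x * phi x).

(* T is a continuous linear map of the space of tempered distributions into
   itself that extends A. As Schwartz functions are dense, T is determined by A.
   A strongly continuous linear map is also weak-* continuous, since the Schwartz
   space is reflexive. *)
Definition tempered_extension n (A : ('rV[R]_n -> R[i]) -> 'rV[R]_n -> R[i])
    (T : functional n -> functional n) : Prop :=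
  [/\ (forall u, tempered u -> tempered (T u)),
      (forall (c : R[i]) u v, tempered u -> tempered v ->
         T (c *: u + v) = c *: T u + T v),
      {within [set u | tempered u], continuous T} &
      forall psi : schwartzFun n, T (regular_dist psi) = regular_dist (A psi)].

Definition in_L2 n (f : 'rV[R]_n -> R[i]) : Prop :=
  (fun x => complex.Re (f x)) \in Lfun (lebesgue_rV R n) 2%:E /\
  (fun x => complex.Im (f x)) \in Lfun (lebesgue_rV R n) 2%:E.

Definition L2norm n (f : 'rV[R]_n -> R[i]) : \bar R :=
  Lnorm (lebesgue_rV R n) 2%:E (fun x => (normc (f x))%:E).

(* For A given on Schwartz functions: A is bounded for the L^2 norm on this
   dense subspace, and the continuous extension of A to tempered distributions
   maps L^2 into L^2 with the same bound. *)
Definition L2_bounded n (A : ('rV[R]_n -> R[i]) -> 'rV[R]_n -> R[i]) : Prop :=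
  exists2 C : R, 0 <= C &
    (forall psi : schwartzFun n,
       in_L2 (A psi) /\ (L2norm (A psi) <= C%:E * L2norm psi)%E) /\
    (forall T, tempered_extension A T ->
       forall f, in_L2 f -> exists g, [/\ in_L2 g, T (regular_dist f) = regular_dist g &
         (L2norm g <= C%:E * L2norm f)%E]).

End complex_calculus.

(* Main.v *)
Require Import Defs.
From HB Require Import structures.
From mathcomp Require Import all_boot all_order all_algebra.
From mathcomp Require Import complex ring lra.
From mathcomp Require Import all_classical all_reals all_analysis.
From mathcomp Require Import measurable_realfun.

Set Implicit Arguments.
Unset Strict Implicit.
Unset Printing Implicit Defensive.

Import Order.TTheory GRing.Theory Num.Theory.
Import numFieldNormedType.Exports.

Local Open Scope classical_set_scope.
Local Open Scope ring_scope.
Local Open Scope complex_scope.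
Local Notation normc := ComplexField.Normc.normc.

(** The inner integral of the operator, over y, is that of a smooth function
    against the oscillating factor exp(i p.(x - y) / hbar), and the naive bound by
    absolute values diverges in p. The L^2 estimate on Schwartz functions follows
    the elementary proof of the Calderon-Vaillancourt theorem by Hwang: it uses
    integrations by parts, Bessel's inequality and Schur's test, and asks of the
    amplitude a((1 - tau) x + tau y, p) only that its derivatives are bounded.
    These bounds hold uniformly for tau in [0, 1], so the estimate survives the
    average over tau that defines the Born-Jordan operator.

    Fix tau and pair the operator applied to u with a function v. After the
    insertion of a cut-off in p (kap), which disappears in the limit, n
    integrations by parts of second order in p (osc_ibp) replace the amplitude by
    one that carries the integrable factor wgt (x - y) (pform_tform). This new
    amplitude g (gker) is not a product of a function of x and a function of y,
    but the resolvent formula F = rk * (prod_j (1 + d_j)) F, used in x and in y,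
    writes it as a superposition over (s, t) of the products rk (x - s) rk (y - t)
    (gker_resolvent); the density of the superposition is still bounded by
    wgt (s - t). For fixed (s, t) the variables x and y separate, and the integral
    over them is a product of Fourier transforms at p of the windowed functions
    v rk (. - s) and u rk (. - t) (osc_pair_le). By Schur's test the factor
    wgt (s - t) costs a constant (tform_le), and by Bessel's inequality the
    integral over p and s of the squared Fourier transform of v rk (. - s) is at
    most a constant times the squared norm of v (bessel_win). Hence the pairing is
    at most K (|v|^2 + |u|^2) (opr_trilinear), and the choice of v as a small
    multiple of the truncated image of u gives the bound (oprBJ_L2). All this is
    done for real functions and the factors cos and sin separately; the complex
    statement (op_BJ_L2) is a combination of eight real operators.

    The statement about the continuous extension T to tempered distributions
    follows by density. Each f in L^2 is a rapid L^2 limit of Schwartz functions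
    psi_k (rapid_dense): products of logistic steps approximate the indicators of
    boxes, the monotone class theorem passes to measurable sets, and simple
    functions do the rest. By the L^2 bound the images of psi_k are a Cauchy
    sequence, whose limit g exists by the classical argument (L2_limit). Both
    psi_k -> f and the convergence of the images to g hold in the sense of
    distributions, and the weak continuity of T gives T f = g (extension_L2). *)

(** * Dominated real integrals *)

Section dominated.
Context d (T : measurableType d) (R : realType).
Variable mu : {measure set T -> \bar R}.
Implicit Types f g : T -> R.

Lemma dom_integrable f g : measurable_fun setT f ->
  mu.-integrable setT (EFin \o g) -> (forall x, `|f x| <= g x) ->
  mu.-integrable setT (EFin \o f).
Proof.
move=> mf ig fg; apply: le_integrable ig => //; first exact/measurable_EFinP.
by move=> x _ /=; rewrite lee_fin (le_trans (fg x))// ler_norm.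
Qed.

Lemma dom_Rintegral f g : measurable_fun setT f ->
  mu.-integrable setT (EFin \o g) -> (forall x, `|f x| <= g x) ->
  `|\int[mu]_x f x| <= \int[mu]_x g x.
Proof.
move=> mf ig fg; have if_ := dom_integrable mf ig fg.
apply: le_trans (le_normr_Rintegral measurableT if_) _.
apply: le_Rintegral => //.
  apply: (@dom_integrable (fun x => `|f x|) g) => //.
    exact: measurableT_comp.
  by move=> x; rewrite normr_id.
Qed.

Lemma le_Rint f g : mu.-integrable setT (EFin \o f) ->
  mu.-integrable setT (EFin \o g) -> (forall x, f x <= g x) ->
  \int[mu]_x f x <= \int[mu]_x g x.
Proof. by move=> *; apply: le_Rintegral. Qed.

Lemma integrable_scale (c : R) f : mu.-integrable setT (EFin \o f) ->
  mu.-integrable setT (EFin \o (fun x => c * f x)).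
Proof.
move=> if_; rewrite (_ : _ \o _ = (fun x => c%:E * (EFin \o f) x)%E).
  exact: integrableZl.
by apply/funext => x /=; rewrite EFinM.
Qed.

Lemma integrable_add f g : mu.-integrable setT (EFin \o f) ->
  mu.-integrable setT (EFin \o g) ->
  mu.-integrable setT (EFin \o (fun x => f x + g x)).
Proof.
move=> if_ ig; rewrite (_ : _ \o _ = ((EFin \o f) \+ (EFin \o g))%E).
  exact: integrableD.
by apply/funext => x /=; rewrite EFinD.
Qed.

Lemma EFin_Rint f : mu.-integrable setT (EFin \o f) ->
  ((\int[mu]_x f x)%:E = \int[mu]_x (f x)%:E)%E.
Proof. by move=> if_; rewrite /Rintegral fineK//; exact: integrable_fin_num. Qed.

Lemma ge0_integrable_le f (c : R) : measurable_fun setT f ->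
  (forall x, 0 <= f x) -> (\int[mu]_x (f x)%:E <= c%:E)%E ->
  mu.-integrable setT (EFin \o f) /\ \int[mu]_x f x <= c.
Proof.
move=> mf f0 fc.
have if_ : mu.-integrable setT (EFin \o f).
  apply/integrableP; split; first exact/measurable_EFinP.
  rewrite (eq_integral (fun x => (f x)%:E)); last first.
    by move=> x _ /=; rewrite ger0_norm.
  exact: le_lt_trans fc (ltry _).
by split=> //; rewrite -lee_fin EFin_Rint.
Qed.

Lemma Rint_cvg (f_ : nat -> T -> R) f g :
  (forall k, measurable_fun setT (f_ k)) -> measurable_fun setT f ->
  mu.-integrable setT (EFin \o g) -> (forall k x, `|f_ k x| <= g x) ->
  (forall x, f_ k x @[k --> \oo] --> f x) ->
  \int[mu]_x f_ k x @[k --> \oo] --> \int[mu]_x f x.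
Proof.
move=> mf_ mf ig fg cf.
have ifk k : mu.-integrable setT (EFin \o f_ k) by exact: dom_integrable (fg k).
have fg' x : `|f x| <= g x.
  have /cvg_norm cn := cf x.
  by apply: (closed_cvg (fun y => y <= g x) _ _ _ cn);
    [exact: closed_le|exact: nearW].
have if_ : mu.-integrable setT (EFin \o f) by exact: dom_integrable fg'.
apply: fine_cvg; rewrite [X in _ --> X](EFin_Rint if_).
have := @dominated_convergence _ _ _ mu setT measurableT (fun k => EFin \o f_ k)
  (EFin \o f) (EFin \o g).
case=> //.
- by move=> k; exact/measurable_EFinP.
- exact/measurable_EFinP.
- by apply: aeW => x _ /=; apply: cvg_EFin; [exact: nearW|exact: cf].
- by apply: aeW => x k _ /=; rewrite lee_fin.
Qed.

End dominated.

Section fubini_real.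
Context d1 d2 (T1 : measurableType d1) (T2 : measurableType d2) (R : realType).
Variable m1 : {sigma_finite_measure set T1 -> \bar R}.
Variable m2 : {sigma_finite_measure set T2 -> \bar R}.

Lemma measurable_Rint (f : T1 * T2 -> R) : measurable_fun setT f ->
  measurable_fun setT (fun x => \int[m2]_y f (x, y)).
Proof.
move=> mf; apply: measurableT_comp => //=.
under eq_fun do rewrite integralE.
apply: emeasurable_funB.
- rewrite [X in measurable_fun _ X](_ : _ = fubini_F m2 ((EFin \o f)^\+)%E); last first.
    by apply/funext => x; apply: eq_integral => y _; rewrite !funeposE.
  apply: measurable_fun_fubini_tonelli_F => [|z]; last exact: funepos_ge0.
  by apply: measurable_funepos; exact/measurable_EFinP.
- rewrite [X in measurable_fun _ X](_ : _ = fubini_F m2 ((EFin \o f)^\-)%E); last first.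
    by apply/funext => x; apply: eq_integral => y _; rewrite !funenegE.
  apply: measurable_fun_fubini_tonelli_F => [|z]; last exact: funeneg_ge0.
  by apply: measurable_funeneg; exact/measurable_EFinP.
Qed.

(** The real-valued integral of a non-integrable slice would silently be 0. A
    dominating function in product form makes every slice integrable, not only
    almost every one, and this is why all double integrals below are bounded in
    this way. *)
Section product_bound.
Variables (f : T1 * T2 -> R) (A : T1 -> R) (B : T2 -> R).
Hypothesis mf : measurable_fun setT f.
Hypothesis iA : m1.-integrable setT (EFin \o A).
Hypothesis iB : m2.-integrable setT (EFin \o B).
Hypothesis fAB : forall x y, `|f (x, y)| <= A x * B y.

Lemma dom_slice2 x : m2.-integrable setT (EFin \o (fun y => f (x, y))).
Proof.
apply: (@dom_integrable _ _ _ _ _ (fun y => A x * B y)) => //.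
  exact: measurableT_comp.
exact: integrable_scale.
Qed.

Lemma dom_slice1 y : m1.-integrable setT (EFin \o (fun x => f (x, y))).
Proof.
apply: (@dom_integrable _ _ _ _ _ (fun x => B y * A x)) => //.
  exact: measurableT_comp.
  exact: integrable_scale.
by move=> x; rewrite mulrC.
Qed.

Lemma dom_prod_integrable : (m1 \x m2)%E.-integrable setT (EFin \o f).
Proof.
apply/integrable12ltyP; first exact/measurable_EFinP.
apply: (@le_lt_trans _ _ (\int[m1]_x (\int[m2]_y (A x * B y)%R)%:E)%E).
  apply: ge0_le_integral => //.
  - by move=> x _; exact: integral_ge0.
  - apply: (measurable_fun_fubini_tonelli_F (fun z => `|(f z)%:E|%E)) => //.
    by apply: measurableT_comp => //; exact/measurable_EFinP.
  - apply/measurable_EFinP; apply: (measurable_Rint (f := fun z => A z.1 * B z.2)).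
    by apply: measurable_funM; apply: measurableT_comp => //;
      apply/measurable_EFinP; exact: (measurable_int _ iA) || exact: (measurable_int _ iB).
  - move=> x _; rewrite EFin_Rint; last exact: integrable_scale.
    apply: ge0_le_integral => //.
    + by apply: measurableT_comp => //; apply/measurable_EFinP; exact: measurableT_comp.
    + exact: (measurable_int _ (integrable_scale (A x) iB)).
    + by move=> y _ /=; rewrite lee_fin.
rewrite (eq_integral (fun x => (\int[m2]_y B y)%:E * (A x)%:E)%E); last first.
  by move=> x _; rewrite RintegralZl// mulrC.
by rewrite integralZl// -EFin_Rint// -EFinM ltry.
Qed.

Lemma Rint_prod :
  \int[(m1 \x m2)%E]_z f z = \int[m1]_x \int[m2]_y f (x, y).
Proof.
rewrite /Rintegral; congr fine.
rewrite -(integral12_prod_meas1 dom_prod_integrable).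
by apply: eq_integral => x _; exact: (esym (EFin_Rint (dom_slice2 x))).
Qed.

Lemma Rfubini :
  \int[m1]_x \int[m2]_y f (x, y) = \int[m2]_y \int[m1]_x f (x, y).
Proof.
rewrite /Rintegral; congr fine.
transitivity (\int[m1]_x \int[m2]_y (EFin \o f) (x, y))%E.
  by apply: eq_integral => x _; exact: (EFin_Rint (dom_slice2 x)).
rewrite (Fubini dom_prod_integrable).
by apply: eq_integral => y _; exact: (esym (EFin_Rint (dom_slice1 y))).
Qed.

Lemma dom_Rint_prod :
  m1.-integrable setT (EFin \o (fun x => \int[m2]_y f (x, y))).
Proof.
apply: (@dom_integrable _ _ _ _ _ (fun x => \int[m2]_y B y * A x)).
- exact: measurable_Rint.
- exact: integrable_scale.
- move=> x; rewrite mulrC -RintegralZl//.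
  apply: dom_Rintegral => //; first exact: measurableT_comp.
  exact: integrable_scale.
Qed.

End product_bound.

End fubini_real.

Section fubini_real_swap.
Context d1 d2 (T1 : measurableType d1) (T2 : measurableType d2) (R : realType).
Variable m1 : {sigma_finite_measure set T1 -> \bar R}.
Variable m2 : {sigma_finite_measure set T2 -> \bar R}.

Lemma measurable_Rint2 (f : T1 * T2 -> R) : measurable_fun setT f ->
  measurable_fun setT (fun y => \int[m1]_x f (x, y)).
Proof.
move=> mf; apply: (@measurable_Rint _ _ T2 T1 R m1 (fun z => f (z.2, z.1))).
by apply: measurableT_comp mf _; exact: measurable_fun_pair.
Qed.

Lemma dom_Rint_prod2 (f : T1 * T2 -> R) (A : T1 -> R) (B : T2 -> R) :
  measurable_fun setT f ->
  m1.-integrable setT (EFin \o A) -> m2.-integrable setT (EFin \o B) ->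
  (forall x y, `|f (x, y)| <= A x * B y) ->
  m2.-integrable setT (EFin \o (fun y => \int[m1]_x f (x, y))).
Proof.
move=> mf iA iB fAB.
apply: (@dom_Rint_prod _ _ T2 T1 R m2 m1 (fun z => f (z.2, z.1)) B A) => //.
  by apply: measurableT_comp mf _; exact: measurable_fun_pair.
by move=> y x /=; rewrite mulrC.
Qed.

End fubini_real_swap.

(** * Lebesgue integrals over row vectors *)

Section rV_measurable.
Variable R : realType.

(** The sigma-algebra is generated by the coordinates while the topology is that
    of the sup norm: an open set is a union of sup-norm balls with rational
    centres and radii, which are countably many boxes. *)
Lemma open_rV_measurable n (U : set 'rV[R]_n) : open U -> measurable U.
Proof.
move=> oU.
pose B (qk : 'rV[rat]_n * nat) : set 'rV[R]_n :=
  [set v | forall i, `|v ord0 i - ratr (qk.1 ord0 i)| < qk.2.+1%:R^-1].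
have mB qk : measurable (B qk).
  rewrite (_ : B qk = \bigcap_(i in [set: 'I_n])
     ((fun v : 'rV[R]_n => `|v ord0 i - ratr (qk.1 ord0 i)|) @^-1`
       `]-oo, qk.2.+1%:R^-1[)).
    apply: fin_bigcap_measurable => // i _; rewrite -[X in measurable X]setTI.
    suff m : measurable_fun setT
        (fun v : 'rV[R]_n => `|v ord0 i - ratr (qk.1 ord0 i)|).
      by apply: m => //.
    apply: measurableT_comp => //; apply: measurable_funB => //.
    exact: (measurable_coord_rV i).
  apply/seteqP; split => v /= H i; first by move=> _ /=; rewrite in_itv/=.
  by have := H i I; rewrite /= in_itv.
pose F (m : nat) : set 'rV[R]_n :=
  if unpickle m is Some qk then (if `[< B qk `<=` U >] then B qk else set0)
  else set0.
have -> : U = \bigcup_m F m.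
  apply/seteqP; split => [v Uv|v [m _]]; last first.
    by rewrite /F; case: (unpickle m) => // qk; case: asboolP => // sub /sub.
  have /nbhs_ballP[e /= e0 eU] : nbhs v U by exact: open_nbhs_nbhs.
  have [k ke] : exists k : nat, k.+1%:R^-1 < e / 2.
    have [k _ /(_ k (leqnn k))] := near_infty_natSinv_lt (PosNum (divr_gt0 e0 (ltr0n _ 2))).
    by exists k.
  have kp : 0 < k.+1%:R^-1 :> R by rewrite invr_gt0 ltr0n.
  have /choice[q qP] : forall i, exists q : rat,
      `|v ord0 i - ratr q| < k.+1%:R^-1.
    move=> i; have /rat_in_itvoo[q] : v ord0 i - k.+1%:R^-1 < v ord0 i + k.+1%:R^-1.
      by rewrite ltrD2l gtrN.
    by rewrite in_itv/= => qi; exists q; rewrite distrC ltr_distl.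
  pose qk := (\row_i q i, k); exists (pickle qk) => //.
  rewrite /F pickleK; case: asboolP => [_|]; first by move=> i /=; rewrite mxE.
  case=> w Bw; apply: eU; split => // i j; rewrite ord1 /ball/=.
  have := Bw j; rewrite /= mxE => wq; have vq := qP j.
  rewrite (_ : _ - _ = (v ord0 j - ratr (q j)) - (w ord0 j - ratr (q j))); last by ring.
  rewrite (le_lt_trans (ler_normB _ _))// [ltRHS]splitr ltrD//.
    exact: lt_trans vq ke.
  exact: lt_trans wq ke.
apply: bigcupT_measurable => m; rewrite /F; case: (unpickle m) => // qk.
by case: asboolP.
Qed.

Lemma continuous_rV_measurable n (f : 'rV[R]_n -> R) :
  continuous f -> measurable_fun setT f.
Proof.
move=> cf; apply: (measurability _ (RGenOpens.measurableE R)).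
move=> _ [_ [a [b ->]] <-]; rewrite setTI.
apply: open_rV_measurable; apply: open_comp => //.
Qed.

Lemma measurable_row_mx m n d (T : measurableType d) (f : T -> 'rV[R]_m)
    (g : T -> 'rV[R]_n) : measurable_fun setT f -> measurable_fun setT g ->
  measurable_fun setT (fun x => row_mx (f x) (g x)).
Proof.
move=> mf mg; apply: measurable_fun_rVP => i.
rewrite (_ : _ \o _ = match fintype.split i with inl j => fun x => f x ord0 j
    | inr j => fun x => g x ord0 j end); last first.
  by apply/funext => x; rewrite /coord_rV /= mxE; case: fintype.split.
case: fintype.split => j.
- exact: (measurableT_comp (measurable_coord_rV j)).
- exact: (measurableT_comp (measurable_coord_rV j)).
Qed.

Lemma measurable_coord n d (T : measurableType d) (f : T -> 'rV[R]_n) i :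
  measurable_fun setT f -> measurable_fun setT (fun x => f x 0 i).
Proof. exact: (measurableT_comp (measurable_coord_rV i)). Qed.

Lemma measurable_dotp n d (T : measurableType d) (f g : T -> 'rV[R]_n) :
  measurable_fun setT f -> measurable_fun setT g ->
  measurable_fun setT (fun x => dotp (f x) (g x)).
Proof.
move=> mf mg; rewrite /dotp; apply: measurable_sum => i.
by apply: measurable_funM; exact: measurable_coord.
Qed.

Lemma measurable_rV_sub n d (T : measurableType d) (f g : T -> 'rV[R]_n) :
  measurable_fun setT f -> measurable_fun setT g ->
  measurable_fun setT (fun x => f x - g x).
Proof.
move=> mf mg; apply: measurable_fun_rVP => i.
rewrite (_ : _ \o _ = (fun x => f x 0 i - g x 0 i)); last first.
  by apply/funext => x; rewrite /coord_rV/= !mxE.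
by apply: measurable_funB; exact: measurable_coord.
Qed.

Lemma measurable_rV_add n d (T : measurableType d) (f g : T -> 'rV[R]_n) :
  measurable_fun setT f -> measurable_fun setT g ->
  measurable_fun setT (fun x => f x + g x).
Proof.
move=> mf mg; apply: measurable_fun_rVP => i.
rewrite (_ : _ \o _ = (fun x => f x 0 i + g x 0 i)); last first.
  by apply/funext => x; rewrite /coord_rV/= !mxE.
by apply: measurable_funD; exact: measurable_coord.
Qed.

Lemma measurable_rV_scale n d (T : measurableType d) (c : T -> R)
    (f : T -> 'rV[R]_n) :
  measurable_fun setT c -> measurable_fun setT f ->
  measurable_fun setT (fun x => c x *: f x).
Proof.
move=> mc mf; apply: measurable_fun_rVP => i.
rewrite (_ : _ \o _ = (fun x => c x * f x 0 i)); last first.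
  by apply/funext => x; rewrite /coord_rV/= !mxE.
by apply: measurable_funM => //; exact: measurable_coord.
Qed.

End rV_measurable.

Section rV_integral.
Variable R : realType.
Notation leb := (@lebesgue_measure R).
Notation mu := (lebesgue_rV R).

Lemma ge0_integral_rV_cons n (f : 'rV[R]_n.+1 -> \bar R) :
  measurable_fun setT f -> (forall v, 0 <= f v)%E ->
  (\int[mu n.+1]_v f v = \int[leb]_x \int[mu n]_v f (rV_cons (x, v)))%E.
Proof.
move=> mf f0.
transitivity (\int[pushforward (leb \x mu n)%E (@rV_cons R n)]_v f v)%E.
  apply: eq_measure_integral; first exact: measurable_rV_cons.
  by move=> ? D mD _.
rewrite ge0_integral_pushforward//=; first last.
  exact: measurable_rV_cons.
rewrite preimage_setT fubini_tonelli1//.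
apply: measurableT_comp => //; exact: measurable_rV_cons.
Qed.

Lemma Rint_rV_cons n (f : 'rV[R]_n.+1 -> R) (A : R -> R) (B : 'rV[R]_n -> R) :
  measurable_fun setT f ->
  leb.-integrable setT (EFin \o A) -> (mu n).-integrable setT (EFin \o B) ->
  (forall x v, `|f (rV_cons (x, v))| <= A x * B v) ->
  \int[mu n.+1]_v f v = \int[leb]_x \int[mu n]_v f (rV_cons (x, v)).
Proof.
move=> mf iA iB fAB.
have mfc : measurable_fun setT (f \o @rV_cons R n).
  by apply: measurableT_comp => //; exact: measurable_rV_cons.
rewrite -(Rint_prod (f := f \o @rV_cons R n) mfc iA iB)//.
rewrite /Rintegral; congr fine.
transitivity (\int[pushforward (leb \x mu n)%E (@rV_cons R n)]_v (f v)%:E)%E.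
  apply: eq_measure_integral; first exact: measurable_rV_cons.
  by move=> ? D mD _.
rewrite integral_pushforward//=.
- exact: measurable_rV_cons.
- exact/measurable_EFinP.
- rewrite preimage_setT; exact: (dom_prod_integrable mfc iA iB).
Qed.

Definition prodf n (F : 'I_n -> R -> R) (x : 'rV[R]_n) : R := \prod_i F i (x 0 i).

Lemma rV_consE0 n x (v : 'rV[R]_n) : rV_cons (x, v) 0 ord0 = x.
Proof. by rewrite mxE unlift_none. Qed.

Lemma rV_consE n x (v : 'rV[R]_n) i : rV_cons (x, v) 0 (lift ord0 i) = v 0 i.
Proof. by rewrite mxE liftK. Qed.

Lemma prodf_cons n (F : 'I_n.+1 -> R -> R) x v :
  prodf F (rV_cons (x, v)) = F ord0 x * prodf (fun i => F (lift ord0 i)) v.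
Proof.
rewrite /prodf big_ord_recl rV_consE0; congr (_ * _).
by apply: eq_bigr => i _; rewrite rV_consE.
Qed.

Lemma prodf_ge0 n (F : 'I_n -> R -> R) v :
  (forall i x, 0 <= F i x) -> 0 <= prodf F v.
Proof. by move=> F0; apply: prodr_ge0. Qed.

Lemma measurable_prodf n (F : 'I_n -> R -> R) :
  (forall i, measurable_fun setT (F i)) -> measurable_fun setT (prodf F).
Proof.
move=> mF; apply: measurable_prod => i _.
exact: measurableT_comp (mF i) (measurable_coord_rV i).
Qed.

Lemma integral_prodf_le n (F : 'I_n -> R -> R) (c : 'I_n -> R) :
  (forall i, measurable_fun setT (F i)) -> (forall i x, 0 <= F i x) ->
  (forall i, 0 <= c i) ->
  (forall i, \int[leb]_x (F i x)%:E <= (c i)%:E)%E ->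
  (\int[mu n]_v (prodf F v)%:E <= (\prod_i c i)%:E)%E.
Proof.
elim: n F c => [|n IH] F c mF F0 c0 Fc.
  rewrite integral_dirac//; last first.
    by apply/measurable_EFinP; exact: measurable_prodf.
  by rewrite diracT mul1e /prodf !big_ord0.
rewrite ge0_integral_rV_cons; first last.
- by move=> v; rewrite lee_fin prodf_ge0.
- by apply/measurable_EFinP; exact: measurable_prodf.
have mp : measurable_fun setT (prodf (fun i => F (lift ord0 i))).
  exact: measurable_prodf.
under eq_integral => x _.
  under eq_integral do rewrite prodf_cons EFinM.
  rewrite ge0_integralZl//; first last.
  - by rewrite lee_fin.
  - by move=> v _; rewrite lee_fin prodf_ge0.
  - exact/measurable_EFinP.
  over.
rewrite ge0_integralZr//; first last.
- by apply: integral_ge0 => v _; rewrite lee_fin prodf_ge0.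
- by move=> x _; rewrite lee_fin.
- by apply/measurable_EFinP; exact: (mF ord0).
rewrite big_ord_recl EFinM; apply: lee_pmul => //.
- by apply: integral_ge0 => v _; rewrite lee_fin.
- by apply: integral_ge0 => v _; rewrite lee_fin prodf_ge0.
- exact: IH.
Qed.

(** Monotone convergence along the intervals [-k, k]. *)
Lemma integral_le_antideriv (f F : R -> R) (K : R) :
  continuous f -> (forall x, 0 <= f x) -> (forall x : R, is_derive x 1 F (f x)) ->
  (forall x, `|F x| <= K) -> (\int[leb]_x (f x)%:E <= (K *+ 2)%:E)%E.
Proof.
move=> cf f0 dF bF.
pose I k : set R := `[- (k.+1%:R), k.+1%:R]%classic.
have IT : \bigcup_k I k = setT.
  apply/seteqP; split => // x _; exists (Num.truncn `|x|) => //.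
  rewrite /I /= in_itv/= -ler_norml ltW//.
  exact: truncnS_gt.
have cvI : (\int[leb]_(x in I k) (f x)%:E)%E @[k --> \oo] -->
    (\int[leb]_x (f x)%:E)%E.
  rewrite -IT; apply: (@ge0_nondecreasing_set_cvg_integral _ (measurableTypeR R)).
  - move=> i j ij; apply/subsetPset => x; rewrite /I /= !in_itv /= -!ler_norml.
    by move=> /le_trans; apply; rewrite ler_nat ltnS.
  - by move=> i; exact: measurable_itv.
  - move=> i; apply: measurable_funTS; apply/measurable_EFinP.
    exact: continuous_measurable_fun.
  - by move=> i x _; rewrite lee_fin.
rewrite -(cvg_lim _ cvI)//; apply: lime_le; first by apply/cvg_ex; eexists; exact: cvI.
apply: nearW => k.
have kk : - (k.+1%:R) < k.+1%:R :> R.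
  by rewrite (@lt_trans _ _ 0)// ?oppr_lt0 ltr0n.
have dF1 x : derivable F x 1 by have [] := dF x.
have cF : continuous F.
  by move=> x; apply: differentiable_continuous; apply/derivable1_diffP.
rewrite (@continuous_FTC2 _ f F)//.
- rewrite -EFinB lee_fin mulr2n.
  have := bF (k.+1%:R); have := bF (- k.+1%:R).
  by rewrite !ler_norml => /andP[? ?] /andP[? ?]; lra.
- exact: continuous_subspaceT.
- split => //; first by apply: cvg_at_right_filter; exact: cF.
  by apply: cvg_at_left_filter; exact: cF.
- by move=> x _; rewrite derive1E; have [_] := dF x.
Qed.

End rV_integral.

(** The Cauchy weight is both the gain of one integration by parts of second
    order in each coordinate and an integrable majorant that is stable under
    convolution. *)
Section cauchy_weight.
Variable R : realType.
Notation leb := (@lebesgue_measure R).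
Notation mu := (lebesgue_rV R).

Definition cw (t : R) : R := (1 + t ^+ 2)^-1.

Lemma cw_den_gt0 t : 0 < 1 + t ^+ 2 :> R.
Proof. by rewrite ltr_pwDl// sqr_ge0. Qed.

Lemma cw_gt0 t : 0 < cw t. Proof. by rewrite invr_gt0 cw_den_gt0. Qed.
Lemma cw_ge0 t : 0 <= cw t. Proof. exact/ltW/cw_gt0. Qed.
Lemma cw_le1 t : cw t <= 1.
Proof. by rewrite invf_le1 ?cw_den_gt0// lerDl sqr_ge0. Qed.
Lemma cwN t : cw (- t) = cw t. Proof. by rewrite /cw sqrrN. Qed.
Lemma cwE t : cw t * (1 + t ^+ 2) = 1.
Proof. by rewrite mulVf// gt_eqF// cw_den_gt0. Qed.

Lemma continuous_cw : continuous cw.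
Proof.
move=> t; apply: cvgV; first by rewrite gt_eqF// cw_den_gt0.
by apply: cvgD; [exact: cvg_cst|exact: exprn_continuous].
Qed.

Lemma measurable_cw : measurable_fun setT cw.
Proof. exact: continuous_measurable_fun continuous_cw. Qed.

(** Peetre's inequality: it amounts to 1 + t^2 <= 2 (1 + s^2) (1 + (s - t)^2). *)
Lemma cw_peetre s t : cw s * cw (s - t) <= 2 * cw t.
Proof.
rewrite /cw -invfM ler_pdivlMr ?cw_den_gt0// mulrC ler_pdivrMr; last first.
  by rewrite mulr_gt0// cw_den_gt0.
have := sqr_ge0 (s * (s - t)); have := sqr_ge0 (2 * s - t).
by rewrite !expr2; nra.
Qed.

Lemma integral_cw (l s : R) : 0 < l ->
  (\int[leb]_x (cw (l * (x - s)))%:E <= (pi / l)%:E)%E.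
Proof.
move=> l0; have -> : pi / l = (pi / 2 / l) *+ 2 by rewrite mulr2n; field; rewrite gt_eqF.
apply: (@integral_le_antideriv _ _ (fun x => atan (l * (x - s)) / l)).
- move=> x; apply: (continuous_comp (f := fun x => l * (x - s))) => //; last exact: continuous_cw.
  by apply: cvgM; [exact: cvg_cst|apply: cvgB; [exact: cvg_id|exact: cvg_cst]].
- by move=> x; exact: cw_ge0.
- move=> x; have -> : cw (l * (x - s)) = (cw (l * (x - s)) * l) / l.
    by rewrite mulfK// gt_eqF.
  have da (y : R) : is_derive y 1 (@atan R) (cw y).
    by apply: DeriveDef; [exact: derivable_atan|rewrite -derive1E derive1_atan].
  have dl : is_derive x 1 (fun x => l * (x - s)) l.
    by apply: is_derive_eq; rewrite subr0 /GRing.scale/= mulr1.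
  have dc := @is_derive1_comp _ (@atan R) (fun x => l * (x - s)) _ _ _ (da (l * (x - s))) dl.
  by apply: is_derive_eq; rewrite scaler0 add0r /GRing.scale/= mulrC.
- move=> x; rewrite normrM [X in _ * X]gtr0_norm ?invr_gt0//.
  rewrite ler_pM2r ?invr_gt0// ler_norml.
  by rewrite !ltW ?atan_gtNpi2 ?atan_ltpi2.
Qed.

End cauchy_weight.

(** * Functions dominated together with their derivatives *)

Section continuity.
Variables (R : realType) (T : topologicalType).
Implicit Types f g : T -> R.

Lemma contD f g : continuous f -> continuous g ->
  continuous (fun x => f x + g x).
Proof. by move=> cf cg x; apply: cvgD; [exact: cf|exact: cg]. Qed.

Lemma contM f g : continuous f -> continuous g ->
  continuous (fun x => f x * g x).
Proof. by move=> cf cg x; apply: cvgM; [exact: cf|exact: cg]. Qed.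

Lemma contZ (c : R) f : continuous f -> continuous (fun x => c * f x).
Proof. by move=> cf; apply: contM => //; exact: cst_continuous. Qed.

End continuity.

Section derive_lines.
Variable R : realType.

(** Derivability along v depends only on the restriction to a line. *)
Lemma is_derive_lineP (V : normedModType R) (f : V -> R) (x v : V) (df : R) :
  is_derive (0 : R) 1 (fun h : R => f (h *: v + x)) df <-> is_derive x v f df.
Proof.
have E : (fun h : R => h^-1 *: ((f \o shift x) (h *: v) - f x)) =
    (fun h : R => h^-1 *: (((fun h : R => f (h *: v + x)) \o shift 0) (h *: 1)
       - (fun h : R => f (h *: v + x)) 0)).
  by apply/funext => h /=; rewrite addr0 scale0r add0r [_%:A]mulr1.
split=> -[d1 d2]; apply: DeriveDef.
- by rewrite /derivable E.
- by rewrite -d2 /derive E.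
- by move: d1; rewrite /derivable E.
- by rewrite -d2 /derive E.
Qed.

Lemma is_derive_affine (U V : normedModType R) (L : U -> V) (f : V -> R)
    (x v : U) (w : V) (c df : R) :
  (forall t : R, L (t *: v + x) = (t * c) *: w + L x) ->
  is_derive (L x) w f df -> is_derive x v (f \o L) (c * df).
Proof.
move=> HL /is_derive_lineP df0; apply/is_derive_lineP.
have -> : (fun h : R => (f \o L) (h *: v + x)) =
    (fun s : R => f (s *: w + L x)) \o (fun h : R => h * c).
  by apply/funext => h /=; rewrite HL.
have dc : is_derive (0 : R) 1 (fun h : R => h * c) c.
  by apply: is_derive_eq; rewrite scaler0 add0r /GRing.scale/= mulr1.
have {}df0 : is_derive (0 * c) 1 (fun s : R => f (s *: w + L x)) df by rewrite mul0r.
have := @is_derive1_comp _ (fun s : R => f (s *: w + L x)) (fun h => h * c)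
  0 df c df0 dc.
by rewrite mulrC.
Qed.

End derive_lines.

Section smooth_le.
Variable R : realType.

Definition pd n (j : 'I_n) (f : 'rV[R]_n -> R) : 'rV[R]_n -> R :=
  fun x => 'D_(delta_mx 0 j) f x.

(** A single weight serves all orders: the estimates use bounded derivatives and
    not the decay that a symbol gains by differentiation. In return the class is
    stable under products, affine substitutions and differential operators, with
    explicit weights. *)
Fixpoint smooth_le n (N : nat) (w f : 'rV[R]_n -> R) : Prop :=
  [/\ continuous f, forall x, `|f x| <= w x &
    if N is N'.+1 then
      forall j, (forall x, derivable f x (delta_mx 0 j)) /\
        smooth_le N' w (pd j f)
    else True].

Section basic.
Variable n : nat.
Implicit Types (f g w : 'rV[R]_n -> R) (N : nat).

Lemma smooth_le_cont N w f : smooth_le N w f -> continuous f.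
Proof. by case: N => [|N] []. Qed.

Lemma smooth_le_norm N w f : smooth_le N w f -> forall x, `|f x| <= w x.
Proof. by case: N => [|N] []. Qed.

Lemma smooth_le_meas N w f : smooth_le N w f -> measurable_fun setT f.
Proof. by move=> /smooth_le_cont; exact: continuous_rV_measurable. Qed.

Lemma smooth_le_w0 N w f : smooth_le N w f -> forall x, 0 <= w x.
Proof. by move=> /smooth_le_norm fw x; exact: le_trans (fw x). Qed.

Lemma smooth_le_pd N w f j : smooth_le N.+1 w f -> smooth_le N w (pd j f).
Proof. by move=> [_ _ /(_ j)[]]. Qed.

Lemma smooth_le_derive N w f j : smooth_le N.+1 w f ->
  forall x, is_derive x (delta_mx 0 j) f (pd j f x).
Proof. by move=> [_ _ /(_ j)[df _]] x; exact: derivableP. Qed.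

Lemma smooth_leS N w f : smooth_le N.+1 w f -> smooth_le N w f.
Proof.
elim: N f => [|N IH] f [cf bf df]; first by split.
by split => // j; have [dj sj] := df j; split => //; exact: IH.
Qed.

Lemma smooth_le_anti N M w f : (M <= N)%N -> smooth_le N w f -> smooth_le M w f.
Proof.
move=> /subnK <-; elim: (N - M)%N => [//|k IH].
by rewrite addSn => /smooth_leS.
Qed.

Lemma smooth_le_weight N w w' f : (forall x, w x <= w' x) ->
  smooth_le N w f -> smooth_le N w' f.
Proof.
move=> ww'; elim: N f => [|N IH] f [cf bf df]; split => //.
- by move=> x; exact: le_trans (bf x) (ww' x).
- by move=> x; exact: le_trans (bf x) (ww' x).
- by move=> j; have [dj sj] := df j; split => //; exact: IH.
Qed.

Lemma pdD j f g : (forall x, derivable f x (delta_mx 0 j)) ->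
  (forall x, derivable g x (delta_mx 0 j)) ->
  pd j (fun x => f x + g x) = (fun x => pd j f x + pd j g x).
Proof. by move=> df dg; apply/funext => x; rewrite /pd (deriveD (df x) (dg x)). Qed.

Lemma pdM j f g : (forall x, derivable f x (delta_mx 0 j)) ->
  (forall x, derivable g x (delta_mx 0 j)) ->
  pd j (fun x => f x * g x) = (fun x => pd j f x * g x + f x * pd j g x).
Proof.
move=> df dg; apply/funext => x; rewrite /pd (deriveM (df x) (dg x)).
by rewrite addrC /GRing.scale/= mulrC.
Qed.

Lemma pdZ j (c : R) f : (forall x, derivable f x (delta_mx 0 j)) ->
  pd j (fun x => c * f x) = (fun x => c * pd j f x).
Proof. by move=> df; apply/funext => x; rewrite /pd; exact: (deriveZ c (df x)). Qed.

Lemma smooth_leD N w w' f g : smooth_le N w f -> smooth_le N w' g ->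
  smooth_le N (fun x => w x + w' x) (fun x => f x + g x).
Proof.
elim: N f g => [|N IH] f g [cf bf df] [cg bg dg]; split => //.
- exact: contD.
- by move=> x; rewrite (le_trans (ler_normD _ _))// lerD.
- exact: contD.
- by move=> x; rewrite (le_trans (ler_normD _ _))// lerD.
- move=> j; have [dfj sfj] := df j; have [dgj sgj] := dg j; split.
    by move=> x; exact: (derivableD (dfj x) (dgj x)).
  by rewrite pdD//; exact: IH.
Qed.

Lemma smooth_leZ N w (c : R) f : smooth_le N w f ->
  smooth_le N (fun x => `|c| * w x) (fun x => c * f x).
Proof.
elim: N f => [|N IH] f [cf bf df]; split => //.
- exact: contZ.
- by move=> x; rewrite normrM ler_wpM2l.
- exact: contZ.
- by move=> x; rewrite normrM ler_wpM2l.
- move=> j; have [dfj sfj] := df j; split.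
    by move=> x; exact: (derivableM (derivable_cst c x _) (dfj x)).
  by rewrite pdZ//; exact: IH.
Qed.

Lemma smooth_leM N w w' f g : smooth_le N w f -> smooth_le N w' g ->
  smooth_le N (fun x => 2 ^+ N * (w x * w' x)) (fun x => f x * g x).
Proof.
elim: N f g => [|N IH] f g sf sg.
  have [cf bf df] := sf; have [cg bg dg] := sg; split => //.
    exact: contM.
  by move=> x; rewrite expr0 mul1r normrM ler_pM.
have [cf bf df] := sf; have [cg bg dg] := sg; split => //.
- exact: contM.
- move=> x; rewrite normrM (@le_trans _ _ (1 * (w x * w' x)))//.
    by rewrite mul1r ler_pM.
  rewrite ler_wpM2r ?exprn_ege1 ?ler1n//.
  by rewrite mulr_ge0 ?(smooth_le_w0 sf) ?(smooth_le_w0 sg).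
- move=> j; have [dfj sfj] := df j; have [dgj sgj] := dg j; split.
    by move=> x; exact: (derivableM (dfj x) (dgj x)).
  rewrite pdM//; apply: (@smooth_le_weight _ (fun x =>
      2 ^+ N * (w x * w' x) + 2 ^+ N * (w x * w' x))).
    by move=> x; rewrite exprS -mulrA mulr_natl mulr2n.
  by apply: smooth_leD; apply: IH => //; exact: smooth_leS.
Qed.

Lemma smooth_le_cst N (c : R) :
  smooth_le N (fun _ : 'rV[R]_n => `|c|) (fun=> c : R).
Proof.
elim: N c => [|N IH] c; split => //; try exact: cst_continuous.
move=> j.
split; first by move=> x; exact: derivable_cst.
have -> : pd j (fun=> c) = (fun=> 0).
  by apply/funext => x; rewrite /pd; exact: derive_cst.
by apply: smooth_le_weight (IH 0) => x; rewrite normr0.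
Qed.

Lemma smooth_le_prod N (I : Type) (r : seq I) (W F : I -> 'rV[R]_n -> R) :
  (forall i, smooth_le N (W i) (F i)) ->
  smooth_le N (fun x => 2 ^+ (N * size r) * \prod_(i <- r) W i x)
    (fun x => \prod_(i <- r) F i x).
Proof.
move=> H; elim: r => [|i r IH].
  under eq_fun do rewrite muln0 expr0 mul1r big_nil.
  under [X in smooth_le _ _ X]eq_fun do rewrite big_nil.
  by have := smooth_le_cst N 1; rewrite normr1.
under [X in smooth_le _ _ X]eq_fun do rewrite big_cons.
apply: smooth_le_weight (smooth_leM (H i) IH) => x.
by rewrite big_cons mulnS exprD -!mulrA ler_wpM2l ?exprn_ge0// mulrCA.
Qed.

End basic.

(** The chain rule for a map that sends each coordinate direction to a multiple
    of a coordinate direction; every substitution needed below is of this kind. *)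
Lemma smooth_le_comp m n N (w f : 'rV[R]_n -> R) (L : 'rV[R]_m -> 'rV[R]_n)
    (s : 'I_m -> 'I_n) (c : 'I_m -> R) :
  continuous L -> (forall j, `|c j| <= 1) ->
  (forall j x (t : R),
     L (t *: delta_mx 0 j + x) = (t * c j) *: delta_mx 0 (s j) + L x) ->
  smooth_le N w f -> smooth_le N (w \o L) (f \o L).
Proof.
move=> cL c1 HL; elim: N f => [|N IH] f sf; have [cf bf df] := sf.
  by split => // [x|x]; [apply: continuous_comp; [exact: cL|exact: cf]|exact: bf].
split => // [x|x|j].
- by apply: continuous_comp; [exact: cL|exact: cf].
- exact: bf.
have dL x := is_derive_affine (HL j x) (smooth_le_derive (s j) sf (L x)).
split; first by move=> x; have [] := dL x.
have -> : pd j (f \o L) = (fun x => c j * (pd (s j) f \o L) x).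
  by apply/funext => x; have [_ ] := dL x.
apply: smooth_le_weight (smooth_leZ (c j) (IH _ (smooth_le_pd (s j) sf))) => x.
by rewrite ler_piMl// (smooth_le_w0 sf).
Qed.

(** There are finitely many derivatives of order at most N, so their constants
    can be added. *)
Lemma smooth_smooth_le n (w f : 'rV[R]_n -> R) : (forall x, 0 <= w x) ->
  smooth f -> (forall s, exists C, forall x, `|partials s f x| <= C * w x) ->
  forall N, exists2 C, 0 <= C & smooth_le N (fun x => C * w x) f.
Proof.
move=> w0 sf bf N; elim: N f sf bf => [|N IH] f sf bf.
  have [C HC] := bf [::]; exists `|C| => //; split => //.
    by have [] := sf [::].
  by move=> x; rewrite (le_trans (HC x))// ler_wpM2r ?ler_norm.
have H j : exists2 C, 0 <= C & smooth_le N (fun x => C * w x) (pd j f).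
  apply: IH => s.
    by have := sf (rcons s j); rewrite /partials foldr_rcons.
  by have := bf (rcons s j); rewrite /partials foldr_rcons.
have [C C0 HC] : exists2 C : 'I_n -> R, (forall j, 0 <= C j) &
    forall j, smooth_le N (fun x => C j * w x) (pd j f).
  have H' j : exists C, 0 <= C /\ smooth_le N (fun x => C * w x) (pd j f).
    by have [C ? ?] := H j; exists C.
  by have [C CP] := choice H'; exists C => j; have [] := CP j.
have [C' HC'] := bf [::].
have S0 : 0 <= \sum_j C j by exact: sumr_ge0.
exists (`|C'| + \sum_j C j); first by rewrite addr_ge0.
have [cf df] := sf [::].
split => // [x|j].
  rewrite (le_trans (HC' x))// ler_wpM2r// (le_trans (ler_norm _))//.
  by rewrite lerDl.
split; first by move=> x; exact: df.
apply: smooth_le_weight (HC j) => x; rewrite ler_wpM2r//.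
rewrite (bigD1 j)//= addrCA lerDl addr_ge0// sumr_ge0//.
Qed.

End smooth_le.

Section cont_rV.
Variable R : realType.

Lemma continuous_rVP (T : topologicalType) n (L : T -> 'rV[R]_n) :
  (forall i, continuous (fun x => L x 0 i)) -> continuous L.
Proof.
move=> cL x A [P nP sub].
have H : \forall y \near x, forall i : 'I_n, P 0 i (L y 0 i).
  apply: filter_forall => i; exact: (cL i x _ (nP 0 i)).
apply: filterS H => y Hy; apply: sub => i j /=.
by rewrite ord1; exact: Hy.
Qed.

Lemma continuous_coord n i : continuous (fun x : 'rV[R]_n => x 0 i).
Proof. exact: coord_continuous. Qed.

Lemma continuous_sum (T : topologicalType) (I : Type) (r : seq I)
    (f : I -> T -> R) : (forall i, continuous (f i)) ->
  continuous (fun x => \sum_(i <- r) f i x).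
Proof.
move=> cf; elim: r => [|i r IH].
  by under eq_fun do rewrite big_nil; exact: cst_continuous.
by under eq_fun do rewrite big_cons; exact: contD.
Qed.

End cont_rV.

(** * Functions of one variable and the product weight *)

Section one_variable.
Variable R : realType.

(** For a class of functions of one variable that is closed under
    differentiation, a bound on all members is a bound on all derivatives of
    each of them; this avoids any formula for the iterated derivatives. *)
Lemma smooth_le_line (G : (R -> R) -> Prop) (w : R -> R) :
  (forall f, G f -> [/\ continuous f, exists2 C : R, 0 <= C & forall t, `|f t| <= C * w t
     & exists2 f', G f' & forall t : R, is_derive t 1 f (f' t)]) ->
  forall N f, G f -> exists2 C : R, 0 <= C &
    smooth_le N (fun v : 'rV[R]_1 => C * w (v 0 0)) (fun v => f (v 0 0)).
Proof.
move=> HG; elim=> [|N IH] f Gf; have [cf [C C0 fC] [f' Gf' df]] := HG f Gf.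
  exists C => //; split => //.
  by move=> v; apply: (continuous_comp (@continuous_coord R 1 0 v)); exact: cf.
have [C' C'0 sf'] := IH _ Gf'.
have w0 t : 0 <= C * w t by exact: le_trans (fC t).
have w0' t : 0 <= C' * w t.
  by have := smooth_le_w0 sf' (const_mx t); rewrite mxE.
exists (C + C'); first exact: addr_ge0.
split => [|v|j].
- by move=> v; apply: (continuous_comp (@continuous_coord R 1 0 v)); exact: cf.
- by rewrite mulrDl (le_trans (fC _))// lerDl.
have dj (v : 'rV[R]_1) :
    is_derive v (delta_mx 0 j) (f \o (fun v : 'rV[R]_1 => v 0 0)) (1 * f' (v 0 0)).
  apply: (@is_derive_affine _ _ _ (fun v : 'rV[R]_1 => v 0 0) f v (delta_mx 0 j) 1) => //.
  by move=> t; rewrite !mxE (ord1 j) !eqxx [_%:A]mulr1.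
split; first by move=> v; have [] := dj v.
have -> : pd j (fun v : 'rV[R]_1 => f (v 0 0)) = (fun v => f' (v 0 0)).
  by apply/funext => v; have [_ ] := dj v; rewrite mul1r.
by apply: smooth_le_weight sf' => v; rewrite mulrDl lerDr.
Qed.

Lemma smooth_le_lin m N (b : 'I_m -> R) (w f : R -> R) :
  (forall j, `|b j| <= 1) ->
  smooth_le N (fun v : 'rV[R]_1 => w (v 0 0)) (fun v => f (v 0 0)) ->
  smooth_le N (fun x : 'rV[R]_m => w (\sum_j b j * x 0 j))
    (fun x : 'rV[R]_m => f (\sum_j b j * x 0 j)).
Proof.
move=> b1 sf.
pose L (x : 'rV[R]_m) : 'rV[R]_1 := const_mx (\sum_j b j * x 0 j).
have cL : continuous L.
  apply: continuous_rVP => i; under eq_fun do rewrite mxE.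
  apply: continuous_sum => j; apply: contZ; exact: continuous_coord.
have HL j x (t : R) : L (t *: delta_mx 0 j + x) = (t * b j) *: delta_mx 0 0 + L x.
  apply/rowP => i; rewrite !mxE !ord1 /= mulr1.
  under eq_bigr => k _ do rewrite !mxE mulrDr.
  rewrite big_split/= (bigD1 j)//= !eqxx /= mulr1 mulrC big1 ?addr0// => k kj.
  by rewrite (negbTE kj) /= !mulr0.
have := smooth_le_comp cL b1 HL sf.
rewrite /comp /L.
by under eq_fun do rewrite mxE; under [X in smooth_le _ _ X]eq_fun do rewrite mxE.
Qed.

Lemma smooth_le_coord m N (i : 'I_m) (w f : R -> R) :
  smooth_le N (fun v : 'rV[R]_1 => w (v 0 0)) (fun v => f (v 0 0)) ->
  smooth_le N (fun x : 'rV[R]_m => w (x 0 i)) (fun x : 'rV[R]_m => f (x 0 i)).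
Proof.
move=> sf.
have E (x : 'rV[R]_m) : \sum_j (j == i)%:R * x 0 j = x 0 i.
  rewrite (bigD1 i)//= eqxx mul1r big1 ?addr0// => k ki.
  by rewrite (negbTE ki) mul0r.
have -> : (fun x : 'rV[R]_m => w (x 0 i)) =
    (fun x => w (\sum_j (j == i)%:R * x 0 j)) by apply/funext => x; rewrite E.
have -> : (fun x : 'rV[R]_m => f (x 0 i)) =
    (fun x => f (\sum_j (j == i)%:R * x 0 j)) by apply/funext => x; rewrite E.
by apply: smooth_le_lin => // j; case: eqP => _; rewrite ?normr1 ?normr0.
Qed.

(** Derivatives of cw are polynomials in cw and t cw, times cw; only the closure
    of this class under differentiation matters. *)
Inductive cw_alg : (R -> R) -> Prop :=
| cw_alg_base : cw_alg (@cw R)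
| cw_alg_cw f : cw_alg f -> cw_alg (fun t => cw t * f t)
| cw_alg_tcw f : cw_alg f -> cw_alg (fun t => t * cw t * f t)
| cw_alg_add f g : cw_alg f -> cw_alg g -> cw_alg (fun t => f t + g t)
| cw_alg_scale (c : R) f : cw_alg f -> cw_alg (fun t => c * f t).

Lemma tcw_le1 (t : R) : `|t * cw t| <= 1.
Proof.
rewrite normrM (ger0_norm (cw_ge0 t)) /cw ler_pdivrMr ?cw_den_gt0// mul1r.
rewrite ler_norml; have := sqr_ge0 (t - 1); have := sqr_ge0 (t + 1).
by have := ler_norm t; case: (lerP 0 t) => ?; rewrite !expr2; nra.
Qed.

Lemma is_derive_cw (t : R) : is_derive t 1 (@cw R) (- 2 * (t * cw t) * cw t).
Proof.
have nz : 1 + t ^+ 2 != 0 by rewrite gt_eqF// cw_den_gt0.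
have d1 : is_derive t 1 (fun t : R => 1 + t ^+ 2) (2 * t).
  by apply: is_derive_eq; rewrite add0r mul1r /GRing.scale/= mulr1; ring.
have := @is_deriveV _ (fun t : R => 1 + t ^+ 2) t _ _ nz d1.
move=> d2; apply: (is_derive_eq d2).
rewrite /cw /GRing.scale/=; field; exact: nz.
Qed.

Lemma cw_alg_closed f : cw_alg f ->
  [/\ continuous f, exists2 C : R, 0 <= C & forall t, `|f t| <= C * cw t
     & exists2 f', cw_alg f' & forall t : R, is_derive t 1 f (f' t)].
Proof.
elim=> {f} [|f Gf [cf [C C0 bf] [f' Gf' df]]|f Gf [cf [C C0 bf] [f' Gf' df]]
  |f g Gf [cf [C C0 bf] [f' Gf' df]] Gg [cg [D D0 bg] [g' Gg' dg]]
  |c f Gf [cf [C C0 bf] [f' Gf' df]]].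
- split; first exact: continuous_cw.
    by exists 1 => // t; rewrite mul1r ger0_norm// cw_ge0.
  exists (fun t => - 2 * (t * cw t * cw t)).
    exact/cw_alg_scale/cw_alg_tcw/cw_alg_base.
  by move=> t; rewrite mulrA; exact: is_derive_cw.
- split; first by apply: contM => //; exact: continuous_cw.
    exists C => // t; rewrite normrM (ger0_norm (cw_ge0 t)) (le_trans _ (bf t))//.
    by rewrite ler_piMl// cw_le1.
  exists (fun t => - 2 * (t * cw t * (cw t * f t)) + cw t * f' t).
    apply: cw_alg_add; last exact: cw_alg_cw.
    exact/cw_alg_scale/cw_alg_tcw/cw_alg_cw.
  move=> t; apply: (is_derive_eq (is_deriveM (is_derive_cw t) (df t))).
  by rewrite /GRing.scale/=; ring.
- split.
  + apply: contM => //; apply: contM; last exact: continuous_cw.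
    by move=> x; exact: cvg_id.
  + exists C => // t; rewrite normrM (le_trans _ (bf t))//.
    by rewrite ler_piMl// tcw_le1.
  + exists (fun t => 2 * (cw t * (cw t * f t)) + (- 1 * (cw t * f t) + t * cw t * f' t)).
      apply: cw_alg_add; first exact/cw_alg_scale/cw_alg_cw/cw_alg_cw.
      apply: cw_alg_add; last exact: cw_alg_tcw.
      exact/cw_alg_scale/cw_alg_cw.
    move=> t.
    have dt := is_deriveM (is_derive_id t 1) (is_derive_cw t).
    apply: (is_derive_eq (is_deriveM dt (df t))).
    rewrite /GRing.scale/= !mulr1.
    have -> : 2 * (cw t * (cw t * f t)) =
        2 * (cw t * f t) * (1 - t ^+ 2 * cw t).
      have -> : 1 - t ^+ 2 * cw t = cw t.
        by rewrite -[X in X - _](cwE t); ring.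
      by ring.
    rewrite (_ : (id * @cw R) t = t * cw t)//; ring.
- split; first exact: contD.
    exists (C + D); first exact: addr_ge0.
    by move=> t; rewrite mulrDl (le_trans (ler_normD _ _))// lerD.
  exists (fun t => f' t + g' t); first exact: cw_alg_add.
  by move=> t; exact: (is_deriveD (df t) (dg t)).
- split; first exact: contZ.
    exists (`|c| * C); first exact: mulr_ge0.
    by move=> t; rewrite normrM -mulrA ler_wpM2l.
  exists (fun t => c * f' t); first exact: cw_alg_scale.
  by move=> t; exact: (is_deriveZ c (df t)).
Qed.

Lemma smooth_le_cw N : exists2 C : R, 0 <= C &
  smooth_le N (fun v : 'rV[R]_1 => C * cw (v 0 0)) (fun v => cw (v 0 0)).
Proof. exact: (smooth_le_line cw_alg_closed N cw_alg_base). Qed.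

End one_variable.

Section weights.
Variable R : realType.
Notation mu := (lebesgue_rV R).

(** The product weight, and not a power of 1 + |x|^2, because it factorizes
    under the identification of R^(n+1) with R x R^n on which all inductions
    rely. *)
Definition wgt n : 'rV[R]_n -> R := prodf (fun _ => @cw R).

Lemma wgt_gt0 n (x : 'rV[R]_n) : 0 < wgt x.
Proof. by apply: prodr_gt0 => i _; exact: cw_gt0. Qed.
Lemma wgt_ge0 n (x : 'rV[R]_n) : 0 <= wgt x.
Proof. exact/ltW/wgt_gt0. Qed.
Lemma wgt_le1 n (x : 'rV[R]_n) : wgt x <= 1.
Proof. by apply: prodr_ile1 => i _; rewrite cw_ge0 cw_le1. Qed.

Lemma wgtN n (x : 'rV[R]_n) : wgt (- x) = wgt x.
Proof. by apply: eq_bigr => i _; rewrite mxE cwN. Qed.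

Lemma wgt_cons n x (v : 'rV[R]_n) : wgt (rV_cons (x, v)) = cw x * wgt v.
Proof. exact: prodf_cons. Qed.

Lemma wgt_peetre n (s t : 'rV[R]_n) : wgt s * wgt (s - t) <= 2 ^+ n * wgt t.
Proof.
rewrite /wgt /prodf -big_split/= -[X in 2 ^+ X](card_ord n) -prodr_const -big_split/=.
apply: ler_prod => i _; rewrite mulr_ge0 ?cw_ge0//= !mxE; exact: cw_peetre.
Qed.

Lemma measurable_wgt n : measurable_fun setT (@wgt n).
Proof. by apply: measurable_prodf => i; exact: measurable_cw. Qed.

Lemma wgt_scale_int n (l : R) (s : 'rV[R]_n) : 0 < l ->
  (mu n).-integrable setT (EFin \o (fun x => wgt (l *: (x - s)))) /\
  \int[mu n]_x wgt (l *: (x - s)) <= (pi / l) ^+ n.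
Proof.
move=> l0.
have E : (fun x => wgt (l *: (x - s))) = prodf (fun i t => cw (l * (t - s 0 i))).
  by apply/funext => x; apply: eq_bigr => i _; rewrite !mxE.
have mF i : measurable_fun setT (fun t : R => cw (l * (t - s 0 i))).
  by apply: measurableT_comp; [exact: measurable_cw|
    apply: measurable_funM => //; exact: measurable_funB].
rewrite E; apply: ge0_integrable_le.
- by apply: measurable_prodf.
- by move=> x; apply: prodf_ge0 => i t; exact: cw_ge0.
- rewrite -[X in _ ^+ X](card_ord n) -prodr_const.
  apply: integral_prodf_le => // [i t|i|i].
  + exact: cw_ge0.
  + by rewrite divr_ge0 ?pi_ge0 ?ltW.
  + exact: integral_cw.
Qed.

Lemma wgt_int n : (mu n).-integrable setT (EFin \o @wgt n) /\
  \int[mu n]_x wgt x <= pi ^+ n.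
Proof.
have := @wgt_scale_int n 1 0 ltr01; rewrite divr1.
have -> // : (fun x => wgt (1 *: (x - 0))) = @wgt n.
by apply/funext => x; rewrite subr0 scale1r.
Qed.

Lemma wgt_sub_int n (s : 'rV[R]_n) :
  (mu n).-integrable setT (EFin \o (fun x => wgt (s - x))) /\
  \int[mu n]_x wgt (s - x) <= pi ^+ n.
Proof.
have := @wgt_scale_int n 1 s ltr01; rewrite divr1.
have -> // : (fun x => wgt (1 *: (x - s))) = (fun x => wgt (s - x)).
by apply/funext => x; rewrite scale1r -wgtN opprB.
Qed.

Lemma smooth_le_wgt_lin m n N (b : 'I_n -> 'I_m -> R) :
  (forall i j, `|b i j| <= 1) -> exists2 C : R, 0 <= C &
  smooth_le N (fun x : 'rV[R]_m => C * \prod_i cw (\sum_j b i j * x 0 j))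
    (fun x : 'rV[R]_m => \prod_i cw (\sum_j b i j * x 0 j)).
Proof.
move=> b1; have [C C0 sC] := smooth_le_cw R N.
exists (2 ^+ (N * size (index_enum 'I_n)) * C ^+ n).
  by rewrite mulr_ge0 ?exprn_ge0.
have H i := @smooth_le_lin _ m N (b i) (fun t => C * cw t) (@cw R) (b1 i) sC.
apply: smooth_le_weight (smooth_le_prod _ H) => x.
by rewrite big_split/= prodr_const card_ord mulrA.
Qed.

End weights.

(** * Integration by parts and the resolvent formula *)

Section one_dimensional.
Variable R : realType.
Notation leb := (@lebesgue_measure R).

Lemma Rint_itv_cvg (g A : R -> R) : measurable_fun setT g ->
  leb.-integrable setT (EFin \o A) -> (forall x, `|g x| <= A x) ->
  \int[leb]_(x in `[- (k.+1%:R), k.+1%:R]) g x @[k --> \oo] --> \int[leb]_x g x.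
Proof.
move=> mg iA gA.
pose g_ k x := g x * \1_(`[- (k.+1%:R), k.+1%:R]) x : R.
have E k : \int[leb]_(x in `[- (k.+1%:R), k.+1%:R]) g x = \int[leb]_x g_ k x.
  rewrite Rintegral_mkcond; apply: eq_Rintegral => x _.
  by rewrite /g_ indicE patchE; case: ifP => _; rewrite ?mulr1 ?mulr0.
under eq_fun do rewrite E.
apply: (@Rint_cvg _ (measurableTypeR R) R leb g_ g A) => //.
- move=> k; apply: measurable_funM => //; exact: measurable_indic.
- move=> k x; rewrite /g_ indicE normrM (le_trans _ (gA x))//.
  by rewrite ler_piMr//; case: (_ \in _); rewrite ?normr1 ?normr0.
- move=> x; apply: cvg_near_cst; exists (Num.truncn `|x|) => // k /= kx.
  rewrite /g_ indicE mem_set ?mulr1//= in_itv/= -ler_norml.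
  by rewrite (le_trans (ltW (truncnS_gt _)))// ler_nat ltnS.
Qed.

Lemma continuous_is_derive (G g : R -> R) :
  (forall x : R, is_derive x 1 G (g x)) -> continuous G.
Proof.
move=> dG x; apply: differentiable_continuous; apply/derivable1_diffP.
by have [] := dG x.
Qed.

Lemma Rint_FTC (G g : R -> R) (a b : R) : continuous g ->
  (forall x : R, is_derive x 1 G (g x)) -> a < b ->
  \int[leb]_(x in `[a, b]) g x = G b - G a.
Proof.
move=> cg dG ab.
have cG := continuous_is_derive dG.
rewrite /Rintegral (@continuous_FTC2 _ g G)//.
- exact: continuous_subspaceT.
- split => //.
  + by apply: cvg_at_right_filter; exact: cG.
  + by apply: cvg_at_left_filter; exact: cG.
- by move=> x _; rewrite derive1E; have [_] := dG x.
Qed.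

Lemma cvg_cw0 : @cw R k.+1%:R @[k --> \oo] --> (0 : R).
Proof.
apply/cvgrPdist_le => e e0.
have [k _ ke] := near_infty_natSinv_lt (PosNum e0).
exists k => // m /= km; rewrite sub0r normrN ger0_norm ?cw_ge0//.
apply: le_trans (ltW (ke m km)); rewrite /cw lef_pV2 ?posrE ?cw_den_gt0 ?ltr0n//.
by have : 1 <= m.+1%:R :> R by [rewrite ler1n]; rewrite expr2; nra.
Qed.

Lemma leb_integrable_scale (c : R) (f : R -> R) : leb.-integrable setT (EFin \o f) ->
  leb.-integrable setT (EFin \o (fun x => c * f x)).
Proof. exact: (@integrable_scale _ (measurableTypeR R) R leb). Qed.

Lemma integrable_cw_sub (C x : R) :
  leb.-integrable setT (EFin \o (fun s : R => C * cw (s - x))).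
Proof.
have := @integral_cw R 1 x ltr01.
under eq_integral do rewrite mul1r.
move=> H; apply: leb_integrable_scale.
have m1 : measurable_fun setT (fun s : R => cw (s - x)).
  by apply: measurableT_comp; [exact: measurable_cw|exact: measurable_funB].
by have [] := @ge0_integrable_le _ (measurableTypeR R) R leb _ _ m1
  (fun s : R => cw_ge0 (s - x)) H.
Qed.

Lemma integrable_cw (C : R) : leb.-integrable setT (EFin \o (fun s : R => C * cw s)).
Proof.
by have := integrable_cw_sub C 0; under eq_fun do rewrite subr0.
Qed.

(** The boundary terms at k and -k are at most C cw k and tend to 0. *)
Lemma Rint_derive0 (G g : R -> R) (C : R) : continuous g ->
  (forall x : R, is_derive x 1 G (g x)) ->
  (forall x, `|g x| <= C * cw x) -> (forall x, `|G x| <= C * cw x) ->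
  \int[leb]_x g x = 0.
Proof.
move=> cg dG bg bG.
have iA := integrable_cw C.
have mg : measurable_fun setT g by exact: continuous_measurable_fun.
have c1 := Rint_itv_cvg mg iA bg.
suff c2 : \int[leb]_(x in `[- (k.+1%:R), k.+1%:R]) g x @[k --> \oo] --> (0 : R).
  by rewrite -(cvg_lim _ c1)// (cvg_lim _ c2).
have kk k : - (k.+1%:R) < k.+1%:R :> R.
  by rewrite (@lt_trans _ _ 0)// ?oppr_lt0 ltr0n.
under eq_fun do rewrite (Rint_FTC cg dG (kk _)).
apply/cvgr0Pnorm_le => e e0.
have C0 : 0 <= C by have := bG 0; rewrite /cw expr0n addr0 invr1 mulr1; exact: le_trans.
have : (C *+ 2) * @cw R k.+1%:R @[k --> \oo] --> (C *+ 2) * (0 : R).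
  by apply: cvgM cvg_cw0; exact: cvg_cst.
rewrite mulr0 => /cvgr0Pnorm_le /(_ e e0); apply: filterS => k.
rewrite ger0_norm ?mulr_ge0 ?cw_ge0 ?mulrn_wge0//; apply: le_trans.
rewrite (le_trans (ler_normB _ _))// mulr2n mulrDl lerD//.
by rewrite -[X in _ <= _ * X]cwN.
Qed.

Lemma is_derive_cos_affine (a b x : R) :
  is_derive x 1 (fun y => cos (a * y + b)) (- (a * sin (a * x + b))).
Proof.
have d1 : is_derive x 1 (fun y : R => a * y + b) a.
  by apply: is_derive_eq; rewrite addr0 /GRing.scale/= mulr1.
have := @is_derive1_comp _ (@cos R) (fun y => a * y + b) _ _ _ (is_derive_cos _) d1.
by rewrite mulNr mulrC.
Qed.

Lemma is_derive_sin_affine (a b x : R) :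
  is_derive x 1 (fun y => sin (a * y + b)) (a * cos (a * x + b)).
Proof.
have d1 : is_derive x 1 (fun y : R => a * y + b) a.
  by apply: is_derive_eq; rewrite addr0 /GRing.scale/= mulr1.
have := @is_derive1_comp _ (@sin R) (fun y => a * y + b) _ _ _ (is_derive_sin _) d1.
by rewrite mulrC.
Qed.

Lemma continuous_cos_affine (a b : R) : continuous (fun y => cos (a * y + b)).
Proof. exact: continuous_is_derive (is_derive_cos_affine a b). Qed.

Lemma normr_cos_le1 (x : R) : `|cos x| <= 1.
Proof. by rewrite ler_norml cos_geN1 cos_le1. Qed.
Lemma normr_sin_le1 (x : R) : `|sin x| <= 1.
Proof. by rewrite ler_norml sin_geN1 sin_le1. Qed.

(** Two integrations by parts give the integral of cos times f'' as -a^2 times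
    that of cos times f; the formula solves this relation for the integral of
    cos times f. *)
Lemma osc_ibp1 (a b l C : R) (f f1 f2 : R -> R) :
  (forall x : R, is_derive x 1 f (f1 x)) ->
  (forall x : R, is_derive x 1 f1 (f2 x)) -> continuous f2 ->
  (forall x, `|f x| <= C * cw x) -> (forall x, `|f1 x| <= C * cw x) ->
  (forall x, `|f2 x| <= C * cw x) ->
  \int[leb]_x (cos (a * x + b) * f x) =
  cw (l * a) * \int[leb]_x (cos (a * x + b) * (f x - l ^+ 2 * f2 x)).
Proof.
move=> df df1 cf2 bf bf1 bf2.
have cf := continuous_is_derive df.
have cc := @continuous_cos_affine a b.
have iA := integrable_cw C.
have int g : continuous g -> (forall x, `|g x| <= C * cw x) ->
    leb.-integrable setT (EFin \o (fun x => cos (a * x + b) * g x)).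
  move=> cg bg; apply: (@dom_integrable _ (measurableTypeR R) R leb _ _ _ iA).
    by apply: continuous_measurable_fun; exact: contM.
  move=> x; rewrite normrM (le_trans _ (bg x))// ler_piMl// normr_cos_le1//.
have bt (u v K : R) : `|u| <= 1 -> `|v| <= K -> `|u * v| <= K.
  by move=> u1 vK; rewrite normrM (le_trans _ vK)// ler_piMl.
have i0 := int f cf bf; have i2 := int f2 cf2 bf2.
set I0 := \int[leb]_x _; pose I2 := \int[leb]_x (cos (a * x + b) * f2 x).
have key : I2 + a ^+ 2 * I0 = 0.
  have -> : I2 + a ^+ 2 * I0 =
      \int[leb]_x (cos (a * x + b) * f2 x + a ^+ 2 * (cos (a * x + b) * f x)).
    rewrite RintegralD//; last exact: leb_integrable_scale.
    by rewrite RintegralZl.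
  apply: (@Rint_derive0 (fun x => cos (a * x + b) * f1 x + a * (sin (a * x + b) * f x))
    _ ((1 + a ^+ 2 + `|a|) * C)).
  - apply: contD; first exact: contM.
    by apply: contZ; exact: contM.
  - move=> x.
    have d1 := is_deriveM (is_derive_cos_affine a b x) (df1 x).
    have d2 := is_deriveM (is_derive_sin_affine a b x) (df x).
    apply: (is_derive_eq (is_deriveD d1 (is_deriveZ a d2))).
    by rewrite /GRing.scale/=; ring.
  - move=> x; rewrite -mulrA !mulrDl mul1r.
    have H0 : 0 <= C * cw x by exact: le_trans (bf x).
    apply: (le_trans (ler_normD _ _)); rewrite -addrA; apply: lerD.
      by apply: bt; rewrite ?normr_cos_le1.
    rewrite normrM (ger0_norm (sqr_ge0 a)).
    apply: (@le_trans _ _ (a ^+ 2 * (C * cw x))).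
      by apply: ler_wpM2l; [exact: sqr_ge0|apply: bt; rewrite ?normr_cos_le1].
    by rewrite lerDl mulr_ge0.
  - move=> x; rewrite -mulrA !mulrDl mul1r.
    have H0 : 0 <= C * cw x by exact: le_trans (bf x).
    apply: (le_trans (ler_normD _ _)); apply: lerD.
      apply: (@le_trans _ _ (C * cw x)); first by apply: bt; rewrite ?normr_cos_le1.
      by rewrite lerDl mulr_ge0 ?sqr_ge0.
    by rewrite normrM; apply: ler_wpM2l => //; apply: bt; rewrite ?normr_sin_le1.
have -> : \int[leb]_x (cos (a * x + b) * (f x - l ^+ 2 * f2 x)) =
    I0 - l ^+ 2 * I2.
  have -> : (fun x => cos (a * x + b) * (f x - l ^+ 2 * f2 x)) =
      (fun x => cos (a * x + b) * f x + - l ^+ 2 * (cos (a * x + b) * f2 x)).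
    by apply/funext => x; ring.
  rewrite RintegralD//; last exact: leb_integrable_scale.
  by rewrite RintegralZl// mulNr.
have -> : I2 = - (a ^+ 2 * I0) by apply/eqP; rewrite -addr_eq0 key.
rewrite -[LHS]mul1r -(cwE (l * a)); ring.
Qed.

(** The fundamental solution of 1 + d/dx that vanishes on the negative
    half-line. *)
Definition rk1 (r : R) : R := if 0 <= r then expR (- r) else 0.

Lemma rk1_ge0 r : 0 <= rk1 r.
Proof. by rewrite /rk1; case: ifP => // _; exact: expR_ge0. Qed.

Lemma rk1_le_cw r : rk1 r <= 2 * cw r.
Proof.
rewrite /rk1; case: ifPn => [r0|_]; last by rewrite mulr_ge0 ?cw_ge0.
rewrite expRN /cw ler_pdivlMr ?cw_den_gt0// mulrC ler_pdivrMr ?expR_gt0//.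
have := expR_ge1Dxn 1 r0; rewrite (_ : 2`! = 2)%N//; lra.
Qed.

Lemma measurable_rk1 : measurable_fun setT rk1.
Proof.
rewrite (_ : rk1 = (fun r => expR (- r) * \1_(`[0, +oo[) r)); last first.
  apply/funext => r; rewrite /rk1 indicE; case: ifPn => r0.
    by rewrite mem_set ?mulr1//= in_itv/= r0.
  by rewrite memNset ?mulr0//= in_itv/= andbT; exact/negP.
apply: measurable_funM; last exact: measurable_indic.
by apply: measurableT_comp => //; exact: measurable_expR.
Qed.

Lemma integrable_rk1_sub (x : R) :
  leb.-integrable setT (EFin \o (fun s : R => rk1 (x - s))).
Proof.
apply: (@dom_integrable _ (measurableTypeR R) R leb _ _ _ (integrable_cw_sub 2 x)).
  by apply: measurableT_comp; [exact: measurable_rk1|exact: measurable_funB].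
by move=> s; rewrite ger0_norm ?rk1_ge0// -cwN opprB rk1_le_cw.
Qed.

(** The integrand is the derivative of s |-> exp (s - x) F s on the half-line s
    <= x, and vanishes beyond x. *)
Lemma resolvent1 (F F' : R -> R) (C : R) (x : R) :
  (forall y : R, is_derive y 1 F (F' y)) -> continuous F' ->
  (forall y, `|F y| <= C) -> (forall y, `|F' y| <= C) ->
  \int[leb]_s (rk1 (x - s) * (F s + F' s)) = F x.
Proof.
move=> dF cF' bF bF'.
have cF := continuous_is_derive dF.
pose g s := rk1 (x - s) * (F s + F' s).
have mg : measurable_fun setT g.
  apply: measurable_funM; last by apply: continuous_measurable_fun; exact: contD.
  by apply: measurableT_comp; [exact: measurable_rk1|exact: measurable_funB].
have iA := leb_integrable_scale (C + C) (integrable_rk1_sub x).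
have bg s : `|g s| <= (C + C) * rk1 (x - s).
  rewrite normrM ger0_norm ?rk1_ge0// mulrC ler_wpM2r ?rk1_ge0//.
  by rewrite (le_trans (ler_normD _ _))// lerD.
have c1 := Rint_itv_cvg mg iA bg.
suff c2 : \int[leb]_(s in `[- (k.+1%:R), k.+1%:R]) g s @[k --> \oo] --> F x.
  by rewrite -(cvg_lim _ c1)// (cvg_lim _ c2).
(* the antiderivative of the integrand on the half-line s <= x *)
pose G s := expR (s - x) * F s.
have dG (s : R) : is_derive s 1 G (expR (s - x) * (F s + F' s)).
  have d1 : is_derive s 1 (fun s : R => s - x) 1.
    by apply: is_derive_eq; rewrite subr0.
  have d2 := @is_derive1_comp _ (@expR R) (fun s : R => s - x) _ _ _ (is_derive_expR _) d1.
  apply: (is_derive_eq (is_deriveM d2 (dF s))).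
  by rewrite /GRing.scale/=; ring.
have cg : continuous (fun s : R => expR (s - x) * (F s + F' s)).
  apply: contM; last exact: contD.
  move=> s; apply: (continuous_comp (f := fun s => s - x)); last exact: continuous_expR.
  by apply: cvgB; [exact: cvg_id|exact: cvg_cst].
have E k : `|x| < k.+1%:R ->
   \int[leb]_(s in `[- (k.+1%:R), k.+1%:R]) g s = F x - G (- (k.+1%:R)).
  rewrite ltr_norml => /andP[xk1 xk2].
  transitivity (\int[leb]_(s in `[- (k.+1%:R), x]) (expR (s - x) * (F s + F' s))).
    rewrite Rintegral_mkcond [RHS]Rintegral_mkcond; apply: eq_Rintegral => s _.
    rewrite !patchE; have [sx|sx] := leP s x.
      rewrite /g /rk1 subr_ge0 sx opprB.
      have -> : (s \in `[(- k.+1%:R), x]%classic) = (s \in `[(- k.+1%:R), (k.+1%:R)]%classic) => //.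
      by apply/idP/idP; rewrite !inE/= !in_itv/= => /andP[-> _] //=; rewrite (le_trans sx)// ltW.
    rewrite [in RHS]memNset; last by rewrite /= in_itv/= => /andP[_]; rewrite leNgt sx.
    by case: ifP => // _; rewrite /g /rk1 subr_ge0 leNgt sx mul0r.
  by rewrite (Rint_FTC cg dG xk1) /G subrr expR0 mul1r.
have cv0 : F x - G (- (k.+1%:R)) @[k --> \oo] --> F x.
  rewrite -[X in _ --> X](subr0 (F x)); apply: cvgB; first exact: cvg_cst.
  apply/cvgr0Pnorm_le => e e0.
  have C0 : 0 <= C by exact: le_trans (bF 0).
  have : expR (- x) * (C *+ 2) * @cw R k.+1%:R @[k --> \oo] -->
      expR (- x) * (C *+ 2) * (0 : R).
    by apply: cvgM cvg_cw0; exact: cvg_cst.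
  rewrite mulr0 => /cvgr0Pnorm_le /(_ e e0); apply: filterS => k.
  rewrite ger0_norm ?mulr_ge0 ?expR_ge0 ?cw_ge0 ?mulrn_wge0//; apply: le_trans.
  rewrite /G normrM ger0_norm ?expR_ge0// expRD mulrC.
  have := rk1_le_cw (k.+1%:R); rewrite /rk1 ler0n => H.
  rewrite mulrA [leLHS]mulrC -mulrA ler_wpM2l ?expR_ge0// mulr2n.
  have := bF (- k.+1%:R); have := expR_ge0 (- k.+1%:R : R); nra.
apply: cvg_trans cv0; apply: near_eq_cvg.
exists (Num.truncn `|x|) => // k /= kx; rewrite E//.
by rewrite (lt_le_trans (truncnS_gt _))// ler_nat ltnS.
Qed.

End one_dimensional.

Section slicing.
Variable R : realType.

Lemma rV_unconsK n : cancel (@rV_uncons R n) (@rV_cons R n).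
Proof.
move=> v; apply/rowP => i; rewrite mxE /=.
by case: unliftP => [j|] -> //=; rewrite mxE.
Qed.

Lemma dotp_cons n x y (u v : 'rV[R]_n) :
  dotp (rV_cons (x, u)) (rV_cons (y, v)) = x * y + dotp u v.
Proof.
rewrite /dotp big_ord_recl !rV_consE0; congr (_ + _).
by apply: eq_bigr => i _; rewrite !rV_consE.
Qed.

Definition rVc n (x : R) (v : 'rV[R]_n) : 'rV[R]_n.+1 := rV_cons (x, v).

Lemma rVc_tail n x j (t : R) (v : 'rV[R]_n) :
  rVc x (t *: delta_mx 0 j + v) = (t * 1) *: delta_mx 0 (lift ord0 j) + rVc x v.
Proof.
apply/rowP => i; rewrite !mxE mulr1.
case: unliftP => [k|] -> /=; last by rewrite mulr0 add0r.
by rewrite !mxE !eqxx (inj_eq (@lift_inj _ ord0)).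
Qed.

Lemma rVc_head n (x t : R) (v : 'rV[R]_n) :
  rVc (t *: 1 + x) v = (t * 1) *: delta_mx 0 ord0 + rVc x v.
Proof.
apply/rowP => i; rewrite !mxE mulr1.
case: unliftP => [k|] -> /=; first by rewrite mulr0 add0r.
by [].
Qed.

Lemma continuous_rVc n x : continuous (@rVc n x).
Proof.
apply: continuous_rVP => i; rewrite /rVc.
case: (unliftP ord0 i) => [k|] ->.
  by under eq_fun do rewrite rV_consE; exact: continuous_coord.
by under eq_fun do rewrite rV_consE0; exact: cst_continuous.
Qed.

Lemma continuous_rVc_head n (v : 'rV[R]_n) : continuous (fun x => rVc x v).
Proof.
apply: continuous_rVP => i; rewrite /rVc.
case: (unliftP ord0 i) => [k|] ->.
  by under eq_fun do rewrite rV_consE; exact: cst_continuous.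
under eq_fun do rewrite rV_consE0.
by move=> x; exact: cvg_id.
Qed.

Lemma smooth_le_rVc n N (w f : 'rV[R]_n.+1 -> R) x : smooth_le N w f ->
  smooth_le N (w \o rVc x) (f \o rVc x).
Proof.
apply: (@smooth_le_comp _ _ _ _ _ _ _ (fun j => lift ord0 j) (fun=> 1)).
- exact: continuous_rVc.
- by move=> j; rewrite normr1.
- by move=> j v t; exact: rVc_tail.
Qed.

Lemma is_derive_rVc_head n N (w f : 'rV[R]_n.+1 -> R) (x : R) v :
  smooth_le N.+1 w f ->
  is_derive x 1 (fun x => f (rVc x v)) (pd ord0 f (rVc x v)).
Proof.
move=> sf.
have := @is_derive_affine _ _ _ (fun x => rVc x v) f x 1 _ 1 _
  (fun t => rVc_head x t v) (smooth_le_derive ord0 sf (rVc x v)).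
by rewrite mul1r.
Qed.

End slicing.

Section operators.
Variable R : realType.

(** The differential operator prod_j (1 - m d_j^2) over the coordinates j in s,
    which turns the oscillating factor into a multiple of itself. *)
Definition lap n (m : R) (s : seq 'I_n) (f : 'rV[R]_n -> R) :=
  foldr (fun j g => fun x => g x + - m * pd j (pd j g) x) f s.

(** The differential operator prod_j (1 + d_j) over the coordinates j in s. With
    one factor per coordinate, and not a power of 1 - Delta, its inverse is
    convolution with a product kernel. *)
Definition der1 n (s : seq 'I_n) (f : 'rV[R]_n -> R) :=
  foldr (fun j g => fun x => g x + pd j g x) f s.

Lemma smooth_le_lap n N m (s : seq 'I_n) w f :
  smooth_le (N + 2 * size s)%N w f ->
  smooth_le N (fun x => (1 + `|m|) ^+ size s * w x) (lap m s f).
Proof.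
elim: s N => [|j s IH] N /=.
  rewrite muln0 addn0; apply: smooth_le_weight => x.
  by rewrite expr0 mul1r.
rewrite mulnS addnA addn2 => /IH; rewrite -/(lap m s f); set g := lap m s f => sg.
have s0 := smooth_leS (smooth_leS sg).
have s2 := smooth_leZ (- m) (smooth_le_pd j (smooth_le_pd j sg)).
apply: smooth_le_weight (smooth_leD s0 s2) => x.
by rewrite normrN exprS -mulrA mulrDl mul1r.
Qed.

Lemma smooth_le_der1 n N (s : seq 'I_n) w f :
  smooth_le (N + size s)%N w f ->
  smooth_le N (fun x => 2 ^+ size s * w x) (der1 s f).
Proof.
elim: s N => [|j s IH] N /=.
  by rewrite addn0; apply: smooth_le_weight => x; rewrite expr0 mul1r.
rewrite addnS -addSn => /IH; rewrite -/(der1 s f); set g := der1 s f => sg.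
apply: smooth_le_weight (smooth_leD (smooth_leS sg) (smooth_le_pd j sg)) => x.
by rewrite exprS -mulrA mulr_natl mulr2n.
Qed.

Section along.
Variables (k n : nat) (L : 'rV[R]_k -> 'rV[R]_n) (h : 'I_k -> 'I_n).
Hypothesis cL : continuous L.
Hypothesis HL : forall j x (t : R),
  L (t *: delta_mx 0 j + x) = (t * 1) *: delta_mx 0 (h j) + L x.

Lemma pd_along N (w f : 'rV[R]_n -> R) j : smooth_le N.+1 w f ->
  pd j (f \o L) = pd (h j) f \o L.
Proof.
move=> sf; apply/funext => v.
have := is_derive_affine (HL j v) (smooth_le_derive (h j) sf (L v)).
by rewrite mul1r => -[].
Qed.

Lemma lap_along m (s : seq 'I_k) (w f : 'rV[R]_n -> R) :
  smooth_le (2 * size s)%N w f ->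
  lap m (map h s) f \o L = lap m s (f \o L).
Proof.
elim: s => [//|j s IH]; rewrite [size (_ :: _)]/= mulnS => sf.
have {}IH := IH (smooth_le_anti (leq_addl _ _) sf).
have := @smooth_le_lap _ 2%N m (map h s) w f.
rewrite size_map => /(_ sf) sg.
rewrite /lap /= -!/(lap _ _ _) -IH; apply/funext => v /=.
set g := lap m (map _ s) f in sg *.
by rewrite (pd_along _ sg) (pd_along _ (smooth_le_pd (h j) sg)).
Qed.

Lemma der1_along (s : seq 'I_k) (w f : 'rV[R]_n -> R) :
  smooth_le (size s)%N w f ->
  der1 (map h s) f \o L = der1 s (f \o L).
Proof.
elim: s => [//|j s IH]; rewrite [size (_ :: _)]/= => sf.
have {}IH := IH (smooth_leS sf).
have := @smooth_le_der1 _ 1%N (map h s) w f.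
rewrite size_map => /(_ sf) sg.
rewrite /der1 /= -!/(der1 _ _) -IH; apply/funext => v /=.
set g := der1 (map _ s) f in sg *.
by rewrite (pd_along _ sg).
Qed.

End along.

Lemma lap_rVc n m (s : seq 'I_n) (w f : 'rV[R]_n.+1 -> R) x :
  smooth_le (2 * size s)%N w f ->
  lap m (map (lift ord0) s) f \o rVc x = lap m s (f \o rVc x).
Proof. by apply: lap_along => j v t; exact: rVc_tail. Qed.

Lemma der1_rVc n (s : seq 'I_n) (w f : 'rV[R]_n.+1 -> R) x :
  smooth_le (size s)%N w f ->
  der1 (map (lift ord0) s) f \o rVc x = der1 s (f \o rVc x).
Proof. by apply: der1_along => j v t; exact: rVc_tail. Qed.

Notation leb := (@lebesgue_measure R).
Notation mu := (lebesgue_rV R).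

Lemma integrable_wgtZ n (C : R) :
  (mu n).-integrable setT (EFin \o (fun v => C * wgt v)).
Proof. by apply: integrable_scale; have [] := wgt_int R n. Qed.

Lemma measurable_cos_dotp n (c b : R) (t : 'rV[R]_n) :
  measurable_fun setT (fun p => cos (c * dotp p t + b)).
Proof.
apply: measurableT_comp; first exact: (continuous_measurable_fun (@continuous_cos R)).
apply: measurable_funD => //; apply: measurable_funM => //.
by apply: measurable_dotp.
Qed.

(** Each factor 1 - l^2 d_j^2 moved from the oscillating function onto f is paid
    for by a division by 1 + (l c t_j)^2. The induction treats one coordinate at
    a time. *)
Lemma osc_ibp n (c l b C : R) (f : 'rV[R]_n -> R) (t : 'rV[R]_n) :
  smooth_le (2 * n)%N (fun x => C * wgt x) f ->
  \int[mu n]_p (cos (c * dotp p t + b) * f p) =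
  wgt ((l * c) *: t) *
    \int[mu n]_p (cos (c * dotp p t + b) * lap (l ^+ 2) (enum 'I_n) f p).
Proof.
elim: n b C f t => [|n IH] b C f t sf.
  rewrite /wgt /prodf big_ord0 mul1r; apply: eq_Rintegral => p _.
  by have -> : enum 'I_0 = [::] by apply: size0nil; rewrite size_enum_ord.
have C0 : 0 <= C.
  by have := smooth_le_w0 sf 0; rewrite pmulr_lge0// wgt_gt0.
rewrite -[t]rV_unconsK; case: (rV_uncons t) => t0 t' {t}.
set H := lap (l ^+ 2) (map (lift ord0) (enum 'I_n)) f.
have sH : smooth_le 2 (fun x => (1 + `|l ^+ 2|) ^+ n * (C * wgt x)) H.
  have := @smooth_le_lap _ 2 (l ^+ 2) (map (lift ord0) (enum 'I_n)) _ _ _.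
  rewrite size_map size_enum_ord; apply.
  by rewrite mulnS in sf.
pose D := (1 + `|l ^+ 2|) ^+ n * C.
have D0 : 0 <= D by rewrite mulr_ge0// exprn_ge0// addr_ge0.
have sHD : smooth_le 2 (fun x => D * wgt x) H.
  by apply: smooth_le_weight sH => x; rewrite mulrA.
have Hlap : lap (l ^+ 2) (enum 'I_n.+1) f =
    (fun x => H x + - l ^+ 2 * pd ord0 (pd ord0 H) x).
  by rewrite enum_ordSl.
have sL : smooth_le 0 (fun x => ((1 + `|l ^+ 2|) * D) * wgt x) (lap (l ^+ 2) (enum 'I_n.+1) f).
  rewrite Hlap.
  have s2 := smooth_leZ (- l ^+ 2) (smooth_le_pd ord0 (smooth_le_pd ord0 sHD)).
  apply: smooth_le_weight (smooth_leD (smooth_leS (smooth_leS sHD)) s2) => x.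
  by rewrite normrN -!mulrA mulrDl mul1r.
have E p0 p' : c * dotp (rV_cons (p0, p')) (rV_cons (t0, t')) + b =
    c * dotp p' t' + (c * t0 * p0 + b).
  by rewrite dotp_cons; ring.
have bnd (g : 'rV[R]_n.+1 -> R) K : smooth_le 0 (fun x => K * wgt x) g ->
    forall p0 p', `|cos (c * dotp (rV_cons (p0, p')) (rV_cons (t0, t')) + b) *
      g (rV_cons (p0, p'))| <= K * cw p0 * wgt p'.
  move=> sg p0 p'; rewrite normrM -mulrA -wgt_cons.
  by rewrite (le_trans _ (smooth_le_norm sg _))// ler_piMl// normr_cos_le1.
have meas (g : 'rV[R]_n.+1 -> R) : measurable_fun setT g -> measurable_fun setT
    (fun p => cos (c * dotp p (rV_cons (t0, t')) + b) * g p).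
  by move=> mg; apply: measurable_funM => //; exact: measurable_cos_dotp.
have iW : (mu n).-integrable setT (EFin \o @wgt R n) by have [] := wgt_int R n.
have sf0 : smooth_le 0 (fun x => C * wgt x) f by exact: smooth_le_anti sf.
rewrite (Rint_rV_cons (meas _ (smooth_le_meas sf0)) (integrable_cw C) iW (bnd _ _ sf0)).
rewrite (Rint_rV_cons (meas _ (smooth_le_meas sL)) (integrable_cw _) iW (bnd _ _ sL)).
have -> : wgt ((l * c) *: rV_cons (t0, t')) = cw (l * (c * t0)) * wgt ((l * c) *: t').
  rewrite -wgt_cons; congr wgt; apply/rowP => i; rewrite !mxE.
  by case: unlift => [j|] /=; rewrite ?mxE ?mulrA.
(* the last n coordinates, by induction *)
transitivity (\int[leb]_p0 (wgt ((l * c) *: t') * \int[mu n]_p'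
    (cos (c * dotp (rV_cons (p0, p')) (rV_cons (t0, t')) + b) * H (rV_cons (p0, p'))))).
  apply: eq_Rintegral => p0 _.
  under eq_Rintegral do rewrite E.
  under [X in _ = _ * X]eq_Rintegral do rewrite E.
  have sfp : smooth_le (2 * n)%N (fun v => (C * cw p0) * wgt v) (f \o rVc p0).
    apply: (@smooth_le_weight _ _ _ ((fun x => C * wgt x) \o rVc p0)).
      by move=> v; rewrite /= wgt_cons mulrA.
    by apply: smooth_le_rVc; apply: smooth_le_anti sf; rewrite leq_mul.
  rewrite (IH _ _ (f \o rVc p0) t' sfp); congr (_ * _).
  apply: eq_Rintegral => p' _; congr (_ * _).
  rewrite -(@lap_rVc n (l ^+ 2) (enum 'I_n) (fun x => C * wgt x) f p0)//.
  by rewrite size_enum_ord; apply: smooth_le_anti sf; rewrite leq_mul.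
have sH0 : smooth_le 0 (fun x => D * wgt x) H by exact: smooth_le_anti sHD.
have mz (g : 'rV[R]_n.+1 -> R) : measurable_fun setT g ->
    measurable_fun setT (g \o @rV_cons R n).
  by move=> mg; apply: measurableT_comp mg _; exact: measurable_rV_cons.
have mH := mz _ (meas _ (smooth_le_meas sH0)).
have mL := mz _ (meas _ (smooth_le_meas sL)).
rewrite (RintegralZl _ measurableT (dom_Rint_prod mH (integrable_cw D) iW (bnd _ _ sH0))).
rewrite [RHS]mulrAC [LHS]mulrC; congr (_ * _).
rewrite (Rfubini mH (integrable_cw D) iW (bnd _ _ sH0)).
rewrite (Rfubini mL (integrable_cw _) iW (bnd _ _ sL)).
(* the first coordinate, by the one-dimensional formula *)
have E2 p0 p' : c * dotp (rV_cons (p0, p')) (rV_cons (t0, t')) + b =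
    c * t0 * p0 + (c * dotp p' t' + b).
  by rewrite E; ring.
rewrite -RintegralZl//; last exact: (dom_Rint_prod2 mL (integrable_cw _) iW (bnd _ _ sL)).
apply: eq_Rintegral => p' _ /=.
under eq_Rintegral do rewrite E2.
under [X in _ = _ * X]eq_Rintegral do rewrite E2.
rewrite Hlap.
have wle y : D * wgt (rVc y p') <= D * cw y.
  by rewrite /rVc wgt_cons ler_wpM2l// ler_piMr ?cw_ge0// wgt_le1.
have s1 := smooth_le_pd ord0 sHD; have s2 := smooth_le_pd ord0 s1.
have d1 x := is_derive_rVc_head x p' sHD.
have d2 x := is_derive_rVc_head x p' s1.
have b0 x : `|H (rVc x p')| <= D * cw x.
  by rewrite (le_trans _ (wle x))// (smooth_le_norm sHD).
have b1 x : `|pd ord0 H (rVc x p')| <= D * cw x.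
  by rewrite (le_trans _ (wle x))// (smooth_le_norm s1).
have b2 x : `|pd ord0 (pd ord0 H) (rVc x p')| <= D * cw x.
  by rewrite (le_trans _ (wle x))// (smooth_le_norm s2).
have c2 : continuous (fun x => pd ord0 (pd ord0 H) (rVc x p')).
  move=> x; apply: (continuous_comp (f := fun x => rVc x p')).
    exact: continuous_rVc_head.
  exact: (smooth_le_cont s2).
have := osc_ibp1 (c * t0) (c * dotp p' t' + b) l d1 d2 c2 b0 b1 b2.
rewrite /rVc => ->; congr (_ * _); apply: eq_Rintegral => p0 _.
by rewrite mulNr.
Qed.

End operators.

(** * The resolvent formula in several variables *)

Section tonelli_real.
Context d1 d2 (T1 : measurableType d1) (T2 : measurableType d2) (R : realType).
Variable m1 : {sigma_finite_measure set T1 -> \bar R}.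
Variable m2 : {sigma_finite_measure set T2 -> \bar R}.

(** The bound on the slices f(., y) is an inequality of extended reals, so that
    it includes their integrability. *)
Lemma Rtonelli_le (f : T1 * T2 -> R) (G : T2 -> R) :
  measurable_fun setT f -> (forall z, 0 <= f z) ->
  m2.-integrable setT (EFin \o G) ->
  (forall y, \int[m1]_x (f (x, y))%:E <= (G y)%:E)%E ->
  m1.-integrable setT (EFin \o (fun x => \int[m2]_y f (x, y))) /\
  \int[m1]_x \int[m2]_y f (x, y) <= \int[m2]_y G y.
Proof.
move=> mf f0 iG fG.
have mE : measurable_fun setT (EFin \o f) by exact/measurable_EFinP.
apply: ge0_integrable_le.
- exact: measurable_Rint.
- by move=> x; apply: Rintegral_ge0 => y _.
rewrite (EFin_Rint iG).
apply: (@le_trans _ _ (\int[m1]_x \int[m2]_y (EFin \o f) (x, y))%E).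
  apply: ge0_le_integral => //.
  - by move=> x _; rewrite lee_fin; apply: Rintegral_ge0 => y _.
  - by apply/measurable_EFinP; exact: measurable_Rint.
  - exact: measurable_fun_fubini_tonelli_F.
  - move=> x _; rewrite /Rintegral.
    have : (0 <= \int[m2]_y (f (x, y))%:E)%E.
      by apply: integral_ge0 => y _; rewrite lee_fin.
    by move: (\int[m2]_y (f (x, y))%:E)%E => [r| |]//= _; rewrite leey.
rewrite fubini_tonelli//.
apply: ge0_le_integral => //.
- by move=> y _; apply: integral_ge0 => x _; rewrite lee_fin.
- exact: (measurable_fun_fubini_tonelli_G (m1 := m1) (EFin \o f)).
- exact: (measurable_int _ iG).
- by move=> y _; exact: fG.
Qed.

End tonelli_real.

Section resolvent.
Variable R : realType.
Notation leb := (@lebesgue_measure R).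
Notation mu := (lebesgue_rV R).

Definition rk n : 'rV[R]_n -> R := prodf (fun _ => @rk1 R).

Lemma measurable_rVc_head n (v : 'rV[R]_n) :
  measurable_fun setT (fun x : R => rVc x v).
Proof.
apply: measurable_fun_rVP => i; rewrite /rVc.
case: (unliftP ord0 i) => [k|] ->.
  rewrite (_ : _ \o _ = cst (v 0 k)); first exact: measurable_cst.
  by apply/funext => x /=; rewrite /coord_rV rV_consE.
rewrite (_ : _ \o _ = id); first exact: measurable_id.
by apply/funext => x /=; rewrite /coord_rV rV_consE0.
Qed.

Lemma rk_ge0 n (x : 'rV[R]_n) : 0 <= rk x.
Proof. by apply: prodf_ge0 => i t; exact: rk1_ge0. Qed.

Lemma rk1_le1 (t : R) : rk1 t <= 1.
Proof. by rewrite /rk1; case: ifP => // t0; rewrite expR_le1 oppr_le0. Qed.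

Lemma rk_le1 n (x : 'rV[R]_n) : rk x <= 1.
Proof. by apply: prodr_ile1 => i _; rewrite rk1_ge0 rk1_le1. Qed.

Lemma rk_le_wgt n (x : 'rV[R]_n) : rk x <= 2 ^+ n * wgt x.
Proof.
rewrite /rk /wgt /prodf -[X in 2 ^+ X](card_ord n) -prodr_const -big_split/=.
by apply: ler_prod => i _; rewrite rk1_ge0 rk1_le_cw.
Qed.

Lemma rk_cons n x (v : 'rV[R]_n) : rk (rV_cons (x, v)) = rk1 x * rk v.
Proof. exact: prodf_cons. Qed.

Lemma measurable_rk n : measurable_fun setT (@rk n).
Proof. by apply: measurable_prodf => i; exact: measurable_rk1. Qed.

Lemma measurable_rk_sub n d (T : measurableType d) (f g : T -> 'rV[R]_n) :
  measurable_fun setT f -> measurable_fun setT g ->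
  measurable_fun setT (fun z => rk (f z - g z)).
Proof.
move=> mf mg; apply: (measurableT_comp (@measurable_rk n)).
exact: measurable_rV_sub.
Qed.

Lemma measurable_wgt_sub n d (T : measurableType d) (f g : T -> 'rV[R]_n) :
  measurable_fun setT f -> measurable_fun setT g ->
  measurable_fun setT (fun z => wgt (f z - g z)).
Proof.
move=> mf mg; apply: (measurableT_comp (@measurable_wgt R n)).
exact: measurable_rV_sub.
Qed.

Lemma integrable_wgt n : (mu n).-integrable setT (EFin \o @wgt R n).
Proof. by have [] := wgt_int R n. Qed.

Lemma rV_consB n (x y : R) (u v : 'rV[R]_n) :
  rV_cons (x, u) - rV_cons (y, v) = rV_cons (x - y, u - v).
Proof. by apply/rowP => i; rewrite !mxE; case: unlift => //= j; rewrite !mxE. Qed.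

(** The one-dimensional resolvent formula, one coordinate at a time. *)
Lemma resolvent n (C : R) (F : 'rV[R]_n -> R) (x : 'rV[R]_n) :
  smooth_le n (fun=> C) F ->
  \int[mu n]_s (rk (x - s) * der1 (enum 'I_n) F s) = F x.
Proof.
elim: n C F x => [|n IH] C F x sF.
  have -> : enum 'I_0 = [::] by apply: size0nil; rewrite size_enum_ord.
  rewrite /Rintegral integral_dirac//; last first.
    apply/measurable_EFinP; apply: measurable_funM.
      exact: measurable_rk_sub.
    exact: (smooth_le_meas sF).
  by rewrite diracT mul1e /= /rk /prodf big_ord0 mul1r; congr F; apply/rowP => -[].
have C0 : 0 <= C by exact: (smooth_le_w0 sF 0).
rewrite -[x]rV_unconsK; case: (rV_uncons x) => x0 x' {x}.
set H := der1 (map (lift ord0) (enum 'I_n)) F.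
have sH : smooth_le 1 (fun=> 2 ^+ n * C) H.
  have := @smooth_le_der1 _ _ 1 (map (lift ord0) (enum 'I_n)) (fun=> C) F.
  by rewrite size_map size_enum_ord; apply.
set D := 2 ^+ n * C in sH; have D0 : 0 <= D by rewrite mulr_ge0 ?exprn_ge0.
have HD : der1 (enum 'I_n.+1) F = (fun x => H x + pd ord0 H x).
  by rewrite enum_ordSl.
have sD : smooth_le 0 (fun=> D + D) (der1 (enum 'I_n.+1) F).
  by rewrite HD; apply: smooth_leD (smooth_leS sH) (smooth_le_pd ord0 sH).
have bnd s0 s' : `|rk (rV_cons (x0, x') - rV_cons (s0, s')) *
    der1 (enum 'I_n.+1) F (rV_cons (s0, s'))| <=
    ((D + D) * rk1 (x0 - s0)) * (2 ^+ n * wgt (x' - s')).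
  rewrite normrM ger0_norm ?rk_ge0// rV_consB rk_cons.
  rewrite [leLHS]mulrC [leLHS]mulrA; apply: ler_pM; last exact: rk_le_wgt.
  - by rewrite mulr_ge0 ?rk1_ge0.
  - exact: rk_ge0.
  - by apply: ler_wpM2r; [exact: rk1_ge0|exact: (smooth_le_norm sD)].
have m : measurable_fun setT
    (fun s : 'rV[R]_n.+1 => rk (rV_cons (x0, x') - s) * der1 (enum 'I_n.+1) F s).
  apply: measurable_funM; last exact: smooth_le_meas sD.
  exact: measurable_rk_sub.
have iA := leb_integrable_scale (D + D) (integrable_rk1_sub x0).
have iB : (mu n).-integrable setT (EFin \o (fun s' => 2 ^+ n * wgt (x' - s'))).
  by apply: integrable_scale; have [] := wgt_sub_int x'.
rewrite (Rint_rV_cons m iA iB bnd).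
have mc : measurable_fun setT ((fun s : 'rV[R]_n.+1 => rk (rV_cons (x0, x') - s) *
    der1 (enum 'I_n.+1) F s) \o @rV_cons R n).
  by apply: measurableT_comp m _; exact: measurable_rV_cons.
rewrite (Rfubini mc iA iB bnd).
transitivity (\int[mu n]_s' (rk (x' - s') * H (rV_cons (x0, s')))).
  apply: eq_Rintegral => s' _ /=.
  transitivity (\int[leb]_s0 (rk (x' - s') *
      (rk1 (x0 - s0) * (H (rVc s0 s') + pd ord0 H (rVc s0 s'))))).
    apply: eq_Rintegral => s0 _.
    by rewrite rV_consB rk_cons HD; rewrite mulrCA mulrA.
  rewrite RintegralZl//; last first.
    apply: (@dom_integrable _ (measurableTypeR R) R leb _ _ _ iA).
      apply: measurable_funM.
        by apply: measurableT_comp; [exact: measurable_rk1|exact: measurable_funB].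
      have mD := smooth_le_meas sD; rewrite HD in mD.
      by apply: measurableT_comp mD _; exact: measurable_rVc_head.
    move=> s0; rewrite normrM (ger0_norm (rk1_ge0 _)) mulrC ler_wpM2r ?rk1_ge0//.
    by have := smooth_le_norm sD (rVc s0 s'); rewrite HD.
  congr (_ * _).
  have d1 y := is_derive_rVc_head y s' sH.
  rewrite -[RHS]/((fun y => H (rVc y s')) x0).
  have := @resolvent1 R (fun y => H (rVc y s')) (fun y => pd ord0 H (rVc y s')) D x0 d1.
  apply.
  - move=> y; apply: (continuous_comp (f := fun x => rVc x s')).
      exact: continuous_rVc_head.
    exact: (smooth_le_cont (smooth_le_pd ord0 sH)).
  - by move=> y; exact: (smooth_le_norm sH).
  - by move=> y; exact: (smooth_le_norm (smooth_le_pd ord0 sH)).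
rewrite -[F _]/((F \o rVc x0) x').
have sr : smooth_le n (fun=> C) (F \o rVc x0).
  exact: (smooth_le_rVc x0 (smooth_leS sF)).
rewrite -(IH _ _ x' sr); apply: eq_Rintegral => s' _; congr (_ * _).
rewrite -(@der1_rVc _ _ _ (fun=> C))//.
by rewrite size_enum_ord; exact: smooth_leS.
Qed.

End resolvent.

(** * Bessel's inequality *)

Section bessel.
Variable R : realType.
Notation mu := (lebesgue_rV R).

(** A cut-off in momentum that increases to 1 with k. As a dilation of wgt, it
    satisfies bounds on its derivatives that are uniform in k. *)
Definition kap n (k : nat) (p : 'rV[R]_n) : R := wgt (k.+1%:R^-1 *: p).

Lemma kap_ge0 n k (p : 'rV[R]_n) : 0 <= kap k p.
Proof. exact: wgt_ge0. Qed.

Lemma kap_le1 n k (p : 'rV[R]_n) : kap k p <= 1.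
Proof. exact: wgt_le1. Qed.

Lemma kap_int n k : (mu n).-integrable setT (EFin \o @kap n k) /\
  \int[mu n]_p kap k p <= (pi * k.+1%:R) ^+ n.
Proof.
have := @wgt_scale_int R n k.+1%:R^-1 0; rewrite invr_gt0 ltr0n => /(_ isT).
rewrite invrK.
have -> // : (fun x => wgt (k.+1%:R^-1 *: (x - 0))) = @kap n k.
by apply/funext => x; rewrite subr0.
Qed.

Lemma smooth_le_wgt n N : exists2 C : R, 0 <= C &
  smooth_le N (fun x => C * wgt x) (@wgt R n).
Proof.
have [|C C0 H] := @smooth_le_wgt_lin R n n N (fun i j => (j == i)%:R).
  by move=> i j; case: eqP; rewrite ?normr1 ?normr0.
have E (x : 'rV[R]_n) : \prod_i cw (\sum_j (j == i)%:R * x 0 j) = wgt x.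
  apply: eq_bigr => i _; congr cw.
  rewrite (bigD1 i)//= eqxx mul1r big1 ?addr0// => k ki.
  by rewrite (negbTE ki) mul0r.
exists C => //.
have -> : @wgt R n = (fun x => \prod_i cw (\sum_j (j == i)%:R * x 0 j)).
  by apply/funext => x; rewrite E.
exact: H.
Qed.

Lemma kap_scale n k x j (t : R) :
  (fun p : 'rV[R]_n => k.+1%:R^-1 *: p) (t *: delta_mx 0 j + x) =
  (t * k.+1%:R^-1) *: delta_mx 0 j + (fun p : 'rV[R]_n => k.+1%:R^-1 *: p) x.
Proof. by rewrite /= scalerDr scalerA [t * _]mulrC. Qed.

Lemma continuous_scale_rV n (c : R) : continuous (fun p : 'rV[R]_n => c *: p).
Proof.
apply: continuous_rVP => i; under eq_fun do rewrite mxE.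
by apply: contZ; exact: continuous_coord.
Qed.

Lemma smooth_le_kap n k N (w f : 'rV[R]_n -> R) : smooth_le N w f ->
  smooth_le N (fun p => w (k.+1%:R^-1 *: p)) (fun p => f (k.+1%:R^-1 *: p)).
Proof.
apply: (@smooth_le_comp _ _ _ _ _ _ _ id (fun=> k.+1%:R^-1)).
- exact: continuous_scale_rV.
- by move=> _; rewrite ger0_norm ?invr_ge0// invf_le1// ler1n.
- by move=> j x t; rewrite kap_scale.
Qed.

Lemma pd_kap n k N (w f : 'rV[R]_n -> R) j : smooth_le N.+1 w f ->
  pd j (fun p => f (k.+1%:R^-1 *: p)) =
  (fun p => k.+1%:R^-1 * pd j f (k.+1%:R^-1 *: p)).
Proof.
move=> sf; apply/funext => p.
have := is_derive_affine (fun t => kap_scale k p j t)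
  (smooth_le_derive j sf (k.+1%:R^-1 *: p)).
by case.
Qed.

(** Dilation by l turns d_j into d_j / l. *)
Lemma lap_kap n k (s : seq 'I_n) (w f : 'rV[R]_n -> R) :
  smooth_le (2 * size s)%N w f ->
  lap (k.+1%:R ^+ 2) s (fun p => f (k.+1%:R^-1 *: p)) =
  (fun p => lap 1 s f (k.+1%:R^-1 *: p)).
Proof.
elim: s => [//|j s IH]; rewrite [size (_ :: _)]/= mulnS => sf.
have {}IH := IH (smooth_le_anti (leq_addl _ _) sf).
have sg := @smooth_le_lap _ _ 2%N 1 s w f sf.
rewrite /lap /= -!/(lap _ _ _) IH; apply/funext => v /=.
set g := lap 1 s f in sg *.
have sg1 := smooth_le_pd j sg.
have sg1' := smooth_le_kap k sg1.
rewrite (pd_kap _ _ sg) pdZ; last first.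
  by move=> x; have [] := smooth_le_derive j sg1' x.
rewrite (pd_kap _ _ sg1) !mulrA; congr (_ + _ * _).
have l0 : k.+1%:R != 0 :> R by rewrite pnatr_eq0.
by rewrite expr2 !mulNr mulfK// mulfV.
Qed.

Lemma kap_le_wgt n k (p : 'rV[R]_n) : kap k p <= (k.+1%:R ^+ 2) ^+ n * wgt p.
Proof.
rewrite -[X in _ ^+ X](card_ord n) -prodr_const /kap /wgt /prodf -big_split/=.
apply: ler_prod => i _; rewrite cw_ge0/= mxE.
rewrite /cw ler_pdivlMr ?cw_den_gt0// mulrC ler_pdivrMr ?cw_den_gt0//.
have kn : (0 : R) < k.+1%:R by rewrite ltr0n.
rewrite mulrDr mulr1 exprMn mulrA -exprMn mulfV ?gt_eqF// expr1n mul1r.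
by rewrite lerD2r exprn_ege1// ler1n.
Qed.

(** Integration by parts with the parameter l = k + 1 matches the dilation in
    kap, so that the right-hand side has an integral over t that does not depend
    on k. *)
Lemma kap_osc n (c b : R) : exists2 K : R, 0 <= K & forall k (t : 'rV[R]_n),
  `|\int[mu n]_p (cos (c * dotp p t + b) * kap k p)| <=
    K * k.+1%:R ^+ n * wgt ((k.+1%:R * c) *: t).
Proof.
have [C C0 sW] := smooth_le_wgt n (2 * n).
exists (2 ^+ n * C * pi ^+ n) => [|k t].
  by rewrite !mulr_ge0 ?exprn_ge0 ?pi_ge0.
have kn : (0 : R) < k.+1%:R by rewrite ltr0n.
have sK : smooth_le (2 * n)%N (fun p => C * kap k p) (@kap n k).
  exact: (smooth_le_kap k sW).
have sK' : smooth_le (2 * n)%N (fun p => C * (k.+1%:R ^+ 2) ^+ n * wgt p) (@kap n k).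
  by apply: smooth_le_weight sK => p; rewrite -mulrA ler_wpM2l// kap_le_wgt.
rewrite (@osc_ibp _ _ c k.+1%:R b _ _ t sK') normrM ger0_norm ?wgt_ge0// mulrC.
rewrite ler_wpM2r ?wgt_ge0//.
have sL : smooth_le 0 (fun p => 2 ^+ n * (C * kap k p))
    (lap (k.+1%:R ^+ 2) (enum 'I_n) (@kap n k)).
  have -> : lap (k.+1%:R ^+ 2) (enum 'I_n) (@kap n k) =
      (fun p => lap 1 (enum 'I_n) (@wgt R n) (k.+1%:R^-1 *: p)).
    apply: (@lap_kap n k _ (fun x => C * wgt x)).
    by rewrite size_enum_ord.
  have := @smooth_le_lap _ n 0 1 (enum 'I_n) (fun x => C * wgt x) (@wgt R n).
  rewrite size_enum_ord normr1 => /(_ sW) H.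
  exact: (smooth_le_kap k H).
have [iK leK] := kap_int n k.
apply: (@le_trans _ _ (\int[mu n]_p (2 ^+ n * C * kap k p))).
  apply: dom_Rintegral.
  - apply: measurable_funM; [exact: measurable_cos_dotp|exact: smooth_le_meas sL].
  - exact: integrable_scale.
  - move=> p; rewrite normrM -mulrA (le_trans _ (smooth_le_norm sL p))//.
    by rewrite ler_piMl// normr_cos_le1.
rewrite RintegralZl// -!mulrA -exprMn; do 2 rewrite ler_wpM2l ?exprn_ge0//.
Qed.

End bessel.

Section tonelli_prod.
Context d1 d2 (T1 : measurableType d1) (T2 : measurableType d2) (R : realType).
Variable m1 : {sigma_finite_measure set T1 -> \bar R}.
Variable m2 : {sigma_finite_measure set T2 -> \bar R}.

Lemma tonelli_prod1 (f : T1 * T2 -> R) (G : T1 -> R) :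
  measurable_fun setT f -> (forall z, 0 <= f z) ->
  m1.-integrable setT (EFin \o G) ->
  (forall x, \int[m2]_y (f (x, y))%:E <= (G x)%:E)%E ->
  (m1 \x m2)%E.-integrable setT (EFin \o f) /\
  \int[(m1 \x m2)%E]_z f z <= \int[m1]_x G x.
Proof.
move=> mf f0 iG fG.
have mE : measurable_fun setT (EFin \o f) by exact/measurable_EFinP.
apply: ge0_integrable_le => //.
rewrite (EFin_Rint iG) (fubini_tonelli1 (EFin \o f))//.
apply: ge0_le_integral => //.
- by move=> x _; apply: integral_ge0 => y _; rewrite lee_fin.
- exact: (measurable_fun_fubini_tonelli_F (m2 := m2) (EFin \o f)).
- exact: (measurable_int _ iG).
- by move=> x _; exact: fG.
Qed.

Lemma tonelli_prod2 (f : T1 * T2 -> R) (G : T2 -> R) :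
  measurable_fun setT f -> (forall z, 0 <= f z) ->
  m2.-integrable setT (EFin \o G) ->
  (forall y, \int[m1]_x (f (x, y))%:E <= (G y)%:E)%E ->
  (m1 \x m2)%E.-integrable setT (EFin \o f) /\
  \int[(m1 \x m2)%E]_z f z <= \int[m2]_y G y.
Proof.
move=> mf f0 iG fG.
have mE : measurable_fun setT (EFin \o f) by exact/measurable_EFinP.
apply: ge0_integrable_le => //.
rewrite (EFin_Rint iG) (fubini_tonelli2 (EFin \o f))//.
apply: ge0_le_integral => //.
- by move=> y _; apply: integral_ge0 => x _; rewrite lee_fin.
- exact: (measurable_fun_fubini_tonelli_G (m1 := m1) (EFin \o f)).
- exact: (measurable_int _ iG).
- by move=> y _; exact: fG.
Qed.

End tonelli_prod.

Section mu2.
Variables (R : realType) (n : nat).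
Notation V := 'rV[R]_n.
Notation mu := (lebesgue_rV R n).

(** The sigma-finite structure is what Fubini's theorem on pairs of pairs
    requires. *)
Definition mu2 : set (V * V) -> \bar R := (mu \x mu)%E.

Let mu2_0 : mu2 set0 = 0%E. Proof. exact: measure0. Qed.
Let mu2_ge0 A : (0 <= mu2 A)%E. Proof. exact: (measure_ge0 (mu \x mu)%E). Qed.
Let mu2_add : semi_sigma_additive mu2.
Proof. exact: (@measure_semi_sigma_additive _ _ _ (mu \x mu)%E). Qed.

HB.instance Definition _ := isMeasure.Build _ _ _ mu2 mu2_0 mu2_ge0 mu2_add.

Let mu2_sigma_finite : sigma_finite setT mu2.
Proof.
have /sigma_finiteP[F [TF ndF Foo]] := sigma_finiteT mu.
exists (fun k => F k `*` F k).
  apply/seteqP; split=> // -[x y] _ /=.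
  have [k _ Fk] : (\bigcup_k F k) x by rewrite -TF.
  have [l _ Fl] : (\bigcup_k F k) y by rewrite -TF.
  exists (maxn k l) => //; split.
    by move: Fk; exact/subsetPset/ndF/leq_maxl.
  by move: Fl; exact/subsetPset/ndF/leq_maxr.
move=> k; have [mF Fk] := Foo k; split; first exact: measurableX.
by rewrite /mu2 product_measure1E// lte_mul_pinfty// ge0_fin_numE.
Qed.

HB.instance Definition _ := Measure_isSigmaFinite.Build _ _ _ mu2 mu2_sigma_finite.

Lemma Rint_mu2 (f : V * V -> R) (A B : V -> R) : measurable_fun setT f ->
  mu.-integrable setT (EFin \o A) -> mu.-integrable setT (EFin \o B) ->
  (forall x y, `|f (x, y)| <= A x * B y) ->
  \int[mu2]_z f z = \int[mu]_x \int[mu]_y f (x, y).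
Proof. exact: Rint_prod. Qed.

Lemma integrable_mu2 (f : V * V -> R) (A B : V -> R) : measurable_fun setT f ->
  mu.-integrable setT (EFin \o A) -> mu.-integrable setT (EFin \o B) ->
  (forall x y, `|f (x, y)| <= A x * B y) ->
  mu2.-integrable setT (EFin \o f).
Proof. exact: dom_prod_integrable. Qed.

Lemma tonelli_mu2_1 (f : V * V -> R) (G : V -> R) :
  measurable_fun setT f -> (forall z, 0 <= f z) ->
  mu.-integrable setT (EFin \o G) ->
  (forall x, \int[mu]_y (f (x, y))%:E <= (G x)%:E)%E ->
  mu2.-integrable setT (EFin \o f) /\ \int[mu2]_z f z <= \int[mu]_x G x.
Proof. exact: tonelli_prod1. Qed.

Lemma tonelli_mu2_2 (f : V * V -> R) (G : V -> R) :
  measurable_fun setT f -> (forall z, 0 <= f z) ->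
  mu.-integrable setT (EFin \o G) ->
  (forall y, \int[mu]_x (f (x, y))%:E <= (G y)%:E)%E ->
  mu2.-integrable setT (EFin \o f) /\ \int[mu2]_z f z <= \int[mu]_y G y.
Proof. exact: tonelli_prod2. Qed.

End mu2.

Section schur.
Variable R : realType.
Notation mu := (lebesgue_rV R).
Variable n : nat.
Notation nu := (@mu2 R n).

Lemma wgt_scale_sub_int (l : R) (s : 'rV[R]_n) : 0 < l ->
  (mu n).-integrable setT (EFin \o (fun x => wgt (l *: (s - x)))) /\
  \int[mu n]_x wgt (l *: (s - x)) <= (pi / l) ^+ n.
Proof.
move=> l0; have := wgt_scale_int s l0.
have -> // : (fun x => wgt (l *: (x - s))) = (fun x => wgt (l *: (s - x))).
by apply/funext => x; rewrite -wgtN -scalerN opprB.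
Qed.

(** Schur's test for the kernel wgt (l (s - t)), whose integrals in s and in t
    are both at most (pi / l)^n. *)
Lemma schur (l : R) (A B : 'rV[R]_n -> R) : 0 < l ->
  measurable_fun setT A -> measurable_fun setT B ->
  (forall x, 0 <= A x) -> (forall x, 0 <= B x) ->
  (mu n).-integrable setT (EFin \o A) -> (mu n).-integrable setT (EFin \o B) ->
  nu.-integrable setT (EFin \o (fun z => wgt (l *: (z.1 - z.2)) * (A z.1 + B z.2))) /\
  \int[nu]_z (wgt (l *: (z.1 - z.2)) * (A z.1 + B z.2)) <=
    (pi / l) ^+ n * (\int[mu n]_x A x + \int[mu n]_x B x).
Proof.
move=> l0 mA mB A0 B0 iA iB.
have mw : measurable_fun setT (fun z : 'rV[R]_n * 'rV[R]_n => wgt (l *: (z.1 - z.2))).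
  apply: measurableT_comp; first exact: measurable_wgt.
  by apply: measurable_rV_scale => //; exact: measurable_rV_sub.
have [i1 le1] : nu.-integrable setT (EFin \o (fun z => wgt (l *: (z.1 - z.2)) * A z.1)) /\
  \int[nu]_z (wgt (l *: (z.1 - z.2)) * A z.1) <= \int[mu n]_x ((pi / l) ^+ n * A x).
  apply: tonelli_mu2_1.
  - by apply: measurable_funM => //; exact: measurableT_comp.
  - by move=> z; rewrite mulr_ge0 ?wgt_ge0.
  - exact: integrable_scale.
  - move=> x /=; have [iw lew] := wgt_scale_sub_int x l0.
    rewrite -EFin_Rint; last first.
      have := integrable_scale (A x) iw.
      by congr integrable; apply/funext => y /=; rewrite mulrC.
    by rewrite RintegralZr// lee_fin ler_wpM2r.
have [i2 le2] : nu.-integrable setT (EFin \o (fun z => wgt (l *: (z.1 - z.2)) * B z.2)) /\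
  \int[nu]_z (wgt (l *: (z.1 - z.2)) * B z.2) <= \int[mu n]_x ((pi / l) ^+ n * B x).
  apply: tonelli_mu2_2.
  - by apply: measurable_funM => //; exact: measurableT_comp.
  - by move=> z; rewrite mulr_ge0 ?wgt_ge0.
  - exact: integrable_scale.
  - move=> y /=; have [iw lew] := wgt_scale_int y l0.
    rewrite -EFin_Rint; last first.
      have := integrable_scale (B y) iw.
      by congr integrable; apply/funext => x /=; rewrite mulrC.
    by rewrite RintegralZr// lee_fin ler_wpM2r.
have E : (fun z : 'rV[R]_n * 'rV[R]_n => wgt (l *: (z.1 - z.2)) * (A z.1 + B z.2)) =
  (fun z => wgt (l *: (z.1 - z.2)) * A z.1 + wgt (l *: (z.1 - z.2)) * B z.2).
  by apply/funext => z; rewrite mulrDr.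
rewrite E; split; first exact: integrable_add.
rewrite RintegralD// mulrDr lerD//.
  by move: le1; rewrite RintegralZl.
by move: le2; rewrite RintegralZl.
Qed.

End schur.

Section bessel.
Variable R : realType.
Notation mu := (lebesgue_rV R).
Variables (n : nat) (c : R).
Hypothesis c0 : 0 < c.
Notation V := 'rV[R]_n.
Notation nu := (@mu2 R n).

Definition ftc (f : V -> R) (p : V) : R := \int[mu n]_y (cos (c * dotp p y) * f y).
Definition fts (f : V -> R) (p : V) : R := \int[mu n]_y (sin (c * dotp p y) * f y).
(** The squared modulus of the Fourier transform of f. *)
Definition ftq (f : V -> R) (p : V) : R := ftc f p ^+ 2 + fts f p ^+ 2.

Lemma measurable_cosT d (T : measurableType d) (f : T -> R) :
  measurable_fun setT f -> measurable_fun setT (fun x => cos (f x)).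
Proof.
move=> mf; apply: measurableT_comp mf.
exact: (continuous_measurable_fun (@continuous_cos R)).
Qed.

Lemma measurable_sinT d (T : measurableType d) (f : T -> R) :
  measurable_fun setT f -> measurable_fun setT (fun x => sin (f x)).
Proof.
move=> mf; apply: measurableT_comp mf.
exact: (continuous_measurable_fun (@continuous_sin R)).
Qed.

Lemma measurable_kap k : measurable_fun setT (@kap R n k).
Proof.
apply: measurableT_comp; first exact: measurable_wgt.
by apply: measurable_rV_scale.
Qed.

Lemma dotpB (p x y : V) : dotp p (x - y) = dotp p x - dotp p y.
Proof.
rewrite /dotp -sumrB; apply: eq_bigr => j _.
by rewrite !mxE mulrBr.
Qed.

Section one_function.
Variables (f : V -> R) (A : R).
Hypothesis mf : measurable_fun setT f.
Hypothesis bf : forall x, `|f x| <= A * wgt x.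

Let A0 : 0 <= A.
Proof. by have := le_trans (normr_ge0 _) (bf 0); rewrite pmulr_lge0// wgt_gt0. Qed.

Lemma ftc_integrable p :
  (mu n).-integrable setT (EFin \o (fun y => cos (c * dotp p y) * f y)).
Proof.
apply: dom_integrable (integrable_wgtZ n A) _.
  apply: measurable_funM => //; apply: measurable_cosT.
  by apply: measurable_funM => //; exact: measurable_dotp.
by move=> x; rewrite normrM (le_trans _ (bf x))// ler_piMl// normr_cos_le1.
Qed.

Lemma fts_integrable p :
  (mu n).-integrable setT (EFin \o (fun y => sin (c * dotp p y) * f y)).
Proof.
apply: dom_integrable (integrable_wgtZ n A) _.
  apply: measurable_funM => //; apply: measurable_sinT.
  by apply: measurable_funM => //; exact: measurable_dotp.
by move=> x; rewrite normrM (le_trans _ (bf x))// ler_piMl// normr_sin_le1.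
Qed.

Lemma sqr_integrable :
  (mu n).-integrable setT (EFin \o (fun y => f y ^+ 2)).
Proof.
apply: dom_integrable (integrable_wgtZ n (A ^+ 2)) _.
  exact: measurable_funX.
move=> x; rewrite normrX (le_trans (_ : _ <= (A * wgt x) ^+ 2))//.
  by rewrite lerXn2r ?nnegrE ?mulr_ge0 ?wgt_ge0.
rewrite exprMn ler_wpM2l ?sqr_ge0// expr2 ler_piMr ?wgt_ge0 ?wgt_le1//.
Qed.

Lemma integrable_wgt2 (C : R) :
  nu.-integrable setT (EFin \o (fun z => C * (wgt z.1 * wgt z.2))).
Proof.
apply: integrable_scale.
apply: (integrable_mu2 _ (integrable_wgt R n) (integrable_wgt R n)).
  by apply: measurable_funM; apply: measurableT_comp => //; exact: measurable_wgt.
by move=> x y; rewrite ger0_norm// mulr_ge0 ?wgt_ge0.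
Qed.

(** From cos (s - t) = cos s cos t + sin s sin t. *)
Lemma ftqE p : ftq f p = \int[nu]_z (cos (c * dotp p (z.1 - z.2)) * (f z.1 * f z.2)).
Proof.
rewrite (Rint_mu2 (A := fun x => A * wgt x) (B := fun x => A * wgt x)); first last.
- move=> x y /=; rewrite normrM (le_trans _ (_ : `|f x * f y| <= _))//.
    by rewrite ler_piMl// normr_cos_le1.
  by rewrite normrM ler_pM.
- exact: integrable_wgtZ.
- exact: integrable_wgtZ.
- apply: measurable_funM; last by apply: measurable_funM; exact: measurableT_comp.
  apply: measurable_cosT; apply: measurable_funM => //.
  by apply: measurable_dotp => //; exact: measurable_rV_sub.
transitivity (\int[mu n]_x (cos (c * dotp p x) * f x * ftc f p +
    sin (c * dotp p x) * f x * fts f p)).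
  have ic := ftc_integrable p; have is_ := fts_integrable p.
  rewrite RintegralD//.
  - by rewrite !RintegralZr.
  - have := integrable_scale (ftc f p) ic.
    by congr integrable; apply/funext => y /=; rewrite mulrC.
  - have := integrable_scale (fts f p) is_.
    by congr integrable; apply/funext => y /=; rewrite mulrC.
apply: eq_Rintegral => x _.
have ic := ftc_integrable p; have is_ := fts_integrable p.
rewrite -!RintegralZl// -RintegralD//; try exact: integrable_scale.
apply: eq_Rintegral => y _ /=.
by rewrite dotpB mulrBr cosB; ring.
Qed.

Lemma ftq_ge0 p : 0 <= ftq f p.
Proof. by rewrite addr_ge0// sqr_ge0. Qed.

End one_function.

(** Half of Plancherel's theorem. By Fubini the left-hand side is a quadratic
    form in f whose kernel is the Fourier transform of kap, to which Schur's
    test applies. *)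
Lemma bessel : exists2 K : R, 0 <= K & forall (f : V -> R) (A : R) (k : nat),
  measurable_fun setT f -> (forall x, `|f x| <= A * wgt x) ->
  (mu n).-integrable setT (EFin \o (fun p => kap k p * ftq f p)) /\
  \int[mu n]_p (kap k p * ftq f p) <= K * \int[mu n]_y (f y ^+ 2).
Proof.
have [K K0 HK] := kap_osc n c 0.
exists (K * (pi / c) ^+ n) => [|f A k mf bf].
  by rewrite mulr_ge0// exprn_ge0// divr_ge0 ?pi_ge0// ltW.
have A0 : 0 <= A.
  by have := le_trans (normr_ge0 _) (bf 0); rewrite pmulr_lge0// wgt_gt0.
have [ik _] := kap_int R n k.
pose F (z : V * (V * V)) := cos (c * dotp z.1 (z.2.1 - z.2.2)) * kap k z.1 *
  (f z.2.1 * f z.2.2).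
have mF : measurable_fun setT F.
  apply: measurable_funM; first apply: measurable_funM.
  - apply: measurable_cosT; apply: measurable_funM => //.
    apply: measurable_dotp => //; apply: measurable_rV_sub.
      by apply: measurableT_comp => //; exact: measurable_snd.
    by apply: measurableT_comp => //; exact: measurable_snd.
  - by apply: (measurableT_comp (measurable_kap k)).
  - apply: measurable_funM; apply: (measurableT_comp mf).
      by apply: measurableT_comp => //; exact: measurable_snd.
    by apply: measurableT_comp => //; exact: measurable_snd.
have bF p z : `|F (p, z)| <= kap k p * (A ^+ 2 * (wgt z.1 * wgt z.2)).
  rewrite /F normrM /=; apply: ler_pM => //.
    by rewrite normrM (ger0_norm (kap_ge0 _ _)) ler_piMl ?kap_ge0// normr_cos_le1.
  rewrite normrM expr2 mulrACA; exact: ler_pM.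
have iB := integrable_wgt2 (A ^+ 2).
have E : (fun p => kap k p * ftq f p) = (fun p => \int[nu]_z F (p, z)).
  apply/funext => p; rewrite (ftqE mf bf) -RintegralZl//.
    by apply: eq_Rintegral => z _; rewrite /F /= mulrCA mulrA.
  apply: dom_integrable iB _.
    apply: measurable_funM; last by apply: measurable_funM; exact: measurableT_comp.
    apply: measurable_cosT; apply: measurable_funM => //.
    by apply: measurable_dotp => //; exact: measurable_rV_sub.
  move=> z; rewrite normrM (le_trans _ (_ : `|f z.1 * f z.2| <= _))//.
    by rewrite ler_piMl// normr_cos_le1.
  by rewrite normrM expr2 mulrACA; exact: ler_pM.
rewrite E; split.
  exact: (dom_Rint_prod mF ik iB bF).
rewrite (Rfubini mF ik iB bF).
have kn : (0 : R) < k.+1%:R by rewrite ltr0n.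
have lc0 : 0 < k.+1%:R * c by rewrite mulr_gt0.
(* |f x f y| <= S x + S y *)
pose S (y : V) := 2^-1 * f y ^+ 2.
have mS : measurable_fun setT S by apply: measurable_funM => //; exact: measurable_funX.
have S0 y : 0 <= S y by rewrite mulr_ge0// sqr_ge0.
have iS : (mu n).-integrable setT (EFin \o S).
  by apply: integrable_scale; exact: (sqr_integrable mf bf).
have [i1 le1] := schur lc0 mS mS S0 S0 iS iS.
apply: (@le_trans _ _ (\int[nu]_z (K * k.+1%:R ^+ n *
    (wgt ((k.+1%:R * c) *: (z.1 - z.2)) * (S z.1 + S z.2))))).
  apply: le_Rint.
  - exact: (dom_Rint_prod2 mF ik iB bF).
  - exact: integrable_scale.
  move=> z; rewrite /F /= RintegralZr; last first.
  - apply: dom_integrable ik _.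
      apply: measurable_funM; last exact: measurable_kap.
      apply: measurable_cosT; apply: measurable_funM => //.
      by apply: measurable_dotp.
    by move=> p; rewrite normrM (ger0_norm (kap_ge0 _ _)) ler_piMl ?kap_ge0// normr_cos_le1.
  - by [].
  apply: le_trans (ler_norm _) _; rewrite normrM mulrA; apply: ler_pM => //.
    have := HK k (z.1 - z.2); under eq_Rintegral do rewrite addr0; exact.
  rewrite normrM /S -mulrDr ler_pdivlMl//.
  have := sqr_ge0 (`|f z.1| - `|f z.2|).
  by rewrite -(real_normK (num_real (f z.1))) -(real_normK (num_real (f z.2))) !expr2; nra.
rewrite RintegralZl//.
apply: le_trans (ler_wpM2l _ le1) _; first by rewrite mulr_ge0 ?exprn_ge0.
rewrite /S RintegralZl//; last exact: (sqr_integrable mf bf).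
have -> : (pi / (k.+1%:R * c)) ^+ n = (pi / c) ^+ n / k.+1%:R ^+ n.
  by rewrite -expr_div_n; congr (_ ^+ n); field; rewrite !gt_eqF.
have kn0 : k.+1%:R ^+ n != 0 :> R by rewrite expf_neq0// gt_eqF.
rewrite le_eqVlt; apply/orP; left; apply/eqP; field; exact: kn0.
Qed.

End bessel.

(** * Functions on phase space *)

Lemma cont_comp (S T U : topologicalType) (f : S -> T) (g : T -> U) :
  continuous f -> continuous g -> continuous (fun x => g (f x)).
Proof.
by move=> cf cg x; apply: (@continuous_comp _ _ _ f g x); [exact: cf|exact: cg].
Qed.

Section phase_space_maps.
Variables (R : realType) (n : nat).
Notation V := 'rV[R]_n.

Lemma split_l (i : 'I_n) : fintype.split (lshift n i) = inl i.
Proof. exact: (unsplitK (inl i)). Qed.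
Lemma split_r (i : 'I_n) : fintype.split (rshift n i) = inr i.
Proof. exact: (unsplitK (inr i)). Qed.

Lemma row_mx_dl (q p : V) j (t : R) :
  row_mx (t *: delta_mx 0 j + q) p =
  (t * 1) *: delta_mx 0 (lshift n j) + row_mx q p.
Proof.
apply/rowP => i; case: (split_ordP i) => k ->;
  rewrite !(row_mxEl, row_mxEr, mxE) !eqxx mulr1 ?eq_lshift ?eq_rlshift//.
by rewrite mulr0 add0r.
Qed.

Lemma row_mx_dr (q p : V) j (t : R) :
  row_mx q (t *: delta_mx 0 j + p) =
  (t * 1) *: delta_mx 0 (rshift n j) + row_mx q p.
Proof.
apply/rowP => i; case: (split_ordP i) => k ->;
  rewrite !(row_mxEl, row_mxEr, mxE) !eqxx mulr1 ?eq_rshift ?eq_lrshift//.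
by rewrite mulr0 add0r.
Qed.

Lemma continuous_row_mx (T : topologicalType) (f g : T -> V) :
  continuous f -> continuous g -> continuous (fun x => row_mx (f x) (g x)).
Proof.
move=> cf cg; apply: continuous_rVP => i.
case: (split_ordP i) => k ->.
  under eq_fun do rewrite row_mxEl.
  exact: (cont_comp cf (@continuous_coord R n k)).
under eq_fun do rewrite row_mxEr.
exact: (cont_comp cg (@continuous_coord R n k)).
Qed.

Lemma continuous_rsub : continuous (fun z : 'rV[R]_(n + n) => rsubmx z).
Proof.
apply: continuous_rVP => i; under eq_fun do rewrite mxE; exact: continuous_coord.
Qed.

Lemma smooth_le_rsub N (w f : V -> R) : smooth_le N w f ->
  smooth_le N (fun z : 'rV[R]_(n + n) => w (rsubmx z)) (fun z => f (rsubmx z)).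
Proof.
apply: (@smooth_le_comp _ _ _ _ _ _ (fun z : 'rV[R]_(n + n) => rsubmx z)
  (fun j => match fintype.split j with inl i => i | inr i => i end)
  (fun j => match fintype.split j with inl i => 0 | inr i => 1 end)).
- exact: continuous_rsub.
- by move=> j; case: fintype.split => _; rewrite ?normr0 ?normr1.
- move=> j x t; apply/rowP => i.
  case: (split_ordP j) => k ->; rewrite ?split_l ?split_r !mxE eqxx /=.
    by rewrite eq_rlshift !mulr0 mul0r.
  by rewrite mulr1 eq_rshift.
Qed.

(** The function wgt (x - y) on phase space is a product of values of cw at
    linear forms with coefficients 1, -1 and 0. *)
Lemma smooth_le_sub N : exists2 C : R, 0 <= C &
  smooth_le N (fun z : 'rV[R]_(n + n) => C * wgt (lsubmx z - rsubmx z))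
    (fun z => wgt (lsubmx z - rsubmx z)).
Proof.
have [|C C0 H] := @smooth_le_wgt_lin R (n + n) n N
    (fun i j => (j == lshift n i)%:R - (j == rshift n i)%:R).
  move=> i j; case: (split_ordP j) => k ->;
    rewrite ?eq_lshift ?eq_rshift ?eq_lrshift ?eq_rlshift ?subr0 ?sub0r ?normrN;
    by case: eqP => _; rewrite ?normr1 ?normr0.
have E (z : 'rV[R]_(n + n)) : \prod_i cw (\sum_j
    ((j == lshift n i)%:R - (j == rshift n i)%:R) * z 0 j) =
    wgt (lsubmx z - rsubmx z).
  apply: eq_bigr => i _; congr cw; rewrite !mxE.
  under eq_bigr do rewrite mulrBl.
  rewrite sumrB (bigD1 (lshift n i))//= eqxx mul1r big1 ?addr0; last first.
    by move=> j ji; rewrite (negbTE ji) mul0r.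
  rewrite (bigD1 (rshift n i))//= eqxx mul1r big1 ?addr0// => j ji.
  by rewrite (negbTE ji) mul0r.
exists C => //.
have -> : (fun z : 'rV[R]_(n + n) => wgt (lsubmx z - rsubmx z)) =
  (fun z => \prod_i cw (\sum_j
    ((j == lshift n i)%:R - (j == rshift n i)%:R) * z 0 j)).
  by apply/funext => z; rewrite E.
by apply: smooth_le_weight H => z; rewrite E.
Qed.

Section amplitude.
Variable tau : R.
Hypothesis tau01 : 0 <= tau <= 1.

Definition mid (x y : V) : V := (1 - tau) *: x + tau *: y.

(** The hypothesis 0 <= tau <= 1 makes the bound uniform in tau: both
    coefficients of the substitution are at most 1 in absolute value. *)
Lemma smooth_le_mid N (w f : 'rV[R]_(n + n) -> R) (p : V) : smooth_le N w f ->
  smooth_le N (fun z : 'rV[R]_(n + n) => w (row_mx (mid (lsubmx z) (rsubmx z)) p))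
    (fun z => f (row_mx (mid (lsubmx z) (rsubmx z)) p)).
Proof.
have [t0 t1] := andP tau01.
apply: (@smooth_le_comp _ _ _ _ _ _
  (fun z : 'rV[R]_(n + n) => row_mx (mid (lsubmx z) (rsubmx z)) p)
  (fun j => match fintype.split j with inl i => lshift n i | inr i => lshift n i end)
  (fun j => match fintype.split j with inl i => 1 - tau | inr i => tau end)).
- apply: continuous_row_mx; last exact: cst_continuous.
  apply: continuous_rVP => i; rewrite /mid; under eq_fun do rewrite !mxE.
  by apply: contD; apply: contZ; exact: continuous_coord.
- by move=> j; case: fintype.split => _; rewrite ger0_norm// ?subr_ge0//; lra.
- move=> j x t; apply/rowP => i.
  case: (split_ordP j) => k ->; case: (split_ordP i) => k' ->;
    rewrite ?split_l ?split_r !(row_mxEl, row_mxEr, mxE) !eqxx /=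
      ?eq_lshift ?eq_rshift ?eq_lrshift ?eq_rlshift ?mulr0n; ring.
Qed.

Lemma smooth_le_mid_y N (w f : 'rV[R]_(n + n) -> R) (x p : V) : smooth_le N w f ->
  smooth_le N (fun y => w (row_mx (mid x y) p)) (fun y => f (row_mx (mid x y) p)).
Proof.
have [t0 t1] := andP tau01.
apply: (@smooth_le_comp _ _ _ _ _ _ (fun y => row_mx (mid x y) p)
  (fun j => lshift n j) (fun _ => tau)).
- apply: continuous_row_mx; last exact: cst_continuous.
  apply: continuous_rVP => i; rewrite /mid; under eq_fun do rewrite !mxE.
  by apply: contD; [exact: cst_continuous|apply: contZ; exact: continuous_coord].
- by move=> j; rewrite ger0_norm.
- move=> j y t; apply/rowP => i; case: (split_ordP i) => k' ->;
    rewrite !(row_mxEl, row_mxEr, mxE) !eqxx /=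
      ?eq_lshift ?eq_rshift ?eq_lrshift ?eq_rlshift ?mulr0n; ring.
Qed.

End amplitude.

Lemma smooth_le_row_l N (w f : 'rV[R]_(n + n) -> R) (p : V) : smooth_le N w f ->
  smooth_le N (fun q => w (row_mx q p)) (fun q => f (row_mx q p)).
Proof.
apply: (@smooth_le_comp _ _ _ _ _ _ (fun q => row_mx q p) (fun j => lshift n j) (fun=> 1)).
- apply: continuous_row_mx; last exact: cst_continuous.
  by move=> x; exact: cvg_id.
- by move=> _; rewrite normr1.
- by move=> j x t; exact: row_mx_dl.
Qed.

Lemma smooth_le_row_r N (w f : 'rV[R]_(n + n) -> R) (q : V) : smooth_le N w f ->
  smooth_le N (fun p => w (row_mx q p)) (fun p => f (row_mx q p)).
Proof.
apply: (@smooth_le_comp _ _ _ _ _ _ (fun p => row_mx q p) (fun j => rshift n j) (fun=> 1)).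
- apply: continuous_row_mx; first exact: cst_continuous.
  by move=> x; exact: cvg_id.
- by move=> _; rewrite normr1.
- by move=> j x t; exact: row_mx_dr.
Qed.

End phase_space_maps.

(** * Windowed Fourier transforms *)

Section fixed_momentum.
Variables (R : realType) (n : nat) (c : R).
Hypothesis c0 : 0 < c.
Notation V := 'rV[R]_n.
Notation mu := (lebesgue_rV R n).
Notation nu := (@mu2 R n).

Lemma measurable_osc d (T : measurableType d) (b : R) (p x y : T -> V) :
  measurable_fun setT p -> measurable_fun setT x -> measurable_fun setT y ->
  measurable_fun setT (fun t => cos (c * dotp (p t) (x t - y t) + b)).
Proof.
move=> mp mx my; apply: measurable_cosT; apply: measurable_funD => //.
apply: measurable_funM => //; apply: measurable_dotp => //.
exact: measurable_rV_sub.
Qed.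

(** By the addition formulas the oscillating factor is a combination of products
    of a function of x and a function of y, so that the integral is a
    combination of products of Fourier transforms; then 2 |r s| <= r^2 + s^2. *)
Lemma osc_pair_le (b : R) (f g : V -> R) (A B : R) (p : V) :
  measurable_fun setT f -> measurable_fun setT g ->
  (forall x, `|f x| <= A * wgt x) -> (forall x, `|g x| <= B * wgt x) ->
  `|\int[nu]_z (cos (c * dotp p (z.1 - z.2) + b) * (f z.1 * g z.2))| <=
    ftq c f p + ftq c g p.
Proof.
move=> mf mg bf bg.
have ic := ftc_integrable c mf bf p; have is_ := fts_integrable c mf bf p.
have jc := ftc_integrable c mg bg p; have js := fts_integrable c mg bg p.
have -> : \int[nu]_z (cos (c * dotp p (z.1 - z.2) + b) * (f z.1 * g z.2)) =
   cos b * (ftc c f p * ftc c g p + fts c f p * fts c g p) -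
   sin b * (fts c f p * ftc c g p - ftc c f p * fts c g p).
  rewrite (Rint_mu2 (A := fun x => A * wgt x) (B := fun x => B * wgt x)); first last.
  - move=> x y /=; rewrite normrM (le_trans _ (_ : `|f x * g y| <= _))//.
      by rewrite ler_piMl// normr_cos_le1.
    by rewrite normrM ler_pM.
  - exact: integrable_wgtZ.
  - exact: integrable_wgtZ.
  - apply: measurable_funM; last by apply: measurable_funM; exact: measurableT_comp.
    exact: measurable_osc.
  transitivity (\int[mu]_x (
     (cos b * ftc c g p + sin b * fts c g p) * (cos (c * dotp p x) * f x) +
     (cos b * fts c g p - sin b * ftc c g p) * (sin (c * dotp p x) * f x))).
    apply: eq_Rintegral => x _.
    transitivity (\int[mu]_y (
       ((cos b * cos (c * dotp p x) - sin b * sin (c * dotp p x)) * f x) * (cos (c * dotp p y) * g y) +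
       ((cos b * sin (c * dotp p x) + sin b * cos (c * dotp p x)) * f x) * (sin (c * dotp p y) * g y))).
      apply: eq_Rintegral => y _ /=.
      rewrite dotpB mulrBr cosD cosB sinB; ring.
    rewrite RintegralD//; try exact: integrable_scale.
    rewrite !RintegralZl// -/(ftc c g p) -/(fts c g p); ring.
  rewrite RintegralD//; try exact: integrable_scale.
  rewrite !RintegralZl// -/(ftc c f p) -/(fts c f p); ring.
rewrite /ftq; set x := ftc c f p; set y := fts c f p; set z := ftc c g p; set w := fts c g p.
have tri (s u v : R) : `|s| <= 1 -> `|u| <= v -> `|s * u| <= v.
  by move=> s1 uv; rewrite normrM (le_trans _ uv)// ler_piMl.
have h1 : `|x * z + y * w| <= (x ^+ 2 + y ^+ 2 + (z ^+ 2 + w ^+ 2)) / 2.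
  rewrite ler_norml; apply/andP; split.
    have := sqr_ge0 (x + z); have := sqr_ge0 (y + w); rewrite !expr2; nra.
  have := sqr_ge0 (x - z); have := sqr_ge0 (y - w); rewrite !expr2; nra.
have h2 : `|y * z - x * w| <= (x ^+ 2 + y ^+ 2 + (z ^+ 2 + w ^+ 2)) / 2.
  rewrite ler_norml; apply/andP; split.
    have := sqr_ge0 (y + z); have := sqr_ge0 (x - w); rewrite !expr2; nra.
  have := sqr_ge0 (y - z); have := sqr_ge0 (x + w); rewrite !expr2; nra.
rewrite [leRHS]splitr (le_trans (ler_normB _ _))// lerD//.
  by apply: tri => //; exact: normr_cos_le1.
by apply: tri => //; exact: normr_sin_le1.
Qed.

Section windows.
Variables (v : V -> R) (A : R).
Hypothesis mv : measurable_fun setT v.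
Hypothesis bv : forall x, `|v x| <= A * wgt x ^+ 2.

Let A0 : 0 <= A.
Proof.
have := le_trans (normr_ge0 _) (bv 0); rewrite pmulr_lge0// exprn_gt0// wgt_gt0//.
Qed.

(** The function v seen through the window rk placed at s. *)
Definition win (s : V) : V -> R := fun x => v x * rk (x - s).

Lemma measurable_win s : measurable_fun setT (win s).
Proof. by apply: measurable_funM => //; exact: measurable_rk_sub. Qed.

(** Peetre's inequality trades half of the decay of v for decay in s. *)
Lemma win_le s x : `|win s x| <= A * 4 ^+ n * (wgt x * wgt s).
Proof.
rewrite /win normrM (ger0_norm (rk_ge0 _)).
apply: (@le_trans _ _ (A * wgt x ^+ 2 * (2 ^+ n * wgt (x - s)))).
  by apply: ler_pM; rewrite ?rk_ge0 ?rk_le_wgt.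
have -> : A * wgt x ^+ 2 * (2 ^+ n * wgt (x - s)) =
  A * 2 ^+ n * wgt x * (wgt x * wgt (x - s)) by ring.
have -> : A * 4 ^+ n * (wgt x * wgt s) = A * 2 ^+ n * wgt x * (2 ^+ n * wgt s).
  by rewrite (_ : 4 = 2 * 2 :> R) ?exprMn; ring.
by apply: ler_wpM2l; [rewrite !mulr_ge0 ?exprn_ge0 ?wgt_ge0|exact: wgt_peetre].
Qed.

Lemma win_le_wgt s x : `|win s x| <= (A * 4 ^+ n) * wgt x.
Proof.
apply: le_trans (win_le s x) _.
by rewrite ler_wpM2l ?mulr_ge0 ?exprn_ge0// ler_piMr ?wgt_ge0// wgt_le1.
Qed.

Lemma measurable_ftq_win : measurable_fun setT (fun z : V * V => ftq c (win z.2) z.1).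
Proof.
apply: measurable_funD; apply: measurable_funX.
- apply: (@measurable_Rint _ _ (V * V)%type V R mu
    (fun z => cos (c * dotp z.1.1 z.2) * win z.1.2 z.2)).
  have m1 : measurable_fun setT (fun z : V * V * V => z.1.1).
    by apply: measurableT_comp => //; exact: measurable_fst.
  have m2 : measurable_fun setT (fun z : V * V * V => z.1.2).
    by apply: measurableT_comp => //; exact: measurable_fst.
  apply: measurable_funM.
    by apply: measurable_cosT; apply: measurable_funM => //; exact: measurable_dotp.
  by apply: measurable_funM; [exact: measurableT_comp|exact: measurable_rk_sub].
- apply: (@measurable_Rint _ _ (V * V)%type V R mu
    (fun z => sin (c * dotp z.1.1 z.2) * win z.1.2 z.2)).
  have m1 : measurable_fun setT (fun z : V * V * V => z.1.1).
    by apply: measurableT_comp => //; exact: measurable_fst.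
  have m2 : measurable_fun setT (fun z : V * V * V => z.1.2).
    by apply: measurableT_comp => //; exact: measurable_fst.
  apply: measurable_funM.
    by apply: measurable_sinT; apply: measurable_funM => //; exact: measurable_dotp.
  by apply: measurable_funM; [exact: measurableT_comp|exact: measurable_rk_sub].
Qed.

Lemma ftq_win_integrable p : mu.-integrable setT (EFin \o (fun s => ftq c (win s) p)).
Proof.
pose D := A * 4 ^+ n * \int[mu]_x wgt x.
have D0 : 0 <= D.
  by rewrite !mulr_ge0 ?exprn_ge0// Rintegral_ge0// => x _; exact: wgt_ge0.
have bnd s (k : V -> R) : measurable_fun setT k -> (forall x, `|k x| <= 1) ->
    (\int[mu]_x (k x * win s x)) ^+ 2 <= D ^+ 2 * wgt s.
  move=> mk k1.
  have : `|\int[mu]_x (k x * win s x)| <= D * wgt s.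
    apply: (@le_trans _ _ (\int[mu]_x (A * 4 ^+ n * wgt s * wgt x))).
      apply: dom_Rintegral.
      - by apply: measurable_funM => //; exact: measurable_win.
      - exact: integrable_wgtZ.
      - move=> x; rewrite normrM (le_trans (_ : _ <= `|win s x|))//.
          by rewrite ler_piMl.
        by rewrite (le_trans (win_le s x))// [wgt x * _]mulrC mulrA.
    by rewrite RintegralZl//; [rewrite /D mulrAC|exact: integrable_wgt].
  move=> H; rewrite -(real_normK (num_real _)) (le_trans (_ : _ <= (D * wgt s) ^+ 2))//.
    by apply: lerXn2r => //; rewrite nnegrE; apply: mulr_ge0 => //; exact: wgt_ge0.
  by rewrite exprMn ler_wpM2l ?sqr_ge0// expr2 ler_piMr ?wgt_ge0 ?wgt_le1.
apply: dom_integrable (integrable_wgtZ n (D ^+ 2 + D ^+ 2)) _.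
  exact: (measurableT_comp measurable_ftq_win (measurable_pair1 p)).
move=> s; rewrite ger0_norm ?ftq_ge0// mulrDl lerD//.
  apply: bnd; last by move=> x; exact: normr_cos_le1.
  by apply: measurable_cosT; apply: measurable_funM => //; exact: measurable_dotp.
apply: bnd; last by move=> x; exact: normr_sin_le1.
by apply: measurable_sinT; apply: measurable_funM => //; exact: measurable_dotp.
Qed.

Lemma win_sqr_int :
  mu.-integrable setT (EFin \o (fun s => \int[mu]_y (win s y ^+ 2))) /\
  \int[mu]_s \int[mu]_y (win s y ^+ 2) <= (2 * pi) ^+ n * \int[mu]_y (v y ^+ 2).
Proof.
have bv' x : `|v x| <= A * wgt x.
  apply: le_trans (bv x) _; rewrite ler_wpM2l// expr2 ler_piMr ?wgt_ge0 ?wgt_le1//.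
have iv := sqr_integrable mv bv'.
have mG : measurable_fun setT (fun z : V * V => win z.1 z.2 ^+ 2).
  apply: measurable_funX; apply: measurable_funM; first exact: measurableT_comp.
  exact: measurable_rk_sub.
have := @Rtonelli_le _ _ V V R mu mu (fun z => win z.1 z.2 ^+ 2)
  (fun y => (2 * pi) ^+ n * v y ^+ 2) mG (fun z => sqr_ge0 _).
case.
- exact: integrable_scale.
- move=> y /=.
  have [iw lew] := wgt_sub_int y.
  have ik : mu.-integrable setT (EFin \o (fun s => win s y ^+ 2)).
    apply: dom_integrable (integrable_scale (v y ^+ 2 * 2 ^+ n) iw) _.
      exact: (measurableT_comp mG (measurable_pair2 y)).
    move=> s; rewrite ger0_norm ?sqr_ge0// exprMn -mulrA ler_wpM2l ?sqr_ge0//.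
    by rewrite (le_trans _ (rk_le_wgt _))// expr2 ler_piMr ?rk_ge0 ?rk_le1.
  rewrite -EFin_Rint// lee_fin.
  apply: (@le_trans _ _ (\int[mu]_s (v y ^+ 2 * 2 ^+ n * wgt (y - s)))).
    apply: le_Rint => //; first exact: integrable_scale.
    move=> s; rewrite exprMn -mulrA ler_wpM2l ?sqr_ge0//.
    by rewrite (le_trans _ (rk_le_wgt _))// expr2 ler_piMr ?rk_ge0 ?rk_le1.
  rewrite RintegralZl// exprMn [leRHS]mulrC mulrA ler_wpM2l//.
  by rewrite mulr_ge0 ?sqr_ge0 ?exprn_ge0.
- by move=> i1 le1; split => //; move: le1; rewrite RintegralZl.
Qed.

End windows.

(** Bessel's inequality for each window, then integration over its position s:
    the window has a finite L^2 norm. *)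
Lemma bessel_win : exists2 K : R, 0 <= K & forall (v : V -> R) (A : R) (k : nat),
  measurable_fun setT v -> (forall x, `|v x| <= A * wgt x ^+ 2) ->
  mu.-integrable setT (EFin \o (fun p => kap k p * \int[mu]_s ftq c (win v s) p)) /\
  \int[mu]_p (kap k p * \int[mu]_s ftq c (win v s) p) <= K * \int[mu]_y (v y ^+ 2).
Proof.
have [K K0 HK] := bessel n c0.
exists (K * (2 * pi) ^+ n) => [|v A k mv bv].
  by rewrite mulr_ge0// exprn_ge0// mulr_ge0 ?pi_ge0.
have [iG leG] := win_sqr_int mv bv.
have mF : measurable_fun setT (fun z : V * V => kap k z.1 * ftq c (win v z.2) z.1).
  apply: measurable_funM; last exact: measurable_ftq_win.
  exact: (measurableT_comp (measurable_kap k)).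
have := @Rtonelli_le _ _ V V R mu mu (fun z => kap k z.1 * ftq c (win v z.2) z.1)
  (fun s => K * \int[mu]_y (win v s y ^+ 2)) mF _.
have E : (fun p => \int[mu]_s (kap k p * ftq c (win v s) p)) =
    (fun p => kap k p * \int[mu]_s ftq c (win v s) p).
  by apply/funext => p; rewrite RintegralZl//; exact: ftq_win_integrable.
case.
- by move=> z; rewrite mulr_ge0 ?kap_ge0 ?ftq_ge0.
- exact: integrable_scale.
- move=> s /=.
  have [i1 le1] := HK (win v s) (A * 4 ^+ n) k (measurable_win mv s) (win_le_wgt bv s).
  by rewrite -EFin_Rint// lee_fin.
- rewrite /= E => i1 le1; split => //; apply: le_trans le1 _.
  by rewrite RintegralZl// -mulrA ler_wpM2l.
Qed.

End fixed_momentum.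

(** * The trilinear estimate *)

Lemma fatou_le d (T : measurableType d) (R : realType)
    (mu : {measure set T -> \bar R}) (f_ : nat -> T -> R) (f : T -> R) (C : R) :
  (forall k, measurable_fun setT (f_ k)) -> (forall k x, 0 <= f_ k x) ->
  (forall x, f_ k x @[k --> \oo] --> f x) ->
  (forall k, \int[mu]_x (f_ k x)%:E <= C%:E)%E ->
  (\int[mu]_x (f x)%:E <= C%:E)%E.
Proof.
move=> mf f0 cf fC.
have cE x : ((f_ k x)%:E)%E @[k --> \oo] --> ((f x)%:E)%E.
  by apply: cvg_EFin; [exact: nearW|exact: cf].
rewrite (eq_integral (fun x => limn_einf (fun k => (f_ k x)%:E))); last first.
  by move=> x _; have [-> _] := cvg_limn_einf_sup (cE x).
apply: (@le_trans _ _ (limn_einf (fun k => \int[mu]_x (f_ k x)%:E)%E)).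
  apply: fatou => //.
  - by move=> k; exact/measurable_EFinP.
  - by move=> k x _; rewrite lee_fin.
apply: le_trans (limn_einf_sup _) _; rewrite limn_esup_lim.
apply: lime_le; first exact: is_cvg_esups.
by apply: nearW => k; apply: ge_ereal_sup => _ [m _ <-].
Qed.

Section trilinear.
Variables (R : realType) (n : nat) (c phi : R).
Hypothesis c0 : 0 < c.
Notation V := 'rV[R]_n.
Notation mu := (lebesgue_rV R n).
Notation nu := (@mu2 R n).
Variables (a : 'rV[R]_(n + n) -> R) (M : R).
Hypothesis sa : smooth_le (4 * n) (fun=> M) a.

Let M0 : 0 <= M. Proof. exact: (smooth_le_w0 sa 0). Qed.

(** The phase phi allows the same estimates to serve for the cosine (phi = 0)
    and for the sine (phi = - pi / 2). *)
Definition osc (p x y : V) : R := cos (c * dotp p (x - y) + phi).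

Lemma osc_le1 p x y : `|osc p x y| <= 1. Proof. exact: normr_cos_le1. Qed.

(** The symbol made integrable in momentum. *)
Definition acut (k : nat) (z : 'rV[R]_(n + n)) : R := a z * kap k (rsubmx z).
(** The result of the integrations by parts in momentum; the parameter c^-1
    compensates for the frequency c of the oscillating factor, so that the gain
    is wgt (x - y). *)
Definition alap (k : nat) : 'rV[R]_(n + n) -> R :=
  lap (c^-1 ^+ 2) (map (@rshift n n) (enum 'I_n)) (acut k).

Lemma smooth_le_acut : exists2 C : R, 0 <= C & forall k,
  smooth_le (4 * n) (fun z => C * kap k (rsubmx z)) (acut k).
Proof.
have [C C0 sW] := smooth_le_wgt R n (4 * n).
exists (2 ^+ (4 * n) * (M * C)) => [|k]; first by rewrite !mulr_ge0 ?exprn_ge0.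
apply: smooth_le_weight (smooth_leM sa (smooth_le_rsub (smooth_le_kap k sW))) => z.
by rewrite /kap !mulrA.
Qed.

Lemma smooth_le_alap : exists2 C : R, 0 <= C & forall k,
  smooth_le (2 * n) (fun z => C * kap k (rsubmx z)) (alap k).
Proof.
have [C C0 sb] := smooth_le_acut.
exists ((1 + `|c^-1 ^+ 2|) ^+ n * C) => [|k].
  by rewrite mulr_ge0 ?exprn_ge0// addr_ge0.
have := @smooth_le_lap _ _ (2 * n) (c^-1 ^+ 2) (map (@rshift n n) (enum 'I_n)) _ _ _.
rewrite size_map size_enum_ord => H.
apply: (@smooth_le_weight _ _ _ _ _ _ _ (H _ _ _)); last first.
  apply: smooth_le_anti (sb k).
  by rewrite -mulnDl.
by move=> z; rewrite mulrA.
Qed.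

Lemma measurable_mid tau d (T : measurableType d) (f g : T -> V) :
  measurable_fun setT f -> measurable_fun setT g ->
  measurable_fun setT (fun z => mid tau (f z) (g z)).
Proof. by move=> mf mg; apply: measurable_rV_add; apply: measurable_rV_scale. Qed.

Section fixed_tau.
Variable tau : R.
Hypothesis tau01 : 0 <= tau <= 1.

Lemma measurable_amid d (T : measurableType d) (h : 'rV[R]_(n + n) -> R)
    (f g p : T -> V) : measurable_fun setT h ->
  measurable_fun setT f -> measurable_fun setT g -> measurable_fun setT p ->
  measurable_fun setT (fun z => h (row_mx (mid tau (f z) (g z)) (p z))).
Proof.
move=> mh mf mg mp; apply: (measurableT_comp mh).
by apply: measurable_row_mx => //; exact: measurable_mid.
Qed.

(** For fixed p, the amplitude after the integrations by parts, as a function of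
    z = (x, y). *)
Definition gker (k : nat) (p : V) (z : 'rV[R]_(n + n)) : R :=
  wgt (lsubmx z - rsubmx z) * alap k (row_mx (mid tau (lsubmx z) (rsubmx z)) p).

Definition gx k p := der1 (map (@lshift n n) (enum 'I_n)) (gker k p).
(** The density of the superposition in gker_resolvent. *)
Definition gxy k p := der1 (map (@rshift n n) (enum 'I_n)) (gx k p).

End fixed_tau.

(** Of the 4 n derivatives of the symbol, 2 n are spent on the integrations by
    parts in p and 2 n are left for the resolvent formula in x and in y. The
    last bound keeps both weights: the one in x - y feeds Schur's test, the one
    in p Bessel's inequality. *)
Lemma smooth_le_gker : exists2 C : R, 0 <= C & forall tau k p, 0 <= tau <= 1 ->
  [/\ smooth_le (2 * n) (fun=> C) (gker tau k p),
      smooth_le n (fun=> C) (gx tau k p) &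
      smooth_le 0 (fun z => C * (wgt (lsubmx z - rsubmx z) * kap k p))
        (gxy tau k p)].
Proof.
have [C C0 sb] := smooth_le_alap.
have [D D0 sd] := smooth_le_sub R n (2 * n).
pose E := 2 ^+ (2 * n) * (D * C).
have E0 : 0 <= E by rewrite !mulr_ge0 ?exprn_ge0.
have F1 : 1 <= 2 ^+ n :> R by rewrite exprn_ege1// ler1n.
exists (2 ^+ n * (2 ^+ n * E)) => [|tau k p tau01].
  by rewrite !mulr_ge0 ?exprn_ge0.
have sg : smooth_le (2 * n) (fun z => E * (wgt (lsubmx z - rsubmx z) * kap k p))
    (gker tau k p).
  have s1 := smooth_le_mid tau01 p (sb k).
  apply: smooth_le_weight (smooth_leM sd s1) => z.
  by rewrite row_mxKr /E -!mulrA ler_wpM2l ?exprn_ge0// !mulrA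
    [D * _ * C]mulrAC.
have sx : smooth_le n (fun z => 2 ^+ n * (E * (wgt (lsubmx z - rsubmx z) * kap k p)))
    (gx tau k p).
  have := @smooth_le_der1 _ _ n (map (@lshift n n) (enum 'I_n)) _ _ _.
  rewrite size_map size_enum_ord; apply.
  by apply: smooth_le_anti sg; rewrite mul2n addnn.
have sxy : smooth_le 0 (fun z => 2 ^+ n * (2 ^+ n * (E * (wgt (lsubmx z - rsubmx z) * kap k p))))
    (gxy tau k p).
  have := @smooth_le_der1 _ _ 0 (map (@rshift n n) (enum 'I_n)) _ _ _.
  by rewrite size_map size_enum_ord; apply.
have w1 (z : 'rV[R]_(n + n)) : E * (wgt (lsubmx z - rsubmx z) * kap k p) <= E.
  rewrite ler_piMr// mulr_ile1 ?wgt_ge0 ?kap_ge0 ?wgt_le1 ?kap_le1//.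
split.
- apply: smooth_le_weight sg => z /=; apply: (le_trans (w1 z)).
  rewrite mulrA ler_peMl// -[leLHS]mulr1 ler_pM//.
- apply: smooth_le_weight sx => z /=; rewrite ler_wpM2l ?exprn_ge0//.
  by apply: (le_trans (w1 z)); rewrite ler_peMl.
- by apply: smooth_le_weight sxy => z; rewrite !mulrA.
Qed.

Lemma integrable_rk_sub (x : V) :
  mu.-integrable setT (EFin \o (fun s => rk (x - s))).
Proof.
have [iw _] := wgt_sub_int x.
apply: dom_integrable (integrable_scale (2 ^+ n) iw) _.
  exact: measurable_rk_sub.
by move=> s; rewrite ger0_norm ?rk_ge0// rk_le_wgt.
Qed.

(** The resolvent formula in both variables separates x from y. *)
Lemma gker_resolvent tau k p x y : 0 <= tau <= 1 ->
  gker tau k p (row_mx x y) =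
  \int[nu]_w (rk (x - w.1) * rk (y - w.2) * gxy tau k p (row_mx w.1 w.2)).
Proof.
move=> tau01; have [C C0 H] := smooth_le_gker; have [sg sx sxy] := H tau k p tau01.
have nn : (n <= 2 * n)%N by rewrite leq_pmull.
have r1 := resolvent x (smooth_le_row_l y (smooth_le_anti nn sg)).
rewrite -r1 (Rint_mu2 (A := fun s => C * rk (x - s)) (B := fun t => rk (y - t))).
- apply: eq_Rintegral => s _.
  transitivity (\int[mu]_t (rk (x - s) * (rk (y - t) * gxy tau k p (row_mx s t)))).
    rewrite RintegralZl//; last first.
      apply: dom_integrable (integrable_scale C (integrable_rk_sub y)) _.
        apply: measurable_funM; first exact: measurable_rk_sub.
        apply: (measurableT_comp (smooth_le_meas sxy)).
        exact: measurable_row_mx.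
      move=> t; rewrite normrM (ger0_norm (rk_ge0 _)) mulrC.
      apply: ler_wpM2r; first exact: rk_ge0.
      apply: le_trans (smooth_le_norm sxy _) _.
      by rewrite ler_piMr// mulr_ile1 ?wgt_ge0 ?kap_ge0 ?wgt_le1 ?kap_le1.
    congr (_ * _).
    have := resolvent y (smooth_le_row_r s sx).
    have -> : der1 (enum 'I_n) (fun q => gx tau k p (row_mx s q)) =
        (fun t => gxy tau k p (row_mx s t)).
      rewrite -[RHS]/(gxy tau k p \o (fun t => row_mx s t)).
      rewrite /gxy (@der1_along _ _ _ (fun t => row_mx s t) _ _ (enum 'I_n) (fun=> C))//.
        by move=> j x' t; exact: row_mx_dr.
      by rewrite size_enum_ord.
    move=> ->.
    have -> // : der1 (enum 'I_n) (fun q => gker tau k p (row_mx q y)) =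
        (fun s => gx tau k p (row_mx s y)).
    rewrite -[RHS]/(gx tau k p \o (fun s => row_mx s y)).
    rewrite /gx (@der1_along _ _ _ (fun s => row_mx s y) _ _ (enum 'I_n) (fun=> C))//.
      by move=> j x' t; exact: row_mx_dl.
    by rewrite size_enum_ord; exact: smooth_le_anti sg.
  by apply: eq_Rintegral => t _ /=; rewrite mulrA.
- apply: measurable_funM.
    by apply: measurable_funM; exact: measurable_rk_sub.
  apply: (measurableT_comp (smooth_le_meas sxy)).
  exact: measurable_row_mx.
- exact: integrable_scale (integrable_rk_sub x).
- exact: integrable_rk_sub.
- move=> s t /=; rewrite normrM ger0_norm ?mulr_ge0 ?rk_ge0//.
  rewrite mulrC mulrA; apply: ler_wpM2r; first exact: rk_ge0.
  apply: ler_wpM2r; first exact: rk_ge0.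
  apply: le_trans (smooth_le_norm sxy _) _.
  rewrite ler_piMr// mulr_ile1 ?wgt_ge0 ?kap_ge0 ?wgt_le1 ?kap_le1//.
Qed.

Definition tform tau k (v u : V -> R) (p : V) : R :=
  \int[nu]_z (osc p z.1 z.2 * (v z.1 * u z.2) * gker tau k p (row_mx z.1 z.2)).

(** Insert gker_resolvent and exchange the integrals. For fixed (s, t) the inner
    integral is controlled by osc_pair_le for the windowed functions, and the
    density gxy contributes kap p wgt (s - t), which Schur's test integrates. *)
Lemma tform_le : exists2 K : R, 0 <= K & forall tau k (v u : V -> R) (A B : R) p,
  0 <= tau <= 1 ->
  measurable_fun setT v -> (forall x, `|v x| <= A * wgt x ^+ 2) ->
  measurable_fun setT u -> (forall x, `|u x| <= B * wgt x ^+ 2) ->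
  `|tform tau k v u p| <= K * (kap k p * \int[mu]_s ftq c (win v s) p +
     kap k p * \int[mu]_s ftq c (win u s) p).
Proof.
have [C C0 H] := smooth_le_gker.
exists (C * pi ^+ n) => [|tau k v u A B p tau01 mv bv mu_ bu].
  by rewrite mulr_ge0 ?exprn_ge0 ?pi_ge0.
have [sg sx sxy] := H tau k p tau01.
have A0 : 0 <= A.
  by have := le_trans (normr_ge0 _) (bv 0); rewrite pmulr_lge0// exprn_gt0// wgt_gt0.
have B0 : 0 <= B.
  by have := le_trans (normr_ge0 _) (bu 0); rewrite pmulr_lge0// exprn_gt0// wgt_gt0.
have bgxy w : `|gxy tau k p w| <= C.
  apply: le_trans (smooth_le_norm sxy _) _.
  rewrite ler_piMr// mulr_ile1 ?wgt_ge0 ?kap_ge0 ?wgt_le1 ?kap_le1//.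
pose F (z : (V * V) * (V * V)) : R := osc p z.1.1 z.1.2 *
  (win v z.2.1 z.1.1 * win u z.2.2 z.1.2) * gxy tau k p (row_mx z.2.1 z.2.2).
have m11 : measurable_fun setT (fun z : (V * V) * (V * V) => z.1.1).
  by apply: measurableT_comp => //; exact: measurable_fst.
have m12 : measurable_fun setT (fun z : (V * V) * (V * V) => z.1.2).
  by apply: measurableT_comp => //; exact: measurable_fst.
have m21 : measurable_fun setT (fun z : (V * V) * (V * V) => z.2.1).
  by apply: measurableT_comp => //; exact: measurable_snd.
have m22 : measurable_fun setT (fun z : (V * V) * (V * V) => z.2.2).
  by apply: measurableT_comp => //; exact: measurable_snd.
have mF : measurable_fun setT F.
  apply: measurable_funM; first apply: measurable_funM.
  - exact: measurable_osc.
  - by apply: measurable_funM; apply: measurable_funM;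
      [exact: (measurableT_comp mv)|exact: measurable_rk_sub
      |exact: (measurableT_comp mu_)|exact: measurable_rk_sub].
  - apply: (measurableT_comp (smooth_le_meas sxy)).
    exact: measurable_row_mx.
pose D := A * 4 ^+ n * (B * 4 ^+ n) * C.
have D0 : 0 <= D by rewrite !mulr_ge0 ?exprn_ge0.
have iW := integrable_mu2 _ (integrable_wgt R n) (integrable_wgt R n).
have mW : measurable_fun setT (fun z : V * V => wgt z.1 * wgt z.2).
  by apply: measurable_funM; apply: measurableT_comp => //; exact: measurable_wgt.
have iW1 := iW _ mW (fun x y => ltac:(by rewrite ger0_norm// mulr_ge0 ?wgt_ge0)).
have bF z w : `|F (z, w)| <= D * (wgt z.1 * wgt z.2) * (wgt w.1 * wgt w.2).
  rewrite /F /= normrM (normrM (osc _ _ _)) (normrM (win v _ _)).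
  have -> : D * (wgt z.1 * wgt z.2) * (wgt w.1 * wgt w.2) =
    1 * ((A * 4 ^+ n * (wgt z.1 * wgt w.1)) * (B * 4 ^+ n * (wgt z.2 * wgt w.2))) * C.
    by rewrite /D; ring.
  apply: ler_pM => //; apply: ler_pM => //; first exact: osc_le1.
  by apply: ler_pM => //; [exact: (win_le bv)|exact: (win_le bu)].
have E : tform tau k v u p = \int[nu]_z \int[nu]_w F (z, w).
  apply: eq_Rintegral => z _; rewrite gker_resolvent// -RintegralZl//; last first.
    apply: (@integrable_mu2 _ _ _ (fun s => C * rk (z.1 - s)) (fun t => rk (z.2 - t))).
    - apply: measurable_funM.
        by apply: measurable_funM; exact: measurable_rk_sub.
      apply: (measurableT_comp (smooth_le_meas sxy)).
      exact: measurable_row_mx.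
    - exact: integrable_scale (integrable_rk_sub _).
    - exact: integrable_rk_sub.
    - move=> s t /=; rewrite normrM ger0_norm ?mulr_ge0 ?rk_ge0//.
      by rewrite mulrC mulrA !ler_wpM2r ?rk_ge0.
  by apply: eq_Rintegral => w _; rewrite /F /win /=; ring.
rewrite E (Rfubini mF (integrable_scale D iW1) iW1 bF).
pose Q w := ftq c (win v w.1) p + ftq c (win u w.2) p.
have [iS leS] := schur (l := 1) ltr01
  (measurableT_comp (measurable_ftq_win c mv) (measurable_pair1 p))
  (measurableT_comp (measurable_ftq_win c mu_) (measurable_pair1 p))
  (fun s => ftq_ge0 _ _ _) (fun s => ftq_ge0 _ _ _)
  (ftq_win_integrable c mv bv p) (ftq_win_integrable c mu_ bu p).
apply: (@le_trans _ _ (\int[nu]_w (C * kap k p *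
    (wgt (1 *: (w.1 - w.2)) * (ftq c (win v w.1) p + ftq c (win u w.2) p))))).
  apply: dom_Rintegral.
  - exact: measurable_Rint2 mF.
  - exact: (integrable_scale (C * kap k p) iS).
  - move=> w; rewrite /F /= scale1r.
    rewrite RintegralZr//; last first.
      apply: (@integrable_mu2 _ _ _ (fun x => A * 4 ^+ n * wgt x)
        (fun x => B * 4 ^+ n * wgt x)).
      - apply: measurable_funM; first exact: measurable_osc.
        by apply: measurable_funM; apply: measurableT_comp => //; exact: measurable_win.
      - exact: integrable_wgtZ.
      - exact: integrable_wgtZ.
      - move=> x y /=; rewrite normrM (le_trans _ (_ : `|win v w.1 x * win u w.2 y| <= _))//.
          by rewrite ler_piMl// osc_le1.
        by rewrite (normrM (win v _ _)); apply: ler_pM => //;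
          [exact: (win_le_wgt bv)|exact: (win_le_wgt bu)].
    rewrite normrM [leRHS]mulrA [leRHS]mulrC; apply: ler_pM => //.
      apply: (@osc_pair_le R n c phi _ _ (A * 4 ^+ n) (B * 4 ^+ n)).
      - exact: measurable_win.
      - exact: measurable_win.
      - exact: (win_le_wgt bv).
      - exact: (win_le_wgt bu).
    apply: le_trans (smooth_le_norm sxy _) _.
    by rewrite row_mxKl row_mxKr mulrA mulrAC.
rewrite RintegralZl//.
apply: le_trans (ler_wpM2l _ leS) _; first by rewrite mulr_ge0 ?kap_ge0.
rewrite divr1; move: (kap _ _) (Rintegral _ _ _) (Rintegral _ _ _) => x y z.
by rewrite le_eqVlt; apply/orP; left; apply/eqP; ring.
Qed.

(** The pairing of v with the operator applied to u, before the integration over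
    p. *)
Definition pform tau (v u : V -> R) (p : V) : R :=
  \int[nu]_z (osc p z.1 z.2 * (v z.1 * u z.2) * a (row_mx (mid tau z.1 z.2) p)).

(** The integration by parts is in p, and t will be x - y: the gain is the
    weight wgt (x - y). *)
Lemma acut_ibp k (q t : V) :
  \int[mu]_p (cos (c * dotp p t + phi) * acut k (row_mx q p)) =
  wgt t * \int[mu]_p (cos (c * dotp p t + phi) * alap k (row_mx q p)).
Proof.
have [C C0 sb] := smooth_le_acut.
have le24 : (2 * n <= 4 * n)%N by rewrite leq_mul.
have sb2 := smooth_le_anti le24 (sb k).
have sq : smooth_le (2 * n) (fun p => C * (k.+1%:R ^+ 2) ^+ n * wgt p)
    (fun p => acut k (row_mx q p)).
  apply: smooth_le_weight (smooth_le_row_r q sb2) => p.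
  by rewrite row_mxKr -mulrA ler_wpM2l// kap_le_wgt.
rewrite (@osc_ibp _ _ c c^-1 phi _ _ t sq) mulVf ?gt_eqF// scale1r; congr (_ * _).
apply: eq_Rintegral => p _; congr (_ * _).
rewrite -[RHS]/((alap k \o (fun p => row_mx q p)) p) /alap.
rewrite (@lap_along _ _ _ (fun p => row_mx q p) _ _ _ (enum 'I_n)
  (fun z => C * kap k (rsubmx z)))//.
  by move=> j x' s; exact: row_mx_dr.
by rewrite size_enum_ord.
Qed.

Lemma measurable_a : measurable_fun setT a.
Proof. exact: smooth_le_meas sa. Qed.

(** Fubini brings the integral over p inside, where the integrations by parts
    apply; the cut-off is what makes this exchange legitimate. *)
Lemma pform_tform tau k (v u : V -> R) (A B : R) : 0 <= tau <= 1 ->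
  measurable_fun setT v -> (forall x, `|v x| <= A * wgt x) ->
  measurable_fun setT u -> (forall x, `|u x| <= B * wgt x) ->
  \int[mu]_p (kap k p * pform tau v u p) = \int[mu]_p tform tau k v u p.
Proof.
move=> tau01 mv bv mu_ bu.
have [C C0 sl] := smooth_le_alap; have sl_ := sl k.
have A0 : 0 <= A.
  by have := le_trans (normr_ge0 _) (bv 0); rewrite pmulr_lge0// wgt_gt0.
have B0 : 0 <= B.
  by have := le_trans (normr_ge0 _) (bu 0); rewrite pmulr_lge0// wgt_gt0.
have [ik _] := kap_int R n k.
have m1 : measurable_fun setT (fun z : V * (V * V) => z.2.1).
  by apply: measurableT_comp => //; exact: measurable_snd.
have m2 : measurable_fun setT (fun z : V * (V * V) => z.2.2).
  by apply: measurableT_comp => //; exact: measurable_snd.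
have mo : measurable_fun setT (fun z : V * (V * V) =>
    osc z.1 z.2.1 z.2.2 * (v z.2.1 * u z.2.2)).
  apply: measurable_funM; first exact: measurable_osc.
  by apply: measurable_funM; [exact: (measurableT_comp mv)|exact: (measurableT_comp mu_)].
have bo (p : V) (z : V * V) :
    `|osc p z.1 z.2 * (v z.1 * u z.2)| <= A * B * (wgt z.1 * wgt z.2).
  rewrite normrM (le_trans (_ : _ <= `|v z.1 * u z.2|))//.
    by rewrite ler_piMl// osc_le1.
  by rewrite normrM mulrACA; apply: ler_pM.
have mid_meas (h : 'rV[R]_(n + n) -> R) : measurable_fun setT h ->
    measurable_fun setT (fun z : V * (V * V) => h (row_mx (mid tau z.2.1 z.2.2) z.1)).
  by move=> mh; exact: measurable_amid.
pose F1 (z : V * (V * V)) : R := osc z.1 z.2.1 z.2.2 * (v z.2.1 * u z.2.2) *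
  acut k (row_mx (mid tau z.2.1 z.2.2) z.1).
pose F2 (z : V * (V * V)) : R := osc z.1 z.2.1 z.2.2 * (v z.2.1 * u z.2.2) *
  gker tau k z.1 (row_mx z.2.1 z.2.2).
have [D D0 sb] := smooth_le_acut; have sb_ := sb k.
have mF1 : measurable_fun setT F1.
  by apply: measurable_funM => //; apply: mid_meas; exact: smooth_le_meas sb_.
have gE p x y : gker tau k p (row_mx x y) =
    wgt (x - y) * alap k (row_mx (mid tau x y) p).
  by rewrite /gker row_mxKl row_mxKr.
have mF2 : measurable_fun setT F2.
  rewrite /F2; under eq_fun do rewrite gE.
  apply: measurable_funM => //; apply: measurable_funM.
    exact: measurable_wgt_sub.
  by apply: mid_meas; exact: smooth_le_meas sl_.
have mW : measurable_fun setT (fun z : V * V => wgt z.1 * wgt z.2).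
  by apply: measurable_funM; apply: measurableT_comp => //; exact: measurable_wgt.
have iW1 := integrable_mu2 mW (integrable_wgt R n) (integrable_wgt R n)
  (fun x y => ltac:(by rewrite ger0_norm// mulr_ge0 ?wgt_ge0)).
have iW2 := integrable_scale (A * B) iW1.
have bF1 p z : `|F1 (p, z)| <= D * kap k p * (A * B * (wgt z.1 * wgt z.2)).
  rewrite /F1 normrM [leRHS]mulrC; apply: ler_pM => //.
  by apply: le_trans (smooth_le_norm sb_ _) _; rewrite row_mxKr.
have bF2 p z : `|F2 (p, z)| <= C * kap k p * (A * B * (wgt z.1 * wgt z.2)).
  rewrite /F2 normrM [leRHS]mulrC; apply: ler_pM => //=.
  rewrite gE normrM ger0_norm ?wgt_ge0// -[leRHS]mul1r.
  apply: ler_pM => //; rewrite ?wgt_ge0 ?wgt_le1//.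
  by apply: le_trans (smooth_le_norm sl_ _) _; rewrite row_mxKr.
transitivity (\int[mu]_p \int[nu]_z F1 (p, z)).
  apply: eq_Rintegral => p _; rewrite -RintegralZl//.
    by apply: eq_Rintegral => z _; rewrite /F1 /acut /= row_mxKr; ring.
  apply: dom_integrable (integrable_scale M iW2) _.
    apply: measurable_funM; first exact: (measurableT_comp mo (measurable_pair1 p)).
    exact: (measurableT_comp (mid_meas _ measurable_a) (measurable_pair1 p)).
  move=> z; rewrite normrM mulrC; apply: ler_pM => //.
  exact: (smooth_le_norm sa).
rewrite (Rfubini mF1 (integrable_scale D ik) iW2 bF1).
rewrite -[RHS]/(\int[mu]_p \int[nu]_z F2 (p, z)).
rewrite (Rfubini mF2 (integrable_scale C ik) iW2 bF2).
apply: eq_Rintegral => z _.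
transitivity (\int[mu]_p (v z.1 * u z.2 * (cos (c * dotp p (z.1 - z.2) + phi) *
    acut k (row_mx (mid tau z.1 z.2) p)))).
  by apply: eq_Rintegral => p _; rewrite /F1 /osc /=; ring.
have iosc (h : 'rV[R]_(n + n) -> R) (K : R) : measurable_fun setT h ->
    (forall z, `|h z| <= K * kap k (rsubmx z)) ->
    mu.-integrable setT (EFin \o (fun p => cos (c * dotp p (z.1 - z.2) + phi) *
      h (row_mx (mid tau z.1 z.2) p))).
  move=> mh bh; apply: dom_integrable (integrable_scale K ik) _.
    apply: measurable_funM; first exact: measurable_cos_dotp.
    by apply: (measurableT_comp mh); exact: measurable_row_mx.
  move=> p; rewrite normrM (le_trans _ (_ : `|h (row_mx (mid tau z.1 z.2) p)| <= _))//.
    by rewrite ler_piMl// normr_cos_le1.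
  by apply: le_trans (bh _) _; rewrite row_mxKr.
rewrite RintegralZl//; last first.
  by apply: (iosc _ D); [exact: smooth_le_meas sb_|exact: smooth_le_norm sb_].
rewrite acut_ibp mulrA.
rewrite -(RintegralZl _ measurableT (iosc _ C (smooth_le_meas sl_) (smooth_le_norm sl_))).
by apply: eq_Rintegral => p _; rewrite /F2 /= gE /osc; ring.
Qed.

(** The integral over y in the definition of the operator. *)
Definition jform tau (u : V -> R) (x p : V) : R :=
  \int[mu]_y (osc p x y * a (row_mx (mid tau x y) p) * u y).

Definition opr tau (u : V -> R) (x : V) : R := \int[mu]_p jform tau u x p.

(** Integrations by parts in y: the decay in p comes from the smoothness of u.
    It gives a meaning to the integral over p, but with a constant that the L^2
    norm of u does not control. *)
Lemma jform_le (u : V -> R) (B : R) : smooth_le (2 * n) (fun y => B * wgt y) u ->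
  exists2 K : R, 0 <= K & forall tau x p, 0 <= tau <= 1 ->
    `|jform tau u x p| <= K * wgt p.
Proof.
move=> su.
have B0 : 0 <= B by have := smooth_le_w0 su 0; rewrite pmulr_lge0// wgt_gt0.
pose E := 2 ^+ (2 * n) * (M * B); pose L := (1 + `|c^-1 ^+ 2|) ^+ n.
have E0 : 0 <= E by rewrite !mulr_ge0 ?exprn_ge0.
have L0 : 0 <= L by rewrite exprn_ge0// addr_ge0.
have W0 : 0 <= \int[mu]_y wgt y by apply: Rintegral_ge0 => y _; exact: wgt_ge0.
exists (L * E * \int[mu]_y wgt y) => [|tau x p tau01]; first by rewrite !mulr_ge0.
pose f y := a (row_mx (mid tau x y) p) * u y.
have le24 : (2 * n <= 4 * n)%N by rewrite leq_mul.
have sf : smooth_le (2 * n) (fun y => E * wgt y) f.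
  apply: smooth_le_weight (smooth_leM (smooth_le_mid_y tau01 x p (smooth_le_anti le24 sa)) su) => y.
  by rewrite /E -!mulrA.
have dotpC (y z : V) : dotp y z = dotp z y by apply: eq_bigr => i _; rewrite mulrC.
have -> : jform tau u x p =
    \int[mu]_y (cos (c * dotp y p + (- phi - c * dotp p x)) * f y).
  apply: eq_Rintegral => y _; rewrite /f mulrA; congr (_ * _ * _).
  by rewrite /osc -cosN dotpB (dotpC y); congr cos; ring.
rewrite (@osc_ibp _ _ c c^-1 _ _ _ p sf) mulVf ?gt_eqF// scale1r.
rewrite normrM ger0_norm ?wgt_ge0// mulrC; apply: ler_wpM2r; first exact: wgt_ge0.
have sl : smooth_le 0 (fun y => L * E * wgt y) (lap (c^-1 ^+ 2) (enum 'I_n) f).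
  have := @smooth_le_lap _ n 0 (c^-1 ^+ 2) (enum 'I_n) _ f.
  rewrite size_enum_ord => /(_ _ sf); apply: smooth_le_weight => y.
  by rewrite /L mulrA.
rewrite -RintegralZl//; last exact: integrable_wgt.
apply: dom_Rintegral.
- by apply: measurable_funM; [exact: measurable_cos_dotp|exact: smooth_le_meas sl].
- exact: integrable_wgtZ.
- move=> y; rewrite normrM (le_trans _ (smooth_le_norm sl y))//.
  by rewrite ler_piMl// normr_cos_le1.
Qed.

Lemma measurable_jform d (T : measurableType d) (u : V -> R) (t : T -> R)
    (x p : T -> V) : measurable_fun setT u -> measurable_fun setT t ->
  measurable_fun setT x -> measurable_fun setT p ->
  measurable_fun setT (fun z => jform (t z) u (x z) (p z)).
Proof.
move=> mu_ mt mx mp.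
have m1 d' (U : measurableType d') (f : T -> U) : measurable_fun setT f ->
    measurable_fun setT (fun w : T * V => f w.1).
  by move=> mf; exact: (measurableT_comp mf).
apply: (@measurable_Rint _ _ T V R mu (fun w =>
  osc (p w.1) (x w.1) w.2 * a (row_mx (mid (t w.1) (x w.1) w.2) (p w.1)) * u w.2)).
apply: measurable_funM; last exact: (measurableT_comp mu_).
apply: measurable_funM; first by apply: measurable_osc => //; exact: m1.
apply: (measurableT_comp measurable_a); apply: measurable_row_mx; last exact: m1.
apply: measurable_rV_add; apply: measurable_rV_scale => //.
- by apply: measurable_funB => //; exact: m1.
- exact: m1.
- exact: m1.
Qed.

Lemma measurable_opr d (T : measurableType d) (u : V -> R) (t : T -> R)
    (x : T -> V) : measurable_fun setT u -> measurable_fun setT t ->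
  measurable_fun setT x ->
  measurable_fun setT (fun z => opr (t z) u (x z)).
Proof.
move=> mu_ mt mx.
apply: (@measurable_Rint _ _ T V R mu (fun w => jform (t w.1) u (x w.1) w.2)).
apply: measurable_jform => //; first exact: (measurableT_comp mt).
exact: (measurableT_comp mx).
Qed.

Lemma opr_le (u : V -> R) (B : R) : smooth_le (2 * n) (fun y => B * wgt y) u ->
  exists2 K : R, 0 <= K & forall tau x, 0 <= tau <= 1 -> `|opr tau u x| <= K.
Proof.
move=> su; have [K K0 HK] := jform_le su.
exists (K * \int[mu]_y wgt y) => [|tau x tau01].
  by rewrite mulr_ge0// Rintegral_ge0// => y _; exact: wgt_ge0.
rewrite -RintegralZl//; last exact: integrable_wgt.
apply: dom_Rintegral.
- apply: measurable_jform => //; exact: smooth_le_meas su.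
- exact: integrable_wgtZ.
- by move=> p; exact: HK.
Qed.

(** By jform_le the integrals over x and p converge absolutely. *)
Lemma opr_pairing tau (v u : V -> R) (A B : R) : 0 <= tau <= 1 ->
  measurable_fun setT v -> (forall x, `|v x| <= A * wgt x) ->
  smooth_le (2 * n) (fun y => B * wgt y) u ->
  \int[mu]_x (v x * opr tau u x) = \int[mu]_p pform tau v u p /\
  exists2 K : R, 0 <= K & forall p, `|pform tau v u p| <= K * wgt p.
Proof.
move=> tau01 mv bv su; have [K K0 HK] := jform_le su.
have A0 : 0 <= A.
  by have := le_trans (normr_ge0 _) (bv 0); rewrite pmulr_lge0// wgt_gt0.
have B0 : 0 <= B by have := smooth_le_w0 su 0; rewrite pmulr_lge0// wgt_gt0.
have bu := smooth_le_norm su; have mu_ := smooth_le_meas su.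
have pE p : pform tau v u p = \int[mu]_x (v x * jform tau u x p).
  rewrite /pform (Rint_mu2 (A := fun x => M * (A * wgt x)) (B := fun x => B * wgt x)).
  - apply: eq_Rintegral => x _; rewrite -RintegralZl//.
      by apply: eq_Rintegral => y _ /=; ring.
    apply: dom_integrable (integrable_wgtZ n (M * B)) _.
      apply: measurable_funM => //; apply: measurable_funM; first exact: measurable_osc.
      by apply: measurable_amid => //; exact: measurable_a.
    move=> y; rewrite normrM -mulrA; apply: ler_pM => //.
    rewrite normrM -[leRHS]mul1r; apply: ler_pM => //; first exact: osc_le1.
    exact: (smooth_le_norm sa).
  - apply: measurable_funM; first apply: measurable_funM.
    + exact: measurable_osc.
    + by apply: measurable_funM; [exact: (measurableT_comp mv)|exact: (measurableT_comp mu_)].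
    + by apply: measurable_amid => //; exact: measurable_a.
  - by apply: integrable_scale; exact: integrable_wgtZ.
  - exact: integrable_wgtZ.
  - move=> x y /=; rewrite !normrM.
    have -> : M * (A * wgt x) * (B * wgt y) = 1 * (A * wgt x * (B * wgt y)) * M by ring.
    apply: ler_pM => //; last exact: (smooth_le_norm sa).
    by apply: ler_pM => //; [exact: osc_le1|exact: ler_pM].
have mF : measurable_fun setT (fun z : V * V => v z.1 * jform tau u z.1 z.2).
  apply: measurable_funM; first exact: (measurableT_comp mv).
  exact: measurable_jform.
have bF x p : `|v x * jform tau u x p| <= A * wgt x * (K * wgt p).
  by rewrite normrM; apply: ler_pM => //; exact: HK.
split.
  under [RHS]eq_Rintegral do rewrite pE.
  rewrite -(Rfubini mF (integrable_wgtZ n A) (integrable_wgtZ n K) bF).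
  apply: eq_Rintegral => x _; rewrite -RintegralZl//.
  apply: dom_integrable (integrable_wgtZ n K) _; first exact: measurable_jform.
  by move=> p; exact: HK.
exists (A * K * \int[mu]_x wgt x) => [|p].
  by rewrite !mulr_ge0// Rintegral_ge0// => x _; exact: wgt_ge0.
rewrite pE mulrAC -RintegralZl//; last exact: integrable_wgt.
apply: dom_Rintegral.
- exact: (measurableT_comp mF (measurable_pair2 p)).
- exact: integrable_wgtZ.
- move=> x; rewrite (_ : A * K * wgt p * wgt x = A * wgt x * (K * wgt p)); last by ring.
  exact: bF.
Qed.

Lemma cvg_kap (p : V) : kap k p @[k --> \oo] --> (1 : R).
Proof.
have cinv : (k.+1%:R^-1 : R) @[k --> \oo] --> (0 : R) by exact: cvg_harmonic.
have [C _ sW] := smooth_le_wgt R n 0.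
have cp : continuous (fun s : R => s *: p).
  apply: continuous_rVP => i; under eq_fun do rewrite mxE.
  by apply: contM; [move=> x; exact: cvg_id|exact: cst_continuous].
have cw_ := cont_comp cp (smooth_le_cont sW).
have -> : (1 : R) = wgt (0 *: p).
  rewrite scale0r /wgt /prodf big1// => i _.
  by rewrite mxE /cw expr0n addr0 invr1.
exact: (cvg_comp _ _ cinv (cw_ 0)).
Qed.

Lemma measurable_tform tau k (v u : V -> R) : measurable_fun setT v ->
  measurable_fun setT u -> measurable_fun setT (tform tau k v u).
Proof.
move=> mv mu_; have [C C0 sl] := smooth_le_alap.
have m1 : measurable_fun setT (fun z : V * (V * V) => z.2.1).
  by apply: measurableT_comp => //; exact: measurable_snd.
have m2 : measurable_fun setT (fun z : V * (V * V) => z.2.2).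
  by apply: measurableT_comp => //; exact: measurable_snd.
apply: (@measurable_Rint _ _ V (V * V)%type R nu (fun z =>
  osc z.1 z.2.1 z.2.2 * (v z.2.1 * u z.2.2) * gker tau k z.1 (row_mx z.2.1 z.2.2))).
apply: measurable_funM; first apply: measurable_funM.
- exact: measurable_osc.
- by apply: measurable_funM; [exact: (measurableT_comp mv)|exact: (measurableT_comp mu_)].
- rewrite /gker; under eq_fun do rewrite row_mxKl row_mxKr.
  apply: measurable_funM; first exact: measurable_wgt_sub.
  by apply: measurable_amid => //; exact: smooth_le_meas (sl k).
Qed.

Lemma measurable_pform tau (v u : V -> R) : measurable_fun setT v ->
  measurable_fun setT u -> measurable_fun setT (pform tau v u).
Proof.
move=> mv mu_.
have m1 : measurable_fun setT (fun z : V * (V * V) => z.2.1).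
  by apply: measurableT_comp => //; exact: measurable_snd.
have m2 : measurable_fun setT (fun z : V * (V * V) => z.2.2).
  by apply: measurableT_comp => //; exact: measurable_snd.
apply: (@measurable_Rint _ _ V (V * V)%type R nu (fun z =>
  osc z.1 z.2.1 z.2.2 * (v z.2.1 * u z.2.2) * a (row_mx (mid tau z.2.1 z.2.2) z.1))).
apply: measurable_funM; first apply: measurable_funM.
- exact: measurable_osc.
- by apply: measurable_funM; [exact: (measurableT_comp mv)|exact: (measurableT_comp mu_)].
- by apply: measurable_amid => //; exact: measurable_a.
Qed.

Lemma wgt2_le (B : R) (u : V -> R) : (forall x, `|u x| <= B * wgt x ^+ 2) ->
  forall x, `|u x| <= B * wgt x.
Proof.
move=> bu x; have B0 : 0 <= B.
  by have := le_trans (normr_ge0 _) (bu 0); rewrite pmulr_lge0// exprn_gt0// wgt_gt0.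
by apply: le_trans (bu x) _; rewrite ler_wpM2l// expr2 ler_piMr ?wgt_ge0 ?wgt_le1.
Qed.

(** The bound is uniform in the cut-off, whose removal is a matter of dominated
    convergence. *)
Theorem opr_trilinear : exists2 K : R, 0 <= K & forall tau (v u : V -> R) (A B : R),
  0 <= tau <= 1 ->
  measurable_fun setT v -> (forall x, `|v x| <= A * wgt x ^+ 2) ->
  smooth_le (2 * n) (fun y => B * wgt y) u -> (forall x, `|u x| <= B * wgt x ^+ 2) ->
  `|\int[mu]_x (v x * opr tau u x)| <=
    K * (\int[mu]_x (v x ^+ 2) + \int[mu]_x (u x ^+ 2)).
Proof.
have [K1 K10 H1] := tform_le; have [K2 K20 H2] := bessel_win n c0.
exists (K1 * K2) => [|tau v u A B tau01 mv bv su bu]; first exact: mulr_ge0.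
have mu_ := smooth_le_meas su.
have bv' := wgt2_le bv; have bu' := wgt2_le bu.
have [-> [K K0 HK]] := opr_pairing tau01 mv bv' su.
have mp := measurable_pform tau mv mu_.
(* the cut-off is inserted only after the integral over p is known to converge *)
have cv : \int[mu]_p (kap k p * pform tau v u p) @[k --> \oo] -->
    \int[mu]_p pform tau v u p.
  apply: (Rint_cvg _ mp (integrable_wgtZ n K)).
  - by move=> k; apply: measurable_funM => //; exact: measurable_kap.
  - move=> k p; rewrite normrM (ger0_norm (kap_ge0 _ _)) (le_trans _ (HK p))//.
    by rewrite ler_piMl// kap_le1.
  - move=> p; rewrite -[X in _ --> X](mul1r (pform tau v u p)).
    by apply: cvgM; [exact: cvg_kap|exact: cvg_cst].
have /cvg_norm cn := cv.
apply: (closed_cvg (fun y => y <= _) _ _ _ cn); first exact: closed_le.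
apply: nearW => k /=.
rewrite (pform_tform k tau01 mv bv' mu_ bu').
have [iv lev] := H2 v A k mv bv; have [iu leu] := H2 u B k mu_ bu.
have iS := integrable_scale K1 (integrable_add iv iu).
apply: le_trans (dom_Rintegral (measurable_tform tau k mv mu_) iS
  (fun p => H1 tau k v u A B p tau01 mv bv mu_ bu)) _.
rewrite (RintegralZl _ measurableT (integrable_add iv iu)).
rewrite (RintegralD measurableT iv iu) -mulrA; apply: ler_wpM2l => //.
by rewrite mulrDr; exact: lerD.
Qed.

Notation leb := (@lebesgue_measure R).
Definition oprBJ (u : V -> R) (x : V) : R := \int[leb]_(tau in `[0, 1]) opr tau u x.

Lemma oprBJE (u : V -> R) x :
  oprBJ u x = \int[leb]_tau (\1_(`[0, 1] : set R) tau * opr tau u x).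
Proof.
rewrite /oprBJ Rintegral_mkcond; apply: eq_Rintegral => t _.
by rewrite patchE indicE; case: ifP => _; rewrite ?mul1r ?mul0r.
Qed.

Lemma integrable_indic01 (K : R) :
  leb.-integrable setT (EFin \o (fun t => K * \1_(`[0, 1] : set R) t)).
Proof.
apply: leb_integrable_scale; exact: integrable_indic_itv.
Qed.

Lemma Rint_indic01 (K : R) :
  \int[leb]_t (K * \1_(`[0, 1] : set R) t) = K.
Proof.
rewrite RintegralZl//; last exact: integrable_indic_itv.
rewrite /Rintegral integral_indic//.
rewrite -[RHS]mulr1; congr (K * _); rewrite setIT -[RHS]/(fine 1%E); congr fine.
apply: etrans (lebesgue_measure_itv `[0, 1]) _ => /=.
by rewrite lte_fin ltr01 oppr0 adde0.
Qed.

Lemma opr_ind_le (u : V -> R) (K : R) :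
  (forall tau x, 0 <= tau <= 1 -> `|opr tau u x| <= K) ->
  forall t x, `|\1_(`[0, 1] : set R) t * opr t u x| <= K * \1_(`[0, 1] : set R) t.
Proof.
move=> HK t x; rewrite indicE; case: (boolP (t \in _)) => t01; last first.
  by rewrite mul0r mulr0 normr0.
rewrite mul1r mulr1; apply: HK.
by move: t01; rewrite inE/= in_itv.
Qed.

Lemma measurable_opr_ind (u : V -> R) : measurable_fun setT u ->
  measurable_fun setT (fun z : V * R => \1_(`[0, 1] : set R) z.2 * opr z.2 u z.1).
Proof.
move=> mu_; apply: measurable_funM; last exact: measurable_opr.
by apply: (measurableT_comp (measurable_indic _)).
Qed.

Lemma measurable_oprBJ (u : V -> R) : measurable_fun setT u ->
  measurable_fun setT (oprBJ u).
Proof.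
move=> mu_; rewrite (_ : oprBJ u =
    fun x => \int[leb]_tau (\1_(`[0, 1] : set R) tau * opr tau u x)); last first.
  by apply/funext => x; exact: oprBJE.
exact: (@measurable_Rint _ _ V _ R leb _ (measurable_opr_ind mu_)).
Qed.

(** Duality. The trilinear estimate is tested on v = e chi_k w, where w is the
    image of u and chi_k a truncation that gives v the decay required. With I
    the integral of chi_k w^2 it reads e I <= K (e^2 I + |u|^2); for small e the
    term in I on the right is absorbed on the left. Fatou's lemma then removes
    the truncation. *)
Theorem oprBJ_L2 : exists2 K : R, 0 <= K & forall (u : V -> R) (B : R),
  smooth_le (2 * n) (fun y => B * wgt y) u -> (forall x, `|u x| <= B * wgt x ^+ 2) ->
  (\int[mu]_x (oprBJ u x ^+ 2)%:E <= (K * \int[mu]_x (u x ^+ 2))%:E)%E.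
Proof.
have [K K0 HK] := opr_trilinear.
(* K + 1 rather than K, in order to divide by it *)
pose L := K + 1.
have L0 : 0 < L by rewrite ltr_wpDl.
exists (4 * L ^+ 2) => [|u B su bu]; first by rewrite mulr_ge0 ?sqr_ge0.
have mu_ := smooth_le_meas su.
have mw := measurable_oprBJ mu_.
have [D D0 HD] := opr_le su.
set w := oprBJ u in mw *; set U := \int[mu]_x (u x ^+ 2).
have U0 : 0 <= U by apply: Rintegral_ge0 => x _; exact: sqr_ge0.
have bw x : `|w x| <= D.
  rewrite /w oprBJE.
  apply: le_trans (_ : \int[leb]_t (D * \1_(`[0, 1] : set R) t) <= _).
    apply: (@dom_Rintegral _ (measurableTypeR R) R leb).
    - exact: (measurableT_comp (measurable_opr_ind mu_) (measurable_pair1 x)).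
    - exact: integrable_indic01.
    - by move=> t; exact: opr_ind_le.
  by rewrite Rint_indic01.
pose chi k (x : V) : R := kap k x ^+ 2.
have chi0 k x : 0 <= chi k x by exact: sqr_ge0.
have chi1 k x : chi k x <= 1 by rewrite exprn_ile1// ?kap_ge0 ?kap_le1.
have mchi k : measurable_fun setT (chi k).
  by apply: measurable_funX; exact: measurable_kap.
have bchi k x : chi k x <= ((k.+1%:R ^+ 2) ^+ n) ^+ 2 * wgt x ^+ 2.
  by rewrite -exprMn lerXn2r ?nnegrE ?mulr_ge0 ?exprn_ge0 ?wgt_ge0 ?kap_ge0// kap_le_wgt.
have key k : mu.-integrable setT (EFin \o (fun x => chi k x * w x ^+ 2)) /\
    \int[mu]_x (chi k x * w x ^+ 2) <= 4 * L ^+ 2 * U.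
  pose E := ((k.+1%:R ^+ 2) ^+ n) ^+ 2 : R.
  have E0 : 0 <= E by exact: sqr_ge0.
  have iI : mu.-integrable setT (EFin \o (fun x => chi k x * w x ^+ 2)).
    apply: dom_integrable (integrable_wgtZ n (E * D ^+ 2)) _.
      by apply: measurable_funM => //; exact: measurable_funX.
    move=> x; rewrite normrM ger0_norm//.
    rewrite [leRHS]mulrAC; apply: ler_pM => //.
      apply: le_trans (bchi k x) _; rewrite ler_wpM2l//.
      by rewrite expr2 ler_piMr ?wgt_ge0 ?wgt_le1.
    by rewrite normrX lerXn2r ?nnegrE.
  split => //; set I := \int[mu]_x _.
  (* the value for which e I <= L (e^2 I + U) leaves half of I on the left *)
  pose e := (2 * L)^-1; have e0 : 0 < e by rewrite invr_gt0 mulr_gt0.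
  pose v x := e * (chi k x * w x).
  have mv : measurable_fun setT v.
    by apply: measurable_funM => //; exact: measurable_funM.
  have bv x : `|v x| <= e * E * D * wgt x ^+ 2.
    rewrite /v normrM (gtr0_norm e0) normrM (ger0_norm (chi0 k x)).
    have -> : e * E * D * wgt x ^+ 2 = e * (E * wgt x ^+ 2 * D) by ring.
    by rewrite ler_pM2l//; apply: ler_pM.
  have H tau : 0 <= tau <= 1 -> `|\int[mu]_x (v x * opr tau u x)| <=
      K * (\int[mu]_x (v x ^+ 2) + U).
    by move=> tau01; exact: (HK tau v u _ B tau01 mv bv su bu).
  have bv' := wgt2_le bv.
  have mF : measurable_fun setT (fun z : V * R =>
      v z.1 * (\1_(`[0, 1] : set R) z.2 * opr z.2 u z.1)).
    by apply: measurable_funM; [exact: (measurableT_comp mv)|exact: measurable_opr_ind].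
  have bF x t : `|v x * (\1_(`[0, 1] : set R) t * opr t u x)| <=
      e * E * D * wgt x * (D * \1_(`[0, 1] : set R) t).
    by rewrite normrM; apply: ler_pM => //; exact: opr_ind_le.
  have vw : \int[mu]_x (v x * w x) =
      \int[leb]_t (\1_(`[0, 1] : set R) t * \int[mu]_x (v x * opr t u x)).
    transitivity (\int[mu]_x \int[leb]_t (v x * (\1_(`[0, 1] : set R) t * opr t u x))).
      apply: eq_Rintegral => x _; rewrite /w oprBJE -RintegralZl//.
      apply: (@dom_integrable _ (measurableTypeR R) R leb _ _ _ (integrable_indic01 D)).
        exact: (measurableT_comp (measurable_opr_ind mu_) (measurable_pair1 x)).
      by move=> t; exact: opr_ind_le.
    rewrite (@Rfubini _ _ V (measurableTypeR R) R mu leb _ _ _ mF (integrable_wgtZ n _) (integrable_indic01 D) bF).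
    apply: eq_Rintegral => t _.
    rewrite indicE; case: (boolP (t \in _)) => t01.
      by rewrite mul1r; apply: eq_Rintegral => x _; rewrite mul1r.
    rewrite mul0r; under eq_Rintegral do rewrite mul0r mulr0.
    by rewrite Rintegral_cst// mul0r.
  set N2 := \int[mu]_x (v x ^+ 2) in H.
  have N20 : 0 <= N2 by apply: Rintegral_ge0 => x _; exact: sqr_ge0.
  have le1 : `|\int[mu]_x (v x * w x)| <= K * (N2 + U).
    rewrite vw.
    apply: le_trans (_ : \int[leb]_t (K * (N2 + U) * \1_(`[0, 1] : set R) t) <= _).
      apply: (@dom_Rintegral _ (measurableTypeR R) R leb).
      - have := @measurable_Rint2 _ _ V (measurableTypeR R) R mu _ mF.
        congr measurable_fun; apply/funext => t.
        rewrite indicE; case: (boolP (t \in _)) => t01.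
          by rewrite mul1r; apply: eq_Rintegral => x _; rewrite mul1r.
        rewrite mul0r; under eq_Rintegral do rewrite mul0r mulr0.
        by rewrite Rintegral_cst// mul0r.
      - exact: integrable_indic01.
      - move=> t; rewrite indicE; case: (boolP (t \in _)) => t01; last first.
          by rewrite mul0r mulr0 normr0.
        by rewrite mul1r mulr1; apply: H; move: t01; rewrite inE/= in_itv.
    by rewrite Rint_indic01.
  have eI : \int[mu]_x (v x * w x) = e * I.
    by rewrite -RintegralZl//; apply: eq_Rintegral => x _; rewrite /v; ring.
  have N2I : N2 <= e ^+ 2 * I.
    rewrite -RintegralZl//; apply: le_Rint.
    - exact: (sqr_integrable mv bv').
    - exact: integrable_scale.
    move=> x; rewrite /v !exprMn ler_wpM2l ?sqr_ge0//.
    apply: ler_wpM2r; first exact: sqr_ge0.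
    by apply: ler_piMr; [exact: chi0|exact: chi1].
  have I0 : 0 <= I by apply: Rintegral_ge0 => x _; rewrite mulr_ge0 ?sqr_ge0.
  have le2 : e * I <= L * (e ^+ 2 * I + U).
    rewrite -eI (le_trans (ler_norm _))// (le_trans le1)//.
    apply: ler_pM => //; [exact: addr_ge0|by rewrite lerDl|exact: lerD].
  have eL : e * (2 * L) = 1 by rewrite mulVf// gt_eqF// mulr_gt0.
  have H3 : 2 * L * (e * I) <= 2 * L * (L * (e ^+ 2 * I + U)).
    by rewrite ler_pM2l// mulr_gt0.
  have E1 : 2 * L * (e * I) = I by rewrite mulrA [_ * e]mulrC eL mul1r.
  have E2 : 2 * L * (L * (e ^+ 2 * I + U)) = (e * (2 * L)) ^+ 2 * I / 2 + 2 * L ^+ 2 * U.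
    by field.
  rewrite E1 E2 eL expr1n mul1r in H3.
  lra.
apply: (fatou_le (f_ := fun k x => chi k x * w x ^+ 2)).
- move=> k; apply: measurable_funM => //; exact: measurable_funX.
- by move=> k x; rewrite mulr_ge0 ?sqr_ge0.
- move=> x; rewrite -[X in _ --> X](mul1r (w x ^+ 2)); apply: cvgM; last exact: cvg_cst.
  rewrite -[X in _ --> X](expr1n _ 2); under eq_fun do rewrite /chi expr2.
  by rewrite expr2; apply: cvgM; exact: cvg_kap.
- by move=> k; have [ik lek] := key k; rewrite -EFin_Rint// lee_fin.
Qed.

End trilinear.

(** * Complex-valued functions *)

Section complex_L2.
Variable R : realType.
Local Notation Re := complex.Re.
Local Notation Im := complex.Im.

Lemma normc_sqr (z : R[i]) : normc z ^+ 2 = Re z ^+ 2 + Im z ^+ 2.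
Proof. by case: z => x y /=; rewrite sqr_sqrtr// addr_ge0 ?sqr_ge0. Qed.

Lemma normc_ge0 (z : R[i]) : 0 <= normc z.
Proof. by case: z => x y; exact: sqrtr_ge0. Qed.

Lemma Re_le_normc (z : R[i]) : `|Re z| <= normc z.
Proof.
rewrite -(@ler_sqr _ `|Re z|) ?nnegrE ?normc_ge0// normc_sqr.
by rewrite real_normK ?num_real// lerDl sqr_ge0.
Qed.

Lemma Im_le_normc (z : R[i]) : `|Im z| <= normc z.
Proof.
rewrite -(@ler_sqr _ `|Im z|) ?nnegrE ?normc_ge0// normc_sqr.
by rewrite real_normK ?num_real// lerDr sqr_ge0.
Qed.

Lemma normc_le (z : R[i]) : normc z <= `|Re z| + `|Im z|.
Proof.
rewrite -(@ler_sqr _ (normc z)) ?nnegrE ?normc_ge0 ?addr_ge0// normc_sqr.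
rewrite -(real_normK (num_real (Re z))) -(real_normK (num_real (Im z))).
have := mulr_ge0 (normr_ge0 (Re z)) (normr_ge0 (Im z)); rewrite !expr2; nra.
Qed.

Lemma Lfun2P d (T : measurableType d) (mu : {measure set T -> \bar R}) (f : T -> R) :
  f \in Lfun mu 2%:E <-> measurable_fun setT f /\ (\int[mu]_x (f x ^+ 2)%:E < +oo)%E.
Proof.
have E : ('N[mu]_2%:E[EFin \o f] = (\int[mu]_x (f x ^+ 2)%:E) `^ 2^-1)%E.
  rewrite unlock; congr (_ `^ _)%E; apply: eq_integral => x _ /=.
  by rewrite -[in RHS](real_normK (num_real (f x))) powR_mulrn.
split.
- move=> lf; split; first by move: lf; rewrite inE => /andP[]; rewrite inE.
  have /integrableP[_] := Lfun2_integrable_sqr lf.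
  by apply: le_lt_trans; apply: ge0_le_integral => //=;
    [move=> x _; rewrite lee_fin sqr_ge0
    |apply/measurable_EFinP; apply: measurable_funX; move: lf; rewrite inE => /andP[]; rewrite inE
    |apply/measurable_EFinP; apply: measurableT_comp => //; apply: measurable_funX; move: lf; rewrite inE => /andP[]; rewrite inE
    |move=> x _; rewrite lee_fin ler_norm].
- move=> [mf fi]; rewrite inE; apply/andP; split; rewrite inE//=.
  by rewrite /finite_norm E poweR_lty.
Qed.

Variable n : nat.
Notation V := 'rV[R]_n.
Notation mu := (lebesgue_rV R n).

(** Extended-real valued, so that it can be compared before integrability is
    known. *)
Definition nsq (f : V -> R[i]) : \bar R :=
  (\int[mu]_x (Re (f x) ^+ 2 + Im (f x) ^+ 2)%:E)%E.

Lemma nsq_ge0 f : (0 <= nsq f)%E.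
Proof. by apply: integral_ge0 => x _; rewrite lee_fin addr_ge0 ?sqr_ge0. Qed.

Lemma L2normE f : L2norm f = (nsq f `^ 2^-1)%E.
Proof.
rewrite /L2norm unlock; congr (_ `^ _)%E; apply: eq_integral => x _ /=.
by rewrite ger0_norm ?normc_ge0// powR_mulrn ?normc_ge0// normc_sqr.
Qed.

Lemma L2norm_le (C : R) f g : 0 <= C -> (nsq f <= (C ^+ 2)%:E * nsq g)%E ->
  (L2norm f <= C%:E * L2norm g)%E.
Proof.
move=> C0 fg; rewrite !L2normE.
have -> : (C%:E = (C ^+ 2)%:E `^ 2^-1)%E.
  by rewrite poweR_EFin powR12_sqrt ?sqr_ge0// sqrtr_sqr ger0_norm.
rewrite -poweRM ?nsq_ge0 ?lee_fin ?sqr_ge0//.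
apply: gt0_ler_poweR => //; rewrite in_itv/= leey andbT ?nsq_ge0//.
by rewrite mule_ge0 ?nsq_ge0 ?lee_fin ?sqr_ge0.
Qed.

Lemma nsqD f : measurable_fun setT (fun x => Re (f x)) ->
  measurable_fun setT (fun x => Im (f x)) ->
  nsq f = (\int[mu]_x (Re (f x) ^+ 2)%:E + \int[mu]_x (Im (f x) ^+ 2)%:E)%E.
Proof.
move=> mr mi; rewrite /nsq; under eq_integral do rewrite EFinD.
rewrite ge0_integralD//.
- by move=> x _; rewrite lee_fin sqr_ge0.
- by apply/measurable_EFinP; exact: measurable_funX.
- by move=> x _; rewrite lee_fin sqr_ge0.
- by apply/measurable_EFinP; exact: measurable_funX.
Qed.

Lemma in_L2P f : in_L2 f <-> [/\ measurable_fun setT (fun x => Re (f x)),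
  measurable_fun setT (fun x => Im (f x)) & (nsq f < +oo)%E].
Proof.
split.
- move=> [/Lfun2P[mr ir] /Lfun2P[mi ii]]; split => //.
  by rewrite nsqD// lte_add_pinfty.
- move=> [mr mi]; rewrite nsqD// => H; split; apply/Lfun2P; split => //.
  + apply: le_lt_trans H; rewrite leeDl//.
    by apply: integral_ge0 => x _; rewrite lee_fin sqr_ge0.
  + apply: le_lt_trans H; rewrite leeDr//.
    by apply: integral_ge0 => x _; rewrite lee_fin sqr_ge0.
Qed.

End complex_L2.

Section classes.
Variables (R : realType).
Local Notation Re := complex.Re.
Local Notation Im := complex.Im.

Lemma dotp_ge0 k (x : 'rV[R]_k) : 0 <= dotp x x.
Proof. by apply: sumr_ge0 => i _; rewrite -expr2 sqr_ge0. Qed.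

Lemma japanese_ge1 k (x : 'rV[R]_k) : 1 <= japanese x.
Proof.
have d0 := dotp_ge0 x.
by rewrite /japanese -[leLHS]sqrtr1 ler_wsqrtr// lerDl.
Qed.

(** For a symbol of order 0 the bracket enters with a nonpositive exponent. *)
Lemma shubin_smooth_le n (rho : R) (a : 'rV[R]_(n + n) -> R[i]) N :
  0 <= rho -> shubin 0 rho a -> exists M : R,
  smooth_le N (fun=> M) (fun z => Re (a z)) /\
  smooth_le N (fun=> M) (fun z => Im (a z)).
Proof.
move=> rho0 [[sr si] Ha].
have bound s : exists C : R, forall z, normc (cpartials s a z) <= C.
  have [C [C0 HC]] := Ha s; exists C => z; apply: le_trans (HC z) _.
  rewrite ler_piMr// sub0r powRN invf_le1 ?powR_gt0 ?(lt_le_trans ltr01) ?japanese_ge1//.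
  rewrite -[leLHS](powRr0 (japanese z)); apply: ler_powR; first exact: japanese_ge1.
  by rewrite mulr_ge0.
have [C C0 HC] := @smooth_smooth_le R _ (fun=> 1) _ (fun=> ler01) sr
  (fun s => ltac:(by have [C HC] := bound s; exists C => z;
    rewrite mulr1; apply: le_trans (HC z); exact: (Re_le_normc (cpartials s a z)))) N.
have [D D0 HD] := @smooth_smooth_le R _ (fun=> 1) _ (fun=> ler01) si
  (fun s => ltac:(by have [C' HC'] := bound s; exists C' => z;
    rewrite mulr1; apply: le_trans (HC' z); exact: (Im_le_normc (cpartials s a z)))) N.
exists (C + D); split.
  by apply: smooth_le_weight HC => z; rewrite mulr1 lerDl.
by apply: smooth_le_weight HD => z; rewrite mulr1 lerDr.
Qed.

(** Each of the n factors of 1 / wgt is at most the square of the Japanese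
    bracket. *)
Lemma wgt_japanese n (x : 'rV[R]_n) : 1 <= japanese x ^+ (2 * n) * wgt x.
Proof.
rewrite exprM /wgt /prodf -[X in _ ^+ X](card_ord n) -prodr_const -big_split/=.
apply: (big_ind (fun t => 1 <= t)) => // [s t s1 t1|i _].
  by rewrite -[leLHS]mulr1 ler_pM.
rewrite sqr_sqrtr ?addr_ge0 ?dotp_ge0// /cw ler_pdivlMr ?cw_den_gt0// mul1r.
rewrite lerD2l /dotp (bigD1 i)//= expr2 lerDl.
by apply: sumr_ge0 => j _; rewrite -expr2 sqr_ge0.
Qed.

Lemma schwartz_smooth_le n (f : 'rV[R]_n -> R[i]) N m : schwartz f ->
  exists2 C : R, 0 <= C &
    smooth_le N (fun x => C * wgt x ^+ m) (fun x => Re (f x)) /\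
    smooth_le N (fun x => C * wgt x ^+ m) (fun x => Im (f x)).
Proof.
move=> [[sr si] Hf].
have w0 (x : 'rV[R]_n) : 0 <= wgt x ^+ m by rewrite exprn_ge0// wgt_ge0.
have bound s : exists C : R, forall x, normc (cpartials s f x) <= C * wgt x ^+ m.
  have [C HC] := Hf (2 * n * m)%N s; exists C => x.
  have W := wgt_japanese x.
  have W2 : 1 <= japanese x ^+ (2 * n * m) * wgt x ^+ m.
    by rewrite exprM -exprMn exprn_ege1.
  rewrite -[leLHS]mulr1; apply: le_trans (ler_wpM2l (normc_ge0 _) W2) _.
  by rewrite mulrA; apply: ler_wpM2r => //; rewrite mulrC.
have [C C0 HC] := @smooth_smooth_le R _ (fun x => wgt x ^+ m) _ w0 sr
  (fun s => ltac:(by have [C HC] := bound s; exists C => z;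
    apply: le_trans (HC z); exact: (Re_le_normc (cpartials s f z)))) N.
have [D D0 HD] := @smooth_smooth_le R _ (fun x => wgt x ^+ m) _ w0 si
  (fun s => ltac:(by have [C' HC'] := bound s; exists C' => z;
    apply: le_trans (HC' z); exact: (Im_le_normc (cpartials s f z)))) N.
exists (C + D); first exact: addr_ge0.
split.
  by apply: smooth_le_weight HC => z; rewrite ler_wpM2r// lerDl.
by apply: smooth_le_weight HD => z; rewrite ler_wpM2r// lerDr.
Qed.

End classes.

Section four_terms.
Context d (T : measurableType d) (R : realType) (mu : {measure set T -> \bar R}).

(** The real and imaginary parts of a product of three complex factors are sums
    of four products of real functions. *)
Lemma Rint_lin4 (s1 s2 s3 s4 : R) (f1 f2 f3 f4 : T -> R) :
  mu.-integrable setT (EFin \o f1) -> mu.-integrable setT (EFin \o f2) ->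
  mu.-integrable setT (EFin \o f3) -> mu.-integrable setT (EFin \o f4) ->
  \int[mu]_x (s1 * f1 x + s2 * f2 x + s3 * f3 x + s4 * f4 x) =
  s1 * \int[mu]_x f1 x + s2 * \int[mu]_x f2 x +
  s3 * \int[mu]_x f3 x + s4 * \int[mu]_x f4 x.
Proof.
move=> i1 i2 i3 i4.
have j1 := integrable_scale s1 i1; have j2 := integrable_scale s2 i2.
have j3 := integrable_scale s3 i3; have j4 := integrable_scale s4 i4.
have j12 := integrable_add j1 j2; have j123 := integrable_add j12 j3.
by rewrite (RintegralD measurableT j123 j4) (RintegralD measurableT j12 j3)
  (RintegralD measurableT j1 j2) !RintegralZl.
Qed.

End four_terms.

Lemma mul_comb4 (R : realType) (q s1 s2 s3 s4 i1 i2 i3 i4 : R) :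
  q * (s1 * i1 + s2 * i2 + s3 * i3 + s4 * i4) =
  q * s1 * i1 + q * s2 * i2 + q * s3 * i3 + q * s4 * i4.
Proof. by ring. Qed.

Lemma scale_comb4 (R : realType) (b : bool) (q s1 s2 s3 s4 i1 i2 i3 i4 : R) :
  (if b then q * (s1 * i1 + s2 * i2 + s3 * i3 + s4 * i4) else 0) =
  q * s1 * (b%:R * i1) + q * s2 * (b%:R * i2) + q * s3 * (b%:R * i3) +
  q * s4 * (b%:R * i4).
Proof. by case: b; rewrite /=; ring. Qed.

(** * The Born-Jordan operator on Schwartz functions *)

Section born_jordan.
Variables (R : realType) (n : nat) (hbar : R).
Hypothesis h0 : 0 < hbar.
Local Notation Re := complex.Re.
Local Notation Im := complex.Im.
Notation V := 'rV[R]_n.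
Notation mu := (lebesgue_rV R n).
Notation leb := (@lebesgue_measure R).

Let c := hbar^-1.
Let c0 : 0 < c. Proof. by rewrite invr_gt0. Qed.
Let kappa := ((2 * pi * hbar)^-1) ^+ n.

Lemma cos_shift (t : R) : cos (t + - (pi / 2)) = sin t.
Proof. by rewrite cosD cosN sinN cos_pihalf sin_pihalf; ring. Qed.

Section real_combination.
Variables (a1 a2 : 'rV[R]_(n + n) -> R) (M : R) (u1 u2 : V -> R) (B : R).
Hypothesis sa1 : smooth_le (4 * n) (fun=> M) a1.
Hypothesis sa2 : smooth_le (4 * n) (fun=> M) a2.
Hypothesis su1 : smooth_le (2 * n) (fun y => B * wgt y) u1.
Hypothesis su2 : smooth_le (2 * n) (fun y => B * wgt y) u2.

Let integrand phi (a : 'rV[R]_(n + n) -> R) (u : V -> R) tau (x p y : V) : R :=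
  osc c phi p x y * a (row_mx (mid tau x y) p) * u y.

Let int_y phi a u : smooth_le (4 * n) (fun=> M) a ->
  smooth_le (2 * n) (fun y => B * wgt y) u -> forall tau x p,
  mu.-integrable setT (EFin \o integrand phi a u tau x p).
Proof.
move=> sa su tau x p; apply: dom_integrable (integrable_wgtZ n (M * B)) _.
  apply: measurable_funM; last exact: smooth_le_meas su.
  apply: measurable_funM; first exact: measurable_osc.
  by apply: measurable_amid => //; exact: smooth_le_meas sa.
move=> y; rewrite /integrand normrM -mulrA.
apply: ler_pM => //; last exact: (smooth_le_norm su).
rewrite normrM -[leRHS]mul1r; apply: ler_pM => //; first exact: osc_le1.
exact: (smooth_le_norm sa).
Qed.

Let int_p phi a u : smooth_le (4 * n) (fun=> M) a ->
  smooth_le (2 * n) (fun y => B * wgt y) u -> forall tau x, 0 <= tau <= 1 ->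
  mu.-integrable setT (EFin \o (fun p => jform c phi a tau u x p)).
Proof.
move=> sa su tau x tau01; have [K K0 HK] := jform_le phi c0 sa su.
apply: dom_integrable (integrable_wgtZ n K) (HK tau x ^~ tau01).
by apply: (measurable_jform _ _ sa) => //; exact: smooth_le_meas su.
Qed.

Let int_t phi (a : 'rV[R]_(n + n) -> R) (u : V -> R) : smooth_le (4 * n) (fun=> M) a ->
  smooth_le (2 * n) (fun y => B * wgt y) u -> forall x,
  leb.-integrable setT (EFin \o (fun t => \1_(`[0, 1] : set R) t * opr c phi a t u x)).
Proof.
move=> sa su x; have [K K0 HK] := opr_le phi c0 sa su.
apply: (@dom_integrable _ (measurableTypeR R) R leb _ _ _ (integrable_indic01 K)).
  exact: (measurableT_comp (measurable_opr_ind _ _ sa (smooth_le_meas su)) (measurable_pair1 x)).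
by move=> t; exact: opr_ind_le.
Qed.

(** Linearity of the integral in y, then in p, then in tau; the bounds above
    make each of these integrals finite. *)
Lemma bj_combination (s1 s2 s3 s4 : R) (F : R -> V -> V -> V -> R) x :
  (forall tau p y, F tau x p y =
    s1 * integrand 0 a1 u1 tau x p y + s2 * integrand 0 a2 u2 tau x p y +
    s3 * integrand (- (pi / 2)) a1 u2 tau x p y +
    s4 * integrand (- (pi / 2)) a2 u1 tau x p y) ->
  \int[leb]_(tau in `[0, 1]) (kappa * \int[mu]_p \int[mu]_y F tau x p y) =
  kappa * (s1 * oprBJ c 0 a1 u1 x + s2 * oprBJ c 0 a2 u2 x +
    s3 * oprBJ c (- (pi / 2)) a1 u2 x + s4 * oprBJ c (- (pi / 2)) a2 u1 x).
Proof.
move=> FE; rewrite Rintegral_mkcond !oprBJE.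
transitivity (\int[leb]_t (
  kappa * s1 * (\1_(`[0, 1] : set R) t * opr c 0 a1 t u1 x) +
  kappa * s2 * (\1_(`[0, 1] : set R) t * opr c 0 a2 t u2 x) +
  kappa * s3 * (\1_(`[0, 1] : set R) t * opr c (- (pi / 2)) a1 t u2 x) +
  kappa * s4 * (\1_(`[0, 1] : set R) t * opr c (- (pi / 2)) a2 t u1 x))).
  apply: eq_Rintegral => t _; rewrite patchE indicE -scale_comb4.
  case: ifP => // t01; congr (kappa * _).
  have {}t01 : 0 <= t <= 1 by move: t01; rewrite inE/= in_itv.
  transitivity (\int[mu]_p (
      s1 * jform c 0 a1 t u1 x p + s2 * jform c 0 a2 t u2 x p +
      s3 * jform c (- (pi / 2)) a1 t u2 x p + s4 * jform c (- (pi / 2)) a2 t u1 x p)).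
    apply: eq_Rintegral => p _.
    under eq_Rintegral do rewrite FE.
    by rewrite Rint_lin4//; exact: int_y.
  by apply: Rint_lin4; exact: int_p.
rewrite (@Rint_lin4 _ (measurableTypeR R) R leb); try exact: int_t.
exact: esym (mul_comb4 _ _ _ _ _ _ _ _ _).
Qed.

Lemma oprBJB phi x : oprBJ c phi a1 (fun y => u1 y - u2 y) x =
  oprBJ c phi a1 u1 x - oprBJ c phi a1 u2 x.
Proof.
have J tau p : jform c phi a1 tau (fun y => u1 y - u2 y) x p =
    jform c phi a1 tau u1 x p - jform c phi a1 tau u2 x p.
  rewrite /jform -RintegralB//; last 2 first.
  - exact: int_y.
  - exact: int_y.
  by apply: eq_Rintegral => y _; rewrite mulrBr.
rewrite !oprBJE -(@RintegralB _ (measurableTypeR R) R leb)//; last 2 first.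
- exact: int_t.
- exact: int_t.
apply: eq_Rintegral => t _; rewrite -mulrBr indicE.
case: (boolP (t \in _)) => t01; last by rewrite !mul0r.
have {}t01 : 0 <= t <= 1 by move: t01; rewrite inE/= in_itv.
rewrite !mul1r /opr -RintegralB//; last 2 first.
- exact: int_p.
- exact: int_p.
by apply: eq_Rintegral => p _; rewrite J.
Qed.

End real_combination.
End born_jordan.

Lemma Re_mul (R : realType) (z w : R[i]) :
  complex.Re (z * w) = complex.Re z * complex.Re w - complex.Im z * complex.Im w.
Proof. by case: z => ? ?; case: w. Qed.

Lemma Im_mul (R : realType) (z w : R[i]) :
  complex.Im (z * w) = complex.Re z * complex.Im w + complex.Im z * complex.Re w.
Proof. by case: z => ? ?; case: w. Qed.

Lemma sqr_sum4_le (R : realType) (p q r t : R) :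
  (p + q + r + t) ^+ 2 <= 4 * (p ^+ 2 + q ^+ 2 + r ^+ 2 + t ^+ 2).
Proof.
rewrite -subr_ge0; have -> : 4 * (p ^+ 2 + q ^+ 2 + r ^+ 2 + t ^+ 2) - (p + q + r + t) ^+ 2 =
  (p - q) ^+ 2 + (p - r) ^+ 2 + (p - t) ^+ 2 + (q - r) ^+ 2 + (q - t) ^+ 2 + (r - t) ^+ 2.
  by ring.
by rewrite !addr_ge0 ?sqr_ge0.
Qed.

Section born_jordan_L2.
Variables (R : realType) (n : nat) (hbar : R).
Hypothesis h0 : 0 < hbar.
Local Notation Re := complex.Re.
Local Notation Im := complex.Im.
Notation V := 'rV[R]_n.
Notation mu := (lebesgue_rV R n).
Notation leb := (@lebesgue_measure R).

Let c := hbar^-1.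
Let c0 : 0 < c. Proof. by rewrite invr_gt0. Qed.
Let kappa := ((2 * pi * hbar)^-1) ^+ n.

Variables (a1 a2 : 'rV[R]_(n + n) -> R) (M : R).
Hypothesis sa1 : smooth_le (4 * n) (fun=> M) a1.
Hypothesis sa2 : smooth_le (4 * n) (fun=> M) a2.

(** The regularity and decay under which the oscillatory integral is handled;
    this class contains the Schwartz functions. *)
Definition decaying (u : V -> R) : Prop :=
  exists2 B : R, smooth_le (2 * n) (fun y => B * wgt y) u &
    forall x, `|u x| <= B * wgt x ^+ 2.

(** The shape common to the real part and the imaginary part of the operator, up
    to signs and the order of u1 and u2; the phase - pi / 2 stands for the sine. *)
Definition bjcomb (s1 s2 s3 s4 : R) (u1 u2 : V -> R) (x : V) : R :=
  kappa * (s1 * oprBJ c 0 a1 u1 x + s2 * oprBJ c 0 a2 u2 x +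
    s3 * oprBJ c (- (pi / 2)) a1 u2 x + s4 * oprBJ c (- (pi / 2)) a2 u1 x).

Lemma smooth_le_wgtW N (B B' : R) (u : V -> R) : B <= B' ->
  smooth_le N (fun y => B * wgt y) u -> smooth_le N (fun y => B' * wgt y) u.
Proof. by move=> BB'; apply: smooth_le_weight => y; rewrite ler_wpM2r ?wgt_ge0. Qed.

Lemma decaying_meas u : decaying u -> measurable_fun setT u.
Proof. by move=> [B /smooth_le_meas]. Qed.

Lemma decaying_sqr u : decaying u -> mu.-integrable setT (EFin \o (fun x => u x ^+ 2)).
Proof.
move=> du; have [B _ bu] := du; have mu_ := decaying_meas du.
apply: dom_integrable (integrable_wgtZ n (B ^+ 2)) _.
  exact: measurable_funX.
move=> x; rewrite normrX.
apply: le_trans (_ : (B * wgt x ^+ 2) ^+ 2 <= _).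
  by rewrite lerXn2r ?nnegrE// (le_trans _ (bu x)).
rewrite exprMn ler_wpM2l ?sqr_ge0// -exprM.
by rewrite -[leRHS]expr1 ler_wiXn2l// ?wgt_ge0 ?wgt_le1.
Qed.

Lemma measurable_bjcomb s1 s2 s3 s4 u1 u2 : measurable_fun setT u1 ->
  measurable_fun setT u2 -> measurable_fun setT (bjcomb s1 s2 s3 s4 u1 u2).
Proof.
move=> m1 m2; apply: measurable_funM => //.
apply: measurable_funD; [apply: measurable_funD; [apply: measurable_funD|]|];
  apply: measurable_funM => //.
- exact: (measurable_oprBJ _ _ sa1).
- exact: (measurable_oprBJ _ _ sa2).
- exact: (measurable_oprBJ _ _ sa1).
- exact: (measurable_oprBJ _ _ sa2).
Qed.

Lemma bjcomb_L2 : exists2 K : R, 0 <= K & forall s1 s2 s3 s4 u1 u2,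
  s1 ^+ 2 <= 1 -> s2 ^+ 2 <= 1 -> s3 ^+ 2 <= 1 -> s4 ^+ 2 <= 1 ->
  decaying u1 -> decaying u2 ->
  (\int[mu]_x (bjcomb s1 s2 s3 s4 u1 u2 x ^+ 2)%:E <=
   (K * (\int[mu]_x (u1 x ^+ 2) + \int[mu]_x (u2 x ^+ 2)))%:E)%E.
Proof.
have [K1 K10 H1] := oprBJ_L2 0 c0 sa1.
have [K2 K20 H2] := oprBJ_L2 0 c0 sa2.
have [K3 K30 H3] := oprBJ_L2 (- (pi / 2)) c0 sa1.
have [K4 K40 H4] := oprBJ_L2 (- (pi / 2)) c0 sa2.
exists (4 * kappa ^+ 2 * (K1 + K2 + K3 + K4)) => [|s1 s2 s3 s4 u1 u2 l1 l2 l3 l4 d1 d2].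
  by rewrite mulr_ge0 ?addr_ge0// mulr_ge0 ?sqr_ge0.
have m1 := decaying_meas d1; have m2 := decaying_meas d2.
move: d1 d2 => [B1 su1 bu1] [B2 su2 bu2].
set U1 := \int[mu]_x (u1 x ^+ 2); set U2 := \int[mu]_x (u2 x ^+ 2).
have U10 : 0 <= U1 by apply: Rintegral_ge0 => x _; exact: sqr_ge0.
have U20 : 0 <= U2 by apply: Rintegral_ge0 => x _; exact: sqr_ge0.
set w1 := oprBJ c 0 a1 u1; set w2 := oprBJ c 0 a2 u2.
set w3 := oprBJ c (- (pi / 2)) a1 u2; set w4 := oprBJ c (- (pi / 2)) a2 u1.
have mw1 : measurable_fun setT w1 by exact: (measurable_oprBJ _ _ sa1).
have mw2 : measurable_fun setT w2 by exact: (measurable_oprBJ _ _ sa2).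
have mw3 : measurable_fun setT w3 by exact: (measurable_oprBJ _ _ sa1).
have mw4 : measurable_fun setT w4 by exact: (measurable_oprBJ _ _ sa2).
have sq (w : V -> R) : measurable_fun setT w ->
    measurable_fun setT (fun x => (w x ^+ 2)%:E).
  by move=> mw; apply/measurable_EFinP; exact: measurable_funX.
have ge0 (w : V -> R) x : (0 <= (w x ^+ 2)%:E)%E by rewrite lee_fin sqr_ge0.
have m12 : measurable_fun setT (fun x => (w1 x ^+ 2)%:E + (w2 x ^+ 2)%:E)%E.
  by apply: emeasurable_funD; exact: sq.
have m123 : measurable_fun setT (fun x => (w1 x ^+ 2)%:E + (w2 x ^+ 2)%:E + (w3 x ^+ 2)%:E)%E.
  by apply: emeasurable_funD => //; exact: sq.
have m1234 : measurable_fun setT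
    (fun x => (w1 x ^+ 2)%:E + (w2 x ^+ 2)%:E + (w3 x ^+ 2)%:E + (w4 x ^+ 2)%:E)%E.
  by apply: emeasurable_funD => //; exact: sq.
apply: (@le_trans _ _ ((4 * kappa ^+ 2)%:E * (\int[mu]_x (w1 x ^+ 2)%:E +
   \int[mu]_x (w2 x ^+ 2)%:E + \int[mu]_x (w3 x ^+ 2)%:E + \int[mu]_x (w4 x ^+ 2)%:E))%E).
  rewrite -(ge0_integralD mu measurableT (fun x _ => ge0 w1 x) (sq _ mw1)
    (fun x _ => ge0 w2 x) (sq _ mw2)).
  rewrite -(ge0_integralD mu measurableT (fun x _ => adde_ge0 (ge0 w1 x) (ge0 w2 x)) m12
    (fun x _ => ge0 w3 x) (sq _ mw3)).
  rewrite -(ge0_integralD mu measurableT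
    (fun x _ => adde_ge0 (adde_ge0 (ge0 w1 x) (ge0 w2 x)) (ge0 w3 x)) m123
    (fun x _ => ge0 w4 x) (sq _ mw4)).
  rewrite -ge0_integralZl//.
  - apply: ge0_le_integral => //.
    + by apply: sq; exact: measurable_bjcomb.
    + exact: measurable_funeM.
    + move=> x _; rewrite -!EFinD -EFinM lee_fin /bjcomb -/(w1 x) -/(w2 x) -/(w3 x) -/(w4 x).
      rewrite exprMn (mulrC 4) -[leRHS]mulrA; apply: ler_wpM2l; first exact: sqr_ge0.
      have E s (w : R) : s ^+ 2 <= 1 -> (s * w) ^+ 2 <= w ^+ 2.
        by move=> ls; rewrite exprMn ler_piMl ?sqr_ge0.
      apply: le_trans (sqr_sum4_le _ _ _ _) _; rewrite ler_pM2l//.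
      by rewrite !lerD// E.
  - by move=> x _; rewrite !adde_ge0.
  - by rewrite lee_fin mulr_ge0 ?sqr_ge0.
apply: (@le_trans _ _ ((4 * kappa ^+ 2)%:E *
    ((K1 * U1)%:E + (K2 * U2)%:E + (K3 * U2)%:E + (K4 * U1)%:E))%E).
  apply: lee_wpmul2l; first by rewrite lee_fin mulr_ge0 ?sqr_ge0.
  apply: leeD; last exact: H4 su1 bu1.
  apply: leeD; last exact: H3 su2 bu2.
  by apply: leeD; [exact: H1 su1 bu1|exact: H2 su2 bu2].
rewrite -!EFinD -EFinM lee_fin -[leRHS]mulrA; apply: ler_wpM2l.
  by rewrite mulr_ge0 ?sqr_ge0.
have -> : (K1 + K2 + K3 + K4) * (U1 + U2) =
  (K1 * U1 + K2 * U2 + K3 * U2 + K4 * U1) + (K1 * U2 + K2 * U1 + K3 * U1 + K4 * U2) by ring.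
by rewrite lerDl !addr_ge0// mulr_ge0.
Qed.

Lemma decayingB u v : decaying u -> decaying v -> decaying (fun x => u x - v x).
Proof.
move=> [B su bu] [D sv bv]; exists (B + `|-1| * D) => [|x].
  have := smooth_leD su (smooth_leZ (-1) sv).
  move=> /(smooth_le_weight _) H.
  have -> : (fun x => u x - v x) = (fun x => u x + -1 * v x).
    by apply/funext => x; rewrite mulN1r.
  by apply: H => x; rewrite mulrDl mulrA.
apply: le_trans (ler_normB _ _) _; rewrite normrN1 mul1r mulrDl.
exact: lerD.
Qed.

Lemma decaying_common u v : decaying u -> decaying v -> exists B,
  smooth_le (2 * n) (fun y => B * wgt y) u /\ smooth_le (2 * n) (fun y => B * wgt y) v.
Proof.
move=> [B su _] [D sv _]; exists (Num.max B D).
by split; [apply: smooth_le_wgtW su|apply: smooth_le_wgtW sv]; rewrite le_max lexx ?orbT.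
Qed.

Lemma bjcombB s1 s2 s3 s4 u1 u2 v1 v2 x : decaying u1 -> decaying u2 ->
  decaying v1 -> decaying v2 ->
  bjcomb s1 s2 s3 s4 (fun y => u1 y - v1 y) (fun y => u2 y - v2 y) x =
  bjcomb s1 s2 s3 s4 u1 u2 x - bjcomb s1 s2 s3 s4 v1 v2 x.
Proof.
move=> du1 du2 dv1 dv2.
have [B [su1 sv1]] := decaying_common du1 dv1.
have [D [su2 sv2]] := decaying_common du2 dv2.
rewrite /bjcomb (oprBJB h0 sa1 su1 sv1) (oprBJB h0 sa2 su2 sv2).
rewrite (oprBJB h0 sa1 su2 sv2) (oprBJB h0 sa2 su1 sv1).
move: kappa => q; do 8 move: (oprBJ _ _ _ _ _) => ?; ring.
Qed.

End born_jordan_L2.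

Definition cdecaying (R : realType) n (f : 'rV[R]_n -> R[i]) : Prop :=
  decaying (fun x => complex.Re (f x)) /\ decaying (fun x => complex.Im (f x)).

Lemma nsq_EFin (R : realType) n (f : 'rV[R]_n -> R[i]) : cdecaying f ->
  nsq f = (\int[lebesgue_rV R n]_x (complex.Re (f x) ^+ 2) +
           \int[lebesgue_rV R n]_x (complex.Im (f x) ^+ 2))%:E.
Proof.
move=> [dr di]; rewrite nsqD; [|exact: decaying_meas..].
by rewrite EFinD !EFin_Rint//; exact: decaying_sqr.
Qed.

Section op_BJ_L2.
Variables (R : realType) (n : nat) (hbar rho : R) (a : 'rV[R]_(n + n) -> R[i]).
Hypothesis h0 : 0 < hbar.
Local Notation Re := complex.Re.
Local Notation Im := complex.Im.
Notation V := 'rV[R]_n.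
Notation mu := (lebesgue_rV R n).
Notation leb := (@lebesgue_measure R).
Let ar z := Re (a z).
Let ai z := Im (a z).
Let kappa := ((2 * pi * hbar)^-1) ^+ n.

Section symbol_bound.
Variable M : R.
Hypothesis sr : smooth_le (4 * n) (fun=> M) ar.
Hypothesis si : smooth_le (4 * n) (fun=> M) ai.

(** The real part of (cos + i sin) (a1 + i a2) (u1 + i u2). *)
Lemma Re_op_BJ psi x : decaying (fun y => Re (psi y)) -> decaying (fun y => Im (psi y)) ->
  Re (op_BJ hbar a psi x) =
  bjcomb hbar ar ai 1 (-1) (-1) (-1) (fun y => Re (psi y)) (fun y => Im (psi y)) x.
Proof.
move=> dr di; have [B [su1 su2]] := decaying_common dr di.
rewrite /bjcomb -(bj_combination h0 sr si su1 su2
  (F := fun tau x p y => Re (expi (hbar^-1 * dotp p (x - y)) *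
      a (row_mx ((1 - tau) *: x + tau *: y) p) * psi y))).
  rewrite /op_BJ /cintegral/=; apply: eq_Rintegral => t _.
  by rewrite mul0r subr0.
move=> tau p y; rewrite !(Re_mul, Im_mul) /= /osc addr0 cos_shift /ar /ai /mid; ring.
Qed.

Lemma Im_op_BJ psi x : decaying (fun y => Re (psi y)) -> decaying (fun y => Im (psi y)) ->
  Im (op_BJ hbar a psi x) =
  bjcomb hbar ar ai 1 1 1 (-1) (fun y => Im (psi y)) (fun y => Re (psi y)) x.
Proof.
move=> dr di; have [B [su1 su2]] := decaying_common dr di.
rewrite /bjcomb -(bj_combination h0 sr si su2 su1
  (F := fun tau x p y => Im (expi (hbar^-1 * dotp p (x - y)) *
      a (row_mx ((1 - tau) *: x + tau *: y) p) * psi y))).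
  rewrite /op_BJ /cintegral/=; apply: eq_Rintegral => t _.
  by rewrite mul0r addr0.
move=> tau p y; rewrite !(Re_mul, Im_mul) /= /osc addr0 cos_shift /ar /ai /mid; ring.
Qed.

End symbol_bound.

Hypothesis rho0 : 0 <= rho.
Hypothesis sa : shubin 0 rho a.

(** The difference of two Schwartz functions, as a plain function, is all that
    the Cauchy property of the images requires. *)
Lemma op_BJB psi phi x : cdecaying psi -> cdecaying phi ->
  op_BJ hbar a (fun y => psi y - phi y) x = op_BJ hbar a psi x - op_BJ hbar a phi x.
Proof.
have [M [sr si]] := shubin_smooth_le (4 * n) rho0 sa.
move=> [pr pi'] [qr qi]; apply/eqP; rewrite eq_complex; apply/andP.
have ReB (z w : R[i]) : Re (z - w) = Re z - Re w by case: z; case: w.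
have ImB (z w : R[i]) : Im (z - w) = Im z - Im w by case: z; case: w.
have dr : decaying (fun y => Re (psi y - phi y)).
  by under eq_fun do rewrite ReB; exact: decayingB.
have di : decaying (fun y => Im (psi y - phi y)).
  by under eq_fun do rewrite ImB; exact: decayingB.
have ER : (fun y => Re (psi y - phi y)) = (fun y => Re (psi y) - Re (phi y)).
  by apply/funext => y; exact: ReB.
have EI : (fun y => Im (psi y - phi y)) = (fun y => Im (psi y) - Im (phi y)).
  by apply/funext => y; exact: ImB.
split; apply/eqP.
- apply: esym; apply: (etrans (ReB _ _)).
  apply: (etrans (congr2 (fun s t => s - t) (Re_op_BJ sr si x pr pi') (Re_op_BJ sr si x qr qi))).
  apply: (etrans (esym (bjcombB h0 sr si _ _ _ _ x pr pi' qr qi))).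
  apply: esym; apply: (etrans (Re_op_BJ sr si x dr di)).
  exact: (congr2 (fun u v => bjcomb hbar ar ai 1 (-1) (-1) (-1) u v x) ER EI).
- apply: esym; apply: (etrans (ImB _ _)).
  apply: (etrans (congr2 (fun s t => s - t) (Im_op_BJ sr si x pr pi') (Im_op_BJ sr si x qr qi))).
  apply: (etrans (esym (bjcombB h0 sr si _ _ _ _ x pi' pr qi qr))).
  apply: esym; apply: (etrans (Im_op_BJ sr si x dr di)).
  exact: (congr2 (fun u v => bjcomb hbar ar ai 1 1 1 (-1) u v x) EI ER).
Qed.

Theorem op_BJ_L2 : exists2 K : R, 0 <= K & forall psi, cdecaying psi ->
  [/\ measurable_fun setT (fun x => Re (op_BJ hbar a psi x)),
      measurable_fun setT (fun x => Im (op_BJ hbar a psi x)) &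
      (nsq (op_BJ hbar a psi) <= K%:E * nsq psi)%E].
Proof.
have [M [sr si]] := shubin_smooth_le (4 * n) rho0 sa.
have [K K0 HK] := bjcomb_L2 h0 sr si.
exists (K + K) => [|psi dpsi]; first exact: addr_ge0.
have [dr di] := dpsi.
have mr := decaying_meas dr; have mi := decaying_meas di.
have m1 : measurable_fun setT (fun x => Re (op_BJ hbar a psi x)).
  under eq_fun do rewrite (Re_op_BJ sr si _ dr di).
  exact: (measurable_bjcomb _ sr si).
have m2 : measurable_fun setT (fun x => Im (op_BJ hbar a psi x)).
  under eq_fun do rewrite (Im_op_BJ sr si _ dr di).
  exact: (measurable_bjcomb _ sr si).
split => //; rewrite nsqD// nsq_EFin// -EFinM.
have s1 : (1 : R) ^+ 2 <= 1 by rewrite expr1n.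
have s2 : (-1 : R) ^+ 2 <= 1 by rewrite sqrrN expr1n.
under eq_integral do rewrite (Re_op_BJ sr si _ dr di).
under [X in (_ + X <= _)%E]eq_integral do rewrite (Im_op_BJ sr si _ dr di).
rewrite mulrDl EFinD; apply: leeD; first exact: HK.
by rewrite addrC; exact: HK.
Qed.

End op_BJ_L2.

(** * Density of the Schwartz functions in L^2 *)

Section L2_closure.
Context d (T : measurableType d) (R : realType) (mu : {measure set T -> \bar R}).
Implicit Types f g h : T -> R.

Lemma measurable_sqr_EFin f : measurable_fun setT f ->
  measurable_fun setT (fun x => (f x ^+ 2)%:E).
Proof. by move=> mf; apply/measurable_EFinP; exact: measurable_funX. Qed.

Lemma integral_sqr_le2 f g h : measurable_fun setT f -> measurable_fun setT g ->
  measurable_fun setT h -> (forall x, `|f x| <= `|g x| + `|h x|) ->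
  (\int[mu]_x (f x ^+ 2)%:E <=
   2%:E * (\int[mu]_x (g x ^+ 2)%:E + \int[mu]_x (h x ^+ 2)%:E))%E.
Proof.
move=> mf mg mh fgh.
have ge0 (w : T -> R) x : (0 <= (w x ^+ 2)%:E)%E by rewrite lee_fin sqr_ge0.
have mgh : measurable_fun setT (fun x => (g x ^+ 2)%:E + (h x ^+ 2)%:E)%E.
  by apply: emeasurable_funD; exact: measurable_sqr_EFin.
rewrite -(ge0_integralD mu measurableT (fun x _ => ge0 g x) (measurable_sqr_EFin mg)
  (fun x _ => ge0 h x) (measurable_sqr_EFin mh)).
rewrite -ge0_integralZl//; last by move=> x _; rewrite adde_ge0.
apply: ge0_le_integral => //.
- exact: measurable_sqr_EFin.
- exact: measurable_funeM.
- move=> x _; rewrite -EFinD -EFinM lee_fin.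
  apply: (@le_trans _ _ ((`|g x| + `|h x|) ^+ 2)).
    by rewrite -(real_normK (num_real (f x))) lerXn2r ?nnegrE ?addr_ge0.
  rewrite -(real_normK (num_real (g x))) -(real_normK (num_real (h x))) -subr_ge0.
  have -> : 2 * (`|g x| ^+ 2 + `|h x| ^+ 2) - (`|g x| + `|h x|) ^+ 2 =
    (`|g x| - `|h x|) ^+ 2 by ring.
  exact: sqr_ge0.
Qed.

Variable S : (T -> R) -> Prop.
Hypothesis S_meas : forall f, S f -> measurable_fun setT f.
Hypothesis S0 : S (fun=> 0).
Hypothesis SD : forall f g, S f -> S g -> S (fun x => f x + g x).
Hypothesis SZ : forall (c : R) f, S f -> S (fun x => c * f x).

(** The closure of S for the L^2 distance. *)
Definition l2cl f : Prop := measurable_fun setT f /\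
  forall e, 0 < e -> exists2 h, S h & (\int[mu]_x ((f x - h x) ^+ 2)%:E <= e%:E)%E.

Lemma l2cl_base f : S f -> l2cl f.
Proof.
move=> Sf; split; first exact: S_meas.
move=> e e0; exists f => //; under eq_integral do rewrite subrr expr0n.
by rewrite integral0 lee_fin ltW.
Qed.

Lemma l2cl_lim f : measurable_fun setT f ->
  (forall e, 0 < e -> exists2 g, l2cl g & (\int[mu]_x ((f x - g x) ^+ 2)%:E <= e%:E)%E) ->
  l2cl f.
Proof.
move=> mf H; split => // e e0.
have e4 : 0 < e / 4 by rewrite divr_gt0.
have [g [mg Hg] fg] := H _ e4; have [h Sh gh] := Hg _ e4.
have mh := S_meas Sh.
exists h => //.
apply: le_trans (integral_sqr_le2 (measurable_funB mf mh) (measurable_funB mf mg)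
  (measurable_funB mg mh) _) _.
  move=> x /=; have -> : f x - h x = (f x - g x) + (g x - h x) by ring.
  exact: ler_normD.
apply: le_trans (_ : 2%:E * ((e / 4)%:E + (e / 4)%:E) <= _)%E.
  by apply: lee_wpmul2l => //; apply: leeD.
by rewrite -EFinD -EFinM lee_fin (_ : 2 * _ = e)//; field.
Qed.

Lemma l2clD f g : l2cl f -> l2cl g -> l2cl (fun x => f x + g x).
Proof.
move=> [mf Hf] [mg Hg]; split; first exact: measurable_funD.
move=> e e0; have e4 : 0 < e / 4 by rewrite divr_gt0.
have [f' Sf ff] := Hf _ e4; have [g' Sg gg] := Hg _ e4.
have mf' := S_meas Sf; have mg' := S_meas Sg.
exists (fun x => f' x + g' x); first exact: SD.
apply: le_trans (integral_sqr_le2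
  (measurable_funB (measurable_funD mf mg) (measurable_funD mf' mg'))
  (measurable_funB mf mf') (measurable_funB mg mg') _) _.
  by move=> x; rewrite /= opprD addrACA ler_normD.
apply: le_trans (_ : 2%:E * ((e / 4)%:E + (e / 4)%:E) <= _)%E.
  by apply: lee_wpmul2l => //; apply: leeD.
by rewrite -EFinD -EFinM lee_fin (_ : 2 * _ = e)//; field.
Qed.

Lemma l2clZ (c : R) f : l2cl f -> l2cl (fun x => c * f x).
Proof.
move=> [mf Hf]; split; first exact: measurable_funM.
move=> e e0; have c1 : 0 < c ^+ 2 + 1 by rewrite ltr_wpDl ?sqr_ge0.
have [f' Sf ff] := Hf _ (divr_gt0 e0 c1); have mf' := S_meas Sf.
exists (fun x => c * f' x); first exact: SZ.
under eq_integral do rewrite -mulrBr exprMn EFinM.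
rewrite ge0_integralZl//; last 3 first.
- by apply: measurable_sqr_EFin; exact: measurable_funB.
- by move=> x _; rewrite lee_fin sqr_ge0.
- by rewrite lee_fin sqr_ge0.
apply: le_trans (lee_wpmul2l _ ff) _; first by rewrite lee_fin sqr_ge0.
rewrite -EFinM lee_fin mulrA ler_pdivrMr// [leRHS]mulrC.
by rewrite ler_wpM2r ?lerDl// ltW.
Qed.

Lemma l2cl0 : l2cl (fun=> 0). Proof. exact: l2cl_base. Qed.

Lemma l2clB f g : l2cl f -> l2cl g -> l2cl (fun x => f x - g x).
Proof.
move=> lf lg; under eq_fun do rewrite -mulN1r.
by apply: l2clD => //; exact: l2clZ.
Qed.

Lemma l2cl_sum (I : Type) (r : seq I) (F : I -> T -> R) :
  (forall i, l2cl (F i)) -> l2cl (fun x => \sum_(i <- r) F i x).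
Proof.
move=> HF; elim: r => [|i r IH].
  by under eq_fun do rewrite big_nil; exact: l2cl0.
by under eq_fun do rewrite big_cons; exact: l2clD.
Qed.

(** Dominated convergence holds in L^2: (f - F k)^2 <= 4 g^2. *)
Lemma l2cl_dct (F : nat -> T -> R) f g : (forall k, l2cl (F k)) ->
  measurable_fun setT f -> mu.-integrable setT (EFin \o (fun x => g x ^+ 2)) ->
  (forall k x, `|F k x| <= g x) -> (forall x, F k x @[k --> \oo] --> f x) ->
  l2cl f.
Proof.
move=> HF mf ig Fg Ff.
have mF k : measurable_fun setT (F k) by case: (HF k).
have fg x : `|f x| <= g x.
  have cn : `|F k x| @[k --> \oo] --> `|f x| by exact: cvg_norm.
  rewrite -(cvg_lim _ cn)//; apply: limr_le; first exact: cvgP cn.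
  by apply: nearW => k.
have bd k x : `|(f x - F k x) ^+ 2| <= 4 * g x ^+ 2.
  have g0 : 0 <= g x by exact: le_trans (fg x).
  have -> : 4 * g x ^+ 2 = (g x + g x) ^+ 2 by ring.
  rewrite normrX lerXn2r ?nnegrE ?addr_ge0//.
  by apply: le_trans (ler_normB _ _) _; exact: lerD.
have m2 k : measurable_fun setT (fun x => (f x - F k x) ^+ 2).
  by apply: measurable_funX; exact: measurable_funB.
have i2 k := dom_integrable (m2 k) (integrable_scale 4 ig) (bd k).
have lim : \int[mu]_x (f x - F k x) ^+ 2 @[k --> \oo] --> \int[mu]_x (0 : R).
  apply: Rint_cvg m2 _ (integrable_scale 4 ig) bd _ => // x.
  rewrite [X in _ --> X](_ : _ = (f x - f x) ^+ 2); last by rewrite subrr expr0n.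
  under eq_fun do rewrite expr2; rewrite expr2.
  by apply: cvgM; apply: cvgB => //; exact: cvg_cst.
rewrite Rintegral_cst// mul0r in lim.
apply: l2cl_lim => // e e0.
have /cvgrPdist_le/(_ _ e0)[N _ HN] := lim.
exists (F N) => //; have := HN N (leqnn N); rewrite /= sub0r normrN => HN'.
by rewrite -EFin_Rint// lee_fin (le_trans (ler_norm _) HN').
Qed.

End L2_closure.

Section rapid.
Variables (R : realType) (n : nat).
Implicit Types f g : 'rV[R]_n -> R.

(** The real Schwartz functions, in terms of the weight wgt; compare
    rapid_schwartz and schwartz_rapid. *)
Definition rapid f : Prop := forall N m, exists2 C : R, 0 <= C &
  smooth_le N (fun x => C * wgt x ^+ m) f.

Lemma rapid_meas f : rapid f -> measurable_fun setT f.
Proof. by move=> /(_ 0 0)[C _ /smooth_le_meas]. Qed.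

Lemma rapid0 : rapid (fun=> 0).
Proof.
move=> N m; exists 0 => //; have := @smooth_le_cst R n N 0.
by apply: smooth_le_weight => x; rewrite normr0 mul0r.
Qed.

Lemma rapidD f g : rapid f -> rapid g -> rapid (fun x => f x + g x).
Proof.
move=> rf rg N m; have [C C0 sf] := rf N m; have [D D0 sg] := rg N m.
exists (C + D); first exact: addr_ge0.
by apply: smooth_le_weight (smooth_leD sf sg) => x; rewrite mulrDl.
Qed.

Lemma rapidZ (c : R) f : rapid f -> rapid (fun x => c * f x).
Proof.
move=> rf N m; have [C C0 sf] := rf N m.
exists (`|c| * C); first exact: mulr_ge0.
by apply: smooth_le_weight (smooth_leZ c sf) => x; rewrite mulrA.
Qed.

Lemma rapid_decaying f : rapid f -> decaying f.
Proof.
move=> rf; have [C C0 sf] := rf (2 * n)%N 2; exists C; last exact: (smooth_le_norm sf).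
apply: smooth_le_weight sf => x; rewrite ler_wpM2l// expr2 ler_piMl//.
  exact: wgt_ge0.
exact: wgt_le1.
Qed.

Lemma smooth_le_partials s N w f : smooth_le (size s + N) w f ->
  smooth_le N w (partials s f).
Proof.
elim: s N => [//|j s IH] N; have -> : (size (j :: s) + N = size s + N.+1)%N by rewrite addnS.
move=> H.
exact: (smooth_le_pd j (IH N.+1 H)).
Qed.

Lemma rapid_smooth f : rapid f -> smooth f.
Proof.
move=> rf s; have [C _ sf] := rf (size s + 1)%N 0.
have sp := smooth_le_partials sf; split; first exact: smooth_le_cont sp.
by move=> x j; have [] := smooth_le_derive j sp x.
Qed.

(** 1 + sum_j x_j^2 <= prod_j (1 + x_j^2). *)
Lemma japanese_wgt (x : 'rV[R]_n) : japanese x ^+ 2 * wgt x <= 1.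
Proof.
rewrite sqr_sqrtr ?addr_ge0 ?dotp_ge0// /wgt /prodf /dotp.
suff [] : [/\ 0 <= \sum_i x 0 i * x 0 i, 0 <= \prod_i cw (x 0 i) &
  (1 + \sum_i x 0 i * x 0 i) * \prod_i cw (x 0 i) <= 1] by [].
elim: (index_enum _) => [|i r [S0 P0 IH]]; first by rewrite !big_nil addr0 mulr1.
rewrite !big_cons; move: (\sum_(_ <- _) _) (\prod_(_ <- _) _) S0 P0 IH => S P S0 P0 IH.
have y0 : 0 <= x 0 i * x 0 i by rewrite -expr2 sqr_ge0.
have c0 := cw_ge0 (x 0 i); split; [exact: addr_ge0|exact: mulr_ge0|].
apply: le_trans IH; have := cwE (x 0 i); rewrite expr2 => E.
rewrite (_ : (1 + S) * P = cw (x 0 i) * (1 + x 0 i * x 0 i) * ((1 + S) * P)); last first.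
  by rewrite E mul1r.
rewrite -subr_ge0.
have -> : cw (x 0 i) * (1 + x 0 i * x 0 i) * ((1 + S) * P) -
   (1 + (x 0 i * x 0 i + S)) * (cw (x 0 i) * P) =
   cw (x 0 i) * P * (x 0 i * x 0 i * S) by ring.
by apply: mulr_ge0; exact: mulr_ge0.
Qed.

End rapid.

Section logistic.
Variable R : realType.

Definition logistic (t : R) : R := (1 + expR (- t))^-1.

Lemma logistic_den (t : R) : 0 < 1 + expR (- t).
Proof. by rewrite addr_gt0// expR_gt0. Qed.

Lemma logistic_ge0 (t : R) : 0 <= logistic t.
Proof. by rewrite invr_ge0 ltW// logistic_den. Qed.

Lemma logistic_le1 t : logistic t <= 1.
Proof. by rewrite invf_le1 ?logistic_den// lerDl expR_ge0. Qed.

Lemma logistic_le_exp t : logistic t <= expR t.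
Proof.
by rewrite -[expR t]invrK -expRN lef_pV2 ?posrE ?logistic_den ?expR_gt0// lerDr.
Qed.

Lemma logisticN t : 1 - logistic t = logistic (- t).
Proof.
have e0 := expR_gt0 t; have d := logistic_den (- t).
rewrite /logistic opprK in d *; rewrite expRN; field.
by rewrite !gt_eqF// addrC.
Qed.

Lemma is_derive_logistic (c d t : R) :
  is_derive t 1 (fun t => logistic (c * t + d))
    (c * (logistic (c * t + d) * (1 - logistic (c * t + d)))).
Proof.
have nz : 1 + expR (- (c * t + d)) != 0 by rewrite gt_eqF ?logistic_den.
have d1 : is_derive t 1 (fun t : R => 1 + expR (- (c * t + d)))
    (- c * expR (- (c * t + d))).
  by apply: is_derive_eq; rewrite /GRing.scale/= !add0r; ring.
have := @is_deriveV _ _ t _ _ nz d1 => d2; apply: (is_derive_eq d2).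
by rewrite /logistic /GRing.scale/=; field; exact: nz.
Qed.

Lemma continuous_logistic (c d : R) : continuous (fun t => logistic (c * t + d)).
Proof.
move=> t; have [D _] := is_derive_logistic c d t.
exact/differentiable_continuous/derivable1_diffP.
Qed.

End logistic.

Lemma rapid_schwartz (R : realType) n (f : 'rV[R]_n -> R[i]) :
  rapid (fun x => complex.Re (f x)) -> rapid (fun x => complex.Im (f x)) -> schwartz f.
Proof.
move=> rr ri; split; first by split; exact: rapid_smooth.
move=> N s; have [C C0 sC] := rr (size s + 0)%N N; have [D D0 sD] := ri (size s + 0)%N N.
have bC := smooth_le_norm (smooth_le_partials sC).
have bD := smooth_le_norm (smooth_le_partials sD).
exists (C + D) => x.
apply: le_trans (ler_wpM2l (exprn_ge0 _ _) (normc_le _)) _.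
  exact: le_trans ler01 (japanese_ge1 x).
have w0 : 0 <= wgt x ^+ N by rewrite exprn_ge0// wgt_ge0.
have j1 : 1 <= japanese x ^+ N by rewrite exprn_ege1// japanese_ge1.
have jw : japanese x ^+ N * wgt x ^+ N <= 1.
  rewrite -exprMn; apply: exprn_ile1.
    by rewrite mulr_ge0 ?wgt_ge0// (le_trans ler01)// japanese_ge1.
  apply: le_trans (japanese_wgt x); rewrite ler_wpM2r ?wgt_ge0//.
  by rewrite expr2 ler_peMl ?japanese_ge1// (le_trans ler01)// japanese_ge1.
apply: le_trans (_ : japanese x ^+ N * ((C + D) * wgt x ^+ N) <= _).
  rewrite ler_wpM2l ?(le_trans ler01)// mulrDl.
  by apply: lerD; [exact: bC|exact: bD].
by rewrite mulrCA ler_piMr// addr_ge0.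
Qed.

Section bumps.
Variable R : realType.

Lemma exp_le_cw (c : R) m : 0 < c -> exists2 D : R, 0 <= D &
  forall t, expR (- (c * `|t|)) <= D * cw t ^+ m.
Proof.
elim: m c => [|m IH] c c0.
  exists 1 => // t; rewrite mul1r expr0 expR_le1 oppr_le0.
  by rewrite mulr_ge0// ltW.
have c2 : 0 < c / 2 by rewrite divr_gt0.
have [D D0 HD] := IH _ c2.
have c4 : 0 < c / 4 by rewrite divr_gt0.
exists ((1 + (c / 4) ^- 2) * D) => [|t].
  by rewrite mulr_ge0// addr_ge0// invr_ge0 sqr_ge0.
have -> : expR (- (c * `|t|)) = expR (- (c / 2 * `|t|)) * expR (- (c / 2 * `|t|)).
  by rewrite -expRD; congr expR; field.
rewrite (exprS (cw t)) [leRHS]mulrACA; apply: ler_pM; rewrite ?expR_ge0//.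
have e1 : 1 + (c / 4 * `|t|) ^+ 2 <= expR (c / 2 * `|t|).
  have -> : c / 2 * `|t| = c / 4 * `|t| + c / 4 * `|t| by field.
  have u0 : 0 <= c / 4 * `|t| by rewrite mulr_ge0// ltW.
  move: (c / 4 * `|t|) u0 => u u0; have u1 : 0 <= 1 + u by rewrite addr_ge0.
  rewrite expRD; apply: le_trans (ler_pM u1 u1 (expR_ge1Dx _) (expR_ge1Dx _)).
  rewrite -subr_ge0 (_ : _ - _ = 2 * u); last by ring.
  by rewrite mulr_ge0.
rewrite expRN /cw ler_pdivlMr ?cw_den_gt0// mulrC ler_pdivrMr ?expR_gt0//.
apply: le_trans (ler_wpM2l _ e1); last by rewrite addr_ge0// invr_ge0 sqr_ge0.
move: (c / 4) c4 => k k0; rewrite exprMn (real_normK (num_real t)).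
have k2 : 0 < k ^+ 2 by rewrite exprn_gt0.
rewrite mulrDl mul1r mulrDr mulr1 mulKf ?gt_eqF//.
rewrite -subr_ge0 (_ : _ - _ = k ^+ 2 * t ^+ 2 + k ^- 2); last by ring.
by apply: addr_ge0; [apply: mulr_ge0|rewrite invr_ge0]; exact: sqr_ge0.
Qed.

Section algebra.
Variables (c d1 d2 : R).
Let L1 (t : R) := logistic (c * t + d1).
Let L2 (t : R) := logistic (- c * t + d2).

(** The product of an increasing and a decreasing logistic step. Its derivatives
    are polynomials in the two steps, so that it is as tame as a Gaussian, while
    suitable parameters make it converge to the indicator of an interval. *)
Definition lbump (t : R) : R := L1 t * L2 t.

(** As the derivative of a logistic step L is proportional to L (1 - L), this
    class is closed under differentiation. *)
Inductive bump_alg : (R -> R) -> Prop :=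
| bump_alg_base : bump_alg lbump
| bump_alg_L1 f : bump_alg f -> bump_alg (fun t => L1 t * f t)
| bump_alg_L2 f : bump_alg f -> bump_alg (fun t => L2 t * f t)
| bump_alg_add f g : bump_alg f -> bump_alg g -> bump_alg (fun t => f t + g t)
| bump_alg_scale (a : R) f : bump_alg f -> bump_alg (fun t => a * f t).

Lemma lbump_ge0 t : 0 <= lbump t.
Proof. by rewrite mulr_ge0 ?logistic_ge0. Qed.

Lemma bump_alg_closed f : bump_alg f ->
  [/\ continuous f, exists2 C : R, 0 <= C & forall t, `|f t| <= C * lbump t
     & exists2 f', bump_alg f' & forall t : R, is_derive t 1 f (f' t)].
Proof.
have cL1 : continuous L1 by exact: continuous_logistic.
have cL2 : continuous L2 by exact: continuous_logistic.
have dL1 (t : R) : is_derive t 1 L1 (c * (L1 t * (1 - L1 t))) by exact: is_derive_logistic.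
have dL2 (t : R) : is_derive t 1 L2 (- c * (L2 t * (1 - L2 t))) by exact: is_derive_logistic.
have n1 (t : R) : `|L1 t| <= 1 by rewrite ger0_norm ?logistic_ge0// logistic_le1.
have n2 (t : R) : `|L2 t| <= 1 by rewrite ger0_norm ?logistic_ge0// logistic_le1.
elim=> {f} [|f Gf [cf [C C0 bf] [f' Gf' df]]|f Gf [cf [C C0 bf] [f' Gf' df]]
  |f g Gf [cf [C C0 bf] [f' Gf' df]] Gg [cg [D D0 bg] [g' Gg' dg]]
  |a f Gf [cf [C C0 bf] [f' Gf' df]]].
- split; first exact: contM.
    by exists 1 => // t; rewrite mul1r ger0_norm// lbump_ge0.
  exists (fun t => - c * (L1 t * lbump t) + c * (L2 t * lbump t)).
    by apply: bump_alg_add; apply: bump_alg_scale;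
      [apply: bump_alg_L1|apply: bump_alg_L2]; exact: bump_alg_base.
  move=> t; apply: (is_derive_eq (is_deriveM (dL1 t) (dL2 t))).
  by rewrite /lbump /GRing.scale/=; ring.
- split; first exact: contM.
    by exists C => // t; rewrite normrM (le_trans _ (bf t))// ler_piMl.
  exists (fun t => c * (L1 t * f t) + (- c * (L1 t * (L1 t * f t)) + L1 t * f' t)).
    apply: bump_alg_add; first exact/bump_alg_scale/bump_alg_L1.
    apply: bump_alg_add; last exact: bump_alg_L1.
    exact/bump_alg_scale/bump_alg_L1/bump_alg_L1.
  move=> t; apply: (is_derive_eq (is_deriveM (dL1 t) (df t))).
  by rewrite /GRing.scale/=; ring.
- split; first exact: contM.
    by exists C => // t; rewrite normrM (le_trans _ (bf t))// ler_piMl.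
  exists (fun t => - c * (L2 t * f t) + (c * (L2 t * (L2 t * f t)) + L2 t * f' t)).
    apply: bump_alg_add; first exact/bump_alg_scale/bump_alg_L2.
    apply: bump_alg_add; last exact: bump_alg_L2.
    exact/bump_alg_scale/bump_alg_L2/bump_alg_L2.
  move=> t; apply: (is_derive_eq (is_deriveM (dL2 t) (df t))).
  by rewrite /GRing.scale/=; ring.
- split; first exact: contD.
    exists (C + D); first exact: addr_ge0.
    by move=> t; rewrite mulrDl (le_trans (ler_normD _ _))// lerD.
  exists (fun t => f' t + g' t); first exact: bump_alg_add.
  by move=> t; exact: (is_deriveD (df t) (dg t)).
- split; first exact: contZ.
    exists (`|a| * C); first exact: mulr_ge0.
    by move=> t; rewrite normrM -mulrA ler_wpM2l.
  exists (fun t => a * f' t); first exact: bump_alg_scale.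
  by move=> t; exact: (is_deriveZ a (df t)).
Qed.

(** One of the two steps decays like exp (- c |t|) on each half-line. *)
Lemma lbump_le (r : R) : `|d1| <= r -> `|d2| <= r -> 0 <= c -> forall t,
  lbump t <= expR r * expR (- (c * `|t|)).
Proof.
move=> r1 r2 c0 t; rewrite -expRD.
have d1r := le_trans (ler_norm _) r1; have d2r := le_trans (ler_norm _) r2.
have [t0|t0] := leP 0 t.
  apply: le_trans (_ : L2 t <= _).
    by rewrite ler_piMl ?logistic_ge0 ?logistic_le1.
  apply: le_trans (logistic_le_exp _) _; rewrite ler_expR (ger0_norm t0) mulNr addrC.
  by rewrite lerD2r.
apply: le_trans (_ : L1 t <= _).
  by rewrite ler_piMr ?logistic_ge0 ?logistic_le1.
apply: le_trans (logistic_le_exp _) _; rewrite ler_expR (ltr0_norm t0) mulrN opprK addrC.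
by rewrite lerD2r.
Qed.

Lemma smooth_le_lbump N m : 0 < c -> exists2 C : R, 0 <= C &
  smooth_le N (fun v : 'rV[R]_1 => C * cw (v 0 0) ^+ m) (fun v => lbump (v 0 0)).
Proof.
move=> c0; have [C C0 sC] := smooth_le_line bump_alg_closed N bump_alg_base.
have [D D0 HD] := exp_le_cw m c0.
exists (C * (expR (`|d1| + `|d2|) * D)); first by rewrite !mulr_ge0// expR_ge0.
apply: smooth_le_weight sC => v; rewrite -mulrA; apply: ler_wpM2l => //.
apply: le_trans (@lbump_le (`|d1| + `|d2|) _ _ _ _) _.
- by rewrite lerDl.
- by rewrite lerDr.
- exact: ltW.
- by rewrite -mulrA; apply: ler_wpM2l => //; exact: expR_ge0.
Qed.

End algebra.
End bumps.

Lemma rapid_prod_lbump (R : realType) n (c : R) (d1 d2 : 'I_n -> R) : 0 < c ->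
  rapid (prodf (fun i => lbump c (d1 i) (d2 i))).
Proof.
move=> c0 N m.
have [C C0 H] : exists2 C : R, 0 <= C & forall i, smooth_le N
    (fun v : 'rV[R]_1 => C * cw (v 0 0) ^+ m) (fun v => lbump c (d1 i) (d2 i) (v 0 0)).
  have /boolp.choice[C HC] : forall i, exists C : R, 0 <= C /\ smooth_le N
     (fun v : 'rV[R]_1 => C * cw (v 0 0) ^+ m) (fun v => lbump c (d1 i) (d2 i) (v 0 0)).
    by move=> i; have [C C0 sC] := smooth_le_lbump (d1 i) (d2 i) N m c0; exists C.
  exists (\sum_i C i) => [|i]; first by apply: sumr_ge0 => i _; have [] := HC i.
  apply: smooth_le_weight (HC i).2 => v; rewrite ler_wpM2r ?exprn_ge0 ?cw_ge0//.
  by rewrite (bigD1 i)//= lerDl; apply: sumr_ge0 => j _; have [] := HC j.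
exists (2 ^+ (N * size (index_enum 'I_n)) * C ^+ n); first by rewrite mulr_ge0 ?exprn_ge0.
have H' i := @smooth_le_coord R n N i (fun t => C * cw t ^+ m) _ (H i).
apply: smooth_le_weight (smooth_le_prod _ H') => x.
by rewrite big_split/= prodr_const card_ord mulrA /wgt /prodf -prodrXl.
Qed.

Section density.
Variables (R : realType) (n : nat).
Notation V := 'rV[R]_n.
Notation mu := (lebesgue_rV R n).
Notation rcl := (@l2cl _ V R mu (@rapid R n)).

Let rm := @rapid_meas R n.
Let rcl_base f := @l2cl_base _ V R mu _ rm f.
Let rclZ c f := @l2clZ _ V R mu _ rm (@rapidZ R n) c f.
Let rclB f g := @l2clB _ V R mu _ rm (@rapidD R n) (@rapidZ R n) f g.
Let rcl_sum I r F := @l2cl_sum _ V R mu _ rm (@rapid0 R n) (@rapidD R n) I r F.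
Let rcl_dct F f g := @l2cl_dct _ V R mu _ rm F f g.

Lemma rapidM (f g : V -> R) : rapid f -> rapid g -> rapid (fun x => f x * g x).
Proof.
move=> rf rg N m; have [C C0 sf] := rf N m; have [D D0 sg] := rg N 0.
exists (2 ^+ N * (C * D)); first by rewrite !mulr_ge0// exprn_ge0.
apply: smooth_le_weight (smooth_leM sf sg) => x.
by rewrite expr0 mulr1 -!mulrA [D * _]mulrC.
Qed.

Lemma rapid_sqr f : rapid f -> mu.-integrable setT (EFin \o (fun x => f x ^+ 2)).
Proof. by move=> rf; exact: decaying_sqr (rapid_decaying rf). Qed.

Let w : V -> R := prodf (fun i => lbump 1 0 0).

Let rw : rapid w. Proof. exact: (rapid_prod_lbump (fun=> 0) (fun=> 0) ltr01). Qed.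

Let w_gt0 x : 0 < w x.
Proof.
by apply: prodr_gt0 => i _; rewrite /lbump /logistic mulr_gt0// invr_gt0 logistic_den.
Qed.

Definition box (a b : V) : set V := [set v | forall i, a 0 i <= v 0 i <= b 0 i].

Lemma cvg_logistic_step (s : R) :
  logistic ((k.+1%:R : R) ^+ 2 * s + k.+1%:R) @[k --> \oo] --> ((0 <= s)%R%:R : R).
Proof.
have le_inv (k : nat) : expR (- k.+1%:R) <= k.+1%:R^-1 :> R.
  rewrite expRN lef_pV2 ?posrE ?expR_gt0//.
  by apply: le_trans (expR_ge1Dx _); rewrite lerDr.
have H : \forall k \near \oo,
    `|((0 <= s)%R%:R : R) - logistic ((k.+1%:R : R) ^+ 2 * s + k.+1%:R)| <= k.+1%:R^-1.
  have [s0|s0] := leP 0 s.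
    apply: nearW => k; rewrite logisticN ger0_norm ?logistic_ge0//.
    apply: le_trans (logistic_le_exp _) (le_trans _ (le_inv k)).
    by rewrite ler_expR lerN2 lerDr mulr_ge0// exprn_ge0.
  near=> k; rewrite sub0r normrN ger0_norm ?logistic_ge0//.
  apply: le_trans (logistic_le_exp _) (le_trans _ (le_inv k)); rewrite ler_expR.
  (* for such k the argument of the step is at most - (k + 1) *)
  have kk : 2 / - s <= k%:R by near: k; exact: nbhs_infty_ger.
  have k1 : (k%:R : R) <= k.+1%:R by rewrite ler_nat.
  have : 2 / - s <= k.+1%:R by exact: le_trans k1.
  rewrite ler_pdivrMr ?oppr_gt0// => k2.
  have k0 : 0 < k.+1%:R :> R by rewrite ltr0n.
  rewrite expr2 -mulrA -[X in _ + X]mulr1 -mulrDr -[leRHS]mulrN1 ler_pM2l//.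
  by move: k2; rewrite mulrN; lra.
apply/cvgrPdist_le => e e0.
have /cvgrPdist_le/(_ _ e0) := @cvg_harmonic R.
apply: filterS2 H => k Hk; rewrite sub0r normrN ger0_norm ?invr_ge0// => He.
exact: le_trans He.
Unshelve. all: by end_near. Qed.

Lemma cvg_prod_seq (I : Type) (r : seq I) (u : I -> nat -> R) (l : I -> R) :
  (forall i, u i k @[k --> \oo] --> l i) ->
  \prod_(i <- r) u i k @[k --> \oo] --> \prod_(i <- r) l i.
Proof.
move=> ul; elim: r => [|i r IH].
  by rewrite big_nil; under eq_fun do rewrite big_nil; exact: cvg_cst.
by rewrite big_cons; under eq_fun do rewrite big_cons; apply: cvgM.
Qed.

Lemma measurable_box a b : measurable (box a b).
Proof.
rewrite (_ : box a b = \bigcap_(i in [set: 'I_n]) (coord_rV i @^-1` `[a 0 i, b 0 i])).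
  apply: fin_bigcap_measurable => // i _.
  by rewrite -[X in measurable X]setTI; exact: measurable_coord_rV.
apply/seteqP; split => v /= H i; move: (H i); rewrite ?in_itv//=.
by move/(_ I).
Qed.

(** Each factor of the approximants is a smooth step of width 1/k^2, shifted by
    1/k so that it converges to the indicator of the closed half-line at the end
    point too. *)
Lemma box_closure a b : rcl (fun x => \1_(box a b) x * w x).
Proof.
pose p (k : nat) i := lbump ((k.+1%:R : R) ^+ 2) (k.+1%:R - k.+1%:R ^+ 2 * a 0 i)
  (k.+1%:R + k.+1%:R ^+ 2 * b 0 i).
have p0 k i t : 0 <= p k i t by exact: lbump_ge0.
have p1 k i t : p k i t <= 1.
  by rewrite mulr_ile1 ?logistic_ge0 ?logistic_le1.
apply: (@rcl_dct (fun k x => prodf (p k) x * w x) _ w).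
- move=> k; apply: rcl_base.
  apply: rapidM => //; apply: rapid_prod_lbump.
  by rewrite exprn_gt0.
- apply: measurable_funM; last exact: rapid_meas.
  by apply: measurable_indic; exact: measurable_box.
- exact: rapid_sqr.
- move=> k x; rewrite normrM (gtr0_norm (w_gt0 x)) ler_piMl ?(ltW (w_gt0 x))//.
  rewrite ger0_norm; first by apply: prodr_ile1 => i _; rewrite p0 p1.
  by apply: prodf_ge0.
- move=> x; apply: cvgM; last exact: cvg_cst.
  have -> : \1_(box a b) x = \prod_i (((0 <= x 0 i - a 0 i)%R%:R * (0 <= b 0 i - x 0 i)%R%:R) : R).
    rewrite indicE; have [xb|xb] := boolP (x \in box a b).
      rewrite big1// => i _; move: xb; rewrite inE => /(_ i)/andP[ax bx].
      by rewrite !subr_ge0 ax bx mulr1.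
    have [j] : exists j, ~~ (a 0 j <= x 0 j <= b 0 j).
      move: xb; rewrite notin_setE /box/= => /existsNP[j Hj]; exists j; exact/negP.
    rewrite negb_and => Hj; rewrite (bigD1 j)//= !subr_ge0.
    by case/orP: Hj => /negbTE ->; rewrite ?mul0r ?mulr0 ?mul0r.
  apply: cvg_prod_seq => i; apply: cvgM.
    rewrite (_ : (fun k : nat => _) =
      fun k => logistic ((k.+1%:R : R) ^+ 2 * (x 0 i - a 0 i) + k.+1%:R)).
      exact: cvg_logistic_step.
    by apply/funext => k; congr logistic; ring.
  rewrite (_ : (fun k : nat => _) =
    fun k => logistic ((k.+1%:R : R) ^+ 2 * (b 0 i - x 0 i) + k.+1%:R)).
    exact: cvg_logistic_step.
  by apply/funext => k; congr logistic; ring.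
Qed.

Let boxes : set (set V) := [set A | exists a b, A = box a b].

Lemma measurable_boxes : @measurable _ V = <<s boxes >>.
Proof.
apply/seteqP; split; last first.
  apply: smallest_sub; first exact: sigma_algebra_measurable.
  by move=> _ [a [b ->]]; exact: measurable_box.
apply: smallest_sub; first exact: smallest_sigma_algebra.
rewrite -bigcup_seq; apply: bigcup_sub => i _ A [B mB <-].
suff mc : measurable_fun [set: g_sigma_algebraType boxes]
    (fun v : g_sigma_algebraType boxes => (v : V) 0 i) by exact: (mc measurableT B mB).
apply: (measurability _ (RGenCInfty.measurableE R)).
move=> _ [_ [x ->] <-]; rewrite setTI.
pose a (m : nat) : V := \row_j if j == i then x else - m%:R.
pose b (m : nat) : V := const_mx m%:R.
rewrite (_ : _ @^-1` _ = \bigcup_m box (a m) (b m)).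
  by apply: bigcupT_measurable => m; apply: sub_sigma_algebra; exists (a m), (b m).
apply/seteqP; split => v.
  rewrite /= in_itv/= andbT => xv.
  exists (Num.truncn (\sum_j `|v 0 j|)).+1 => // j; rewrite !mxE.
  have vj : `|v 0 j| <= (Num.truncn (\sum_j `|v 0 j|)).+1%:R.
    apply: (@le_trans _ _ (\sum_j `|v 0 j|)); last exact/ltW/truncnS_gt.
    by rewrite (bigD1 j)//= lerDl; apply: sumr_ge0.
  move: vj; rewrite ler_norml => /andP[v1 v2].
  by rewrite v2 andbT; case: eqP => [->|_].
by move=> [m _ /(_ i)]; rewrite !mxE eqxx /= in_itv/= andbT => /andP[].
Qed.

Lemma boxI : setI_closed boxes.
Proof.
move=> _ _ [a [b ->]] [c [d ->]].
exists (\row_j Num.max (a 0 j) (c 0 j)), (\row_j Num.min (b 0 j) (d 0 j)).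
apply/seteqP; split => v.
  by move=> [H1 H2] j; rewrite !mxE ge_max le_min; case/andP: (H1 j) => -> ->;
    case/andP: (H2 j) => -> ->.
move=> H; split => j; move: (H j); rewrite !mxE ge_max le_min.
  by move=> /andP[/andP[-> _] /andP[-> _]].
by move=> /andP[/andP[_ ->] /andP[_ ->]].
Qed.

(** The monotone class theorem. Multiplication by the fixed Schwartz function w
    keeps all functions in L^2, so that complements and the whole space cause no
    trouble. *)
Lemma measurable_closure (S : set V) : measurable S -> rcl (fun x => \1_S x * w x).
Proof.
rewrite measurable_boxes; move: S.
apply: (dynkin_induction measurable_boxes boxI (P := fun S => rcl (fun x => \1_S x * w x))).
- by under eq_fun do rewrite indicE mem_setT mul1r; exact: rcl_base.
- by move=> _ [a [b ->]]; exact: box_closure.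
- move=> S mS HS; rewrite (_ : (fun x => _) = fun x => w x - \1_S x * w x).
    by apply: rclB => //; exact: rcl_base.
  apply/funext => x; rewrite !indicE in_setC.
  by case: (x \in S); rewrite /= ?mul1r ?mul0r ?subrr ?subr0.
- move=> F mF tF HF.
  apply: (@rcl_dct (fun k x => \sum_(j < k) (\1_(F j) x * w x)) _ w).
  + by move=> k; exact: rcl_sum.
  + apply: measurable_funM; last exact: rm.
    by apply: measurable_indic; exact: bigcupT_measurable.
  + exact: rapid_sqr.
  + move=> k x; rewrite -mulr_suml normrM (gtr0_norm (w_gt0 x)) ler_piMl ?(ltW (w_gt0 x))//.
    rewrite ger0_norm; last by apply: sumr_ge0.
    have [[j xj]|nx] := pselect (exists j : 'I_k, F j x); last first.
      by rewrite big1// => j _; rewrite indicE memNset// => xj; apply: nx; exists j.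
    rewrite (bigD1 j)//= big1 ?addr0; first by rewrite indicE; case: (_ \in _).
    move=> l lj; rewrite indicE memNset// => xl; move/eqP: lj; apply; apply/val_inj.
    by move/trivIsetP : tF => /(_ l j Logic.I Logic.I) tF; apply: contrapT => /eqP/tF E;
      have : (F l `&` F j) x by []; rewrite E.
  + move=> x; have [[j _ xj]|nx] := pselect ((\bigcup_k F k) x); last first.
      rewrite indicE memNset// mul0r.
      rewrite (_ : (fun k : nat => _) = fun=> 0); first exact: cvg_cst.
      apply/funext => k; rewrite big1// => j _; rewrite indicE memNset ?mul0r// => xj.
      by apply: nx; exists j.
    rewrite indicE mem_set; last by exists j.
    apply: cvg_near_cst; exists j.+1 => // k /= jk.
    rewrite (bigD1 (Ordinal jk))//= indicE mem_set//.
    rewrite big1 ?addr0// => l lj; rewrite indicE memNset ?mul0r// => xl.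
    move/eqP: lj; apply; apply/val_inj => /=.
    by move/trivIsetP : tF => /(_ l j Logic.I Logic.I) tF; apply: contrapT => /eqP/tF E;
      have : (F l `&` F j) x by []; rewrite E.
Qed.

Import HBNNSimple.

(** Simple functions approximate f / w, hence their products with w approximate
    f. *)
Lemma ge0_L2_closure (f : V -> R) : measurable_fun setT f -> (forall x, 0 <= f x) ->
  mu.-integrable setT (EFin \o (fun x => f x ^+ 2)) -> rcl f.
Proof.
move=> mf f0 if2.
have winv x : 0 <= (w x)^-1 by rewrite invr_ge0 ltW.
pose h x := (f x * (w x)^-1)%:E.
have mh : measurable_fun setT h.
  apply/measurable_EFinP; apply: measurable_funM => //.
  have c2 : continuous (fun x => (w x)^-1).
    move=> x; apply: (continuous_comp (f := w) (g := fun t => t^-1)).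
      by have [C _ /smooth_le_cont] := rw 0 0; apply.
    by apply: cvgV => //; rewrite gt_eqF.
  exact: continuous_rV_measurable.
have h0 x : setT x -> (0 <= h x)%E by move=> _; rewrite lee_fin mulr_ge0.
pose g := nnsfun_approx measurableT mh.
have gh k (x : V) : g k x <= f x * (w x)^-1.
  rewrite -lee_fin /g nnsfun_approxE; exact: le_approx.
apply: (@rcl_dct (fun k (x : V) => g k x * w x) _ f) => //.
- move=> k; rewrite (_ : (fun x => _) = fun x => \sum_(y <- finmap.enum_fset (fset_set (range (g k))))
      (y * (\1_(g k @^-1` [set y]) x * w x))).
    by apply: rcl_sum => y; apply: rclZ; apply: measurable_closure.
  apply/funext => x; rewrite fimfunE fsbig_finite//= mulr_suml.
  by apply: eq_bigr => y _; rewrite mulrA.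
- move=> k x; rewrite normrM (gtr0_norm (w_gt0 x)) ger0_norm//.
  by rewrite -ler_pdivlMr.
- move=> x; rewrite [X in _ --> X](_ : _ = f x * (w x)^-1 * w x); last first.
    by rewrite mulfVK// lt0r_neq0.
  apply: cvgM; last exact: cvg_cst.
  have /fine_cvgP[_] := cvg_nnsfun_approx measurableT mh h0 (x := x) Logic.I.
  exact.
Qed.

(** Positive and negative parts. *)
Theorem rapid_dense (f : V -> R) : measurable_fun setT f ->
  mu.-integrable setT (EFin \o (fun x => f x ^+ 2)) -> rcl f.
Proof.
move=> mf if2.
have part (g : V -> R) : measurable_fun setT g -> (forall x, `|g x| = `|f x|) ->
    rcl (fun x => Num.max (g x) 0).
  move=> mg gf.
  have mm : measurable_fun setT (fun x => Num.max (g x) 0).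
    exact: measurable_maxr.
  apply: ge0_L2_closure => //; first by move=> x; rewrite le_max lexx orbT.
  apply: dom_integrable if2 _; first exact: measurable_funX.
  move=> x; rewrite normrX -(real_normK (num_real (f x))) -gf.
  rewrite lerXn2r ?nnegrE//; case: (leP 0 (g x)) => // g0.
  by rewrite normr0.
rewrite (_ : f = fun x => Num.max (f x) 0 - Num.max (- f x) 0).
  apply: rclB; first exact: part.
  by apply: part => [|x]; [exact: measurableT_comp|rewrite normrN].
apply/funext => x; case: (leP 0 (f x)) => f0.
  by rewrite max_r ?oppr_le0// subr0.
by rewrite max_l ?oppr_ge0 ?ltW// sub0r opprK.
Qed.

End density.

(** * Extension to tempered distributions *)

Section weak_limits.
Variables (R : realType) (n : nat).
Notation C := ((R[i])^o).
Notation functional := {ptws (schwartzFun R n) -> (R[i])^o}.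

Lemma cvg_normc (z : nat -> C) (l : C) :
  (forall e : R, 0 < e -> \forall k \near \oo, normc ((l : R[i]) - (z k : R[i])) <= e) ->
  z k @[k --> \oo] --> l.
Proof.
move=> H; apply/cvgrPdist_le => e e0.
have [r [-> r0]] : exists r : R, e = r%:C /\ 0 < r.
  move: e0; case: e => x y; rewrite ltcE /= => /andP[/eqP -> x0].
  by exists x.
have := H _ r0; apply: filterS => k Hk.
by rewrite /Num.norm/= lecR.
Qed.

(** The topology of pointwise convergence is the initial one for the
    evaluations. *)
Lemma ptws_cvg (v : nat -> functional) (u : functional) :
  (forall phi, (v k phi : C) @[k --> \oo] --> (u phi : C)) -> v @ \oo --> u.
Proof.
move=> vu; apply/cvg_sup => phi A; rewrite nbhsE => -[B [[B' oB' <-] Bu] BA].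
have : nbhs (u phi : C) B' by exact: open_nbhs_nbhs.
move=> /(vu phi)[N _ HN]; exists N => // k Nk; apply: BA; exact: HN.
Qed.

Lemma ptws_cvg_eval (v : nat -> functional) (u : functional) phi :
  v @ \oo --> u -> (v k phi : C) @[k --> \oo] --> (u phi : C).
Proof.
move=> /cvg_sup/(_ phi) vu A nA; apply: (vu (fun g => A (g phi))).
exact: (@initial_continuous _ _ (fun g : functional => (g phi : C)) u A nA).
Qed.

(** Continuity on the subspace A along a sequence that stays in A. *)
Lemma ptws_seq_continuous (A : set (functional)) (T : functional -> functional)
    (v : nat -> functional) (u : functional) :
  {within A, continuous T} -> A u -> (forall k, A (v k)) ->
  (forall phi, (v k phi : C) @[k --> \oo] --> (u phi : C)) ->
  forall phi, (T (v k) phi : C) @[k --> \oo] --> (T u phi : C).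
Proof.
move=> cT Au Av vu.
have Tv : T (v k) @[k --> \oo] --> T u.
  have vw : v @ \oo --> within A (nbhs u).
    have vn : v @ \oo --> u by exact: ptws_cvg.
    by move=> B BA; have [N _ HN] := vn _ BA; exists N => // k Nk; exact: HN.
  apply: cvg_trans (_ : T @ within A (nbhs u) --> T u).
    by apply: cvg_trans (cvg_app T vw) => B; apply.
  by have := cT u; rewrite /continuous_at /= nbhs_subspace_in.
by move=> phi; exact: (@ptws_cvg_eval (fun k => T (v k)) (T u) phi Tv).
Qed.

Lemma cvgC_unique (z : nat -> C) (l l' : C) :
  z k @[k --> \oo] --> l -> z k @[k --> \oo] --> l' -> l = l'.
Proof. by move=> zl zl'; apply: (cvg_unique (@norm_hausdorff _ C) zl zl'). Qed.

End weak_limits.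

Section L2_limit.
Context d (T : measurableType d) (R : realType) (mu : {measure set T -> \bar R}).

Lemma sum_half_le (N : nat) : \sum_(0 <= k < N) (2 ^- k : R) <= 2.
Proof.
suff : \sum_(0 <= k < N) (2 ^- k : R) + 2 * 2 ^- N <= 2.
  by apply: le_trans; rewrite lerDl mulr_ge0// invr_ge0 exprn_ge0.
elim: N => [|N IH]; first by rewrite big_nil add0r expr0 invr1 mulr1.
apply: le_trans IH; rewrite big_nat_recr//= -addrA lerD2l exprS.
by rewrite invfM mulrA divff// mul1r; lra.
Qed.

Variables (h : nat -> T -> R) (C : R).
Hypothesis mh : forall k, measurable_fun setT (h k).
Hypothesis hC : forall k l, (k <= l)%N ->
  (\int[mu]_x ((h l x - h k x) ^+ 2)%:E <= (C * (2 ^- k) ^+ 2)%:E)%E.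

Let df k x := h k.+1 x - h k x.
Let G x := (\sum_(0 <= k <oo) (2 ^+ k * df k x ^+ 2)%:E)%E.

Let t0 k x : (0 <= (2 ^+ k * df k x ^+ 2)%:E)%E.
Proof. by rewrite lee_fin mulr_ge0 ?sqr_ge0// exprn_ge0. Qed.

Let mt k : measurable_fun setT (fun x => (2 ^+ k * df k x ^+ 2)%:E).
Proof.
apply/measurable_EFinP; apply: measurable_funM => //; apply: measurable_funX.
exact: measurable_funB.
Qed.

Let mG : measurable_fun setT G.
Proof. by apply: ge0_emeasurable_sum => k // x _ _; exact: t0. Qed.

Let intG : (\int[mu]_x G x < +oo)%E.
Proof.
rewrite integral_nneseries//.
have C0 : 0 <= C.
  have := hC (leqnn 0); rewrite expr0 invr1 expr1n mulr1 -lee_fin; apply: le_trans.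
  by apply: integral_ge0 => x _; rewrite lee_fin sqr_ge0.
apply: (@le_lt_trans _ _ (C * 2)%:E); last exact: ltry.
apply: lime_le.
  by apply: is_cvg_nneseries => k _ _; apply: integral_ge0 => x _; exact: t0.
apply: nearW => N; apply: (@le_trans _ _ (\sum_(0 <= k < N) (C * 2 ^- k)%:E)%E).
  apply: lee_sum => k _; under eq_integral do rewrite EFinM.
  have md : measurable_fun setT (fun x => (df k x ^+ 2)%:E).
    by apply: measurable_sqr_EFin; exact: measurable_funB.
  have d0 x : setT x -> (0 <= (df k x ^+ 2)%:E)%E by rewrite lee_fin sqr_ge0.
  have k0 : (0 <= (2 ^+ k : R)%:E)%E by rewrite lee_fin exprn_ge0.
  rewrite (ge0_integralZl mu measurableT md d0 k0).
  apply: le_trans (lee_wpmul2l _ (hC (leqnSn k))) _; first by rewrite lee_fin exprn_ge0.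
  rewrite -EFinM lee_fin (_ : 2 ^+ k * _ = C * 2 ^- k)//.
  have : 2 ^+ k != 0 :> R by rewrite expf_neq0.
  by move: (2 ^+ k) => a a0; field.
by rewrite sumEFin lee_fin -mulr_sumr ler_wpM2l// sum_half_le.
Qed.

Let cvg_h x : G x \is a fin_num -> cvgn (h ^~ x).
Proof.
move=> Gx; pose u k : R^o := df k x.
have cu : cvgn (series u).
  apply: normed_cvg; apply: nondecreasing_is_cvgn.
    by apply: nondecreasing_series => k _ _; exact: normr_ge0.
  exists (fine (G x) + 2) => _ [N _ <-]; rewrite /series/=.
  apply: (@le_trans _ _ (\sum_(0 <= k < N) (2 ^+ k * df k x ^+ 2 + 2 ^- k))).
    apply: ler_sum => k _; rewrite /u; move: (df k x) => y.
    have a0 : 0 < 2 ^+ k :> R by rewrite exprn_gt0.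
    move: (2 ^+ k : R) a0 => a a0.
    have na : a != 0 by rewrite gt_eqF.
    rewrite -(ler_pM2l a0) -subr_ge0 -(real_normK (num_real y)).
    have -> : a * (a * `|y| ^+ 2 + a^-1) - a * `|y| = (a * `|y| - 2^-1) ^+ 2 + 3 / 4.
      by field.
    by rewrite addr_ge0 ?sqr_ge0.
  rewrite big_split/= lerD ?sum_half_le// -lee_fin fineK// -sumEFin.
  by apply: nneseries_lim_ge => k _ _; exact: t0.
have -> : h ^~ x = fun k => h 0 x + series u k.
  apply/funext => k; rewrite /series/= telescope_sumr//; ring.
by apply: is_cvgD => //; exact: is_cvg_cst.
Qed.

(** A sequence that is Cauchy in L^2 at a geometric rate converges almost
    everywhere, because the increments satisfy |d| <= 2^k d^2 + 2^-k and sum_k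
    2^k d_k^2 has a finite integral. Fatou's lemma transfers the bounds to the
    limit. *)
Lemma L2_limit (D : R) : (forall k, \int[mu]_x (h k x ^+ 2)%:E <= D%:E)%E ->
  exists2 g : T -> R, measurable_fun setT g &
    (forall k, \int[mu]_x ((g x - h k x) ^+ 2)%:E <= (C * (2 ^- k) ^+ 2)%:E)%E /\
    (\int[mu]_x (g x ^+ 2)%:E <= D%:E)%E.
Proof.
move=> hD.
(* the set of convergence, up to a null set *)
pose A := [set x | G x \is a fin_num].
have mA : measurable A.
  by have := emeasurable_fin_num measurableT mG; rewrite setTI.
have aeA : {ae mu, forall x, A x}.
  have iG : mu.-integrable setT G.
    apply/integrableP; split => //.
    rewrite (eq_integral G)// => x _; rewrite gee0_abs//.
    by apply: nneseries_ge0 => k _ _; exact: t0.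
  by apply: filterS (integrable_ae measurableT iG) => x; exact.
pose g x := lim ((\1_A x * h k x) @[k --> \oo]).
have cg x : \1_A x * h k x @[k --> \oo] --> g x.
  have [xA|xA] := pselect (A x).
    rewrite /g (_ : (fun k => \1_A x * h k x) = h ^~ x); first exact: cvg_h.
    by apply/funext => k; rewrite indicE mem_set// mul1r.
  rewrite /g (_ : (fun k => \1_A x * h k x) = fun=> 0); last first.
    by apply/funext => k; rewrite indicE memNset// mul0r.
  have c0 : (0 : R) @[_ --> \oo] --> (0 : R) by exact: cvg_cst.
  by rewrite (cvg_lim _ c0).
have m1h k : measurable_fun setT (fun x => \1_A x * h k x).
  by apply: measurable_funM => //; exact: measurable_indic.
have mg : measurable_fun setT g.
  by apply: (measurable_fun_cvg m1h) => x _; exact: cg.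
have gA x : \1_A x * g x = g x.
  rewrite indicE; have [xA|xA] := boolP (x \in A); first by rewrite mul1r.
  rewrite mul0r; apply: (cvg_unique _ _ (cg x)) => //.
  rewrite (_ : (fun k => \1_A x * h k x) = fun=> 0); first exact: cvg_cst.
  by apply/funext => k; rewrite indicE (negbTE xA) mul0r.
have ind_le (f : T -> R) B : measurable_fun setT f -> (\int[mu]_x (f x ^+ 2)%:E <= B)%E ->
    (\int[mu]_x ((\1_A x * f x) ^+ 2)%:E <= B)%E.
  move=> mf; apply: le_trans; apply: ge0_le_integral => //.
  - by move=> x _; rewrite lee_fin sqr_ge0.
  - apply: measurable_sqr_EFin; apply: measurable_funM => //; exact: measurable_indic.
  - exact: measurable_sqr_EFin.
  - move=> x _; rewrite lee_fin indicE; case: (x \in A); rewrite ?mul1r// mul0r.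
    by rewrite expr0n sqr_ge0.
exists g => //; split => [k|]; last first.
  apply: (fatou_le (f_ := fun k x => (\1_A x * h k x) ^+ 2)).
  - by move=> k; exact: measurable_funX.
  - by move=> k x; exact: sqr_ge0.
  - by move=> x; under eq_fun do rewrite expr2; rewrite expr2; apply: cvgM.
  - by move=> k; exact: ind_le.
rewrite (ge0_ae_eq_integral (g := fun x => ((\1_A x * (g x - h k x)) ^+ 2)%:E))//.
- apply: (fatou_le (f_ := fun l x => (\1_A x * (h (l + k)%N x - h k x)) ^+ 2)).
  + move=> l; apply: measurable_funX; apply: measurable_funM.
      exact: measurable_indic.
    exact: measurable_funB.
  + by move=> l x; exact: sqr_ge0.
  + move=> x; under eq_fun do rewrite expr2; rewrite expr2.
    have c1 : \1_A x * (h (l + k)%N x - h k x) @[l --> \oo] --> \1_A x * (g x - h k x).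
      rewrite mulrBr gA; under eq_fun do rewrite mulrBr.
      apply: cvgB; last exact: cvg_cst.
      by rewrite (cvg_shiftn k (fun l => \1_A x * h l x)).
    exact: cvgM.
  + move=> l; apply: ind_le; first exact: measurable_funB.
    by apply: hC; exact: leq_addl.
- by apply: measurable_sqr_EFin; exact: measurable_funB.
- apply: measurable_sqr_EFin; apply: measurable_funM; first exact: measurable_indic.
  exact: measurable_funB.
- by move=> x _; rewrite lee_fin sqr_ge0.
- by move=> x _; rewrite lee_fin sqr_ge0.
- by apply: filterS aeA => x Ax _; rewrite indicE mem_set// mul1r.
Qed.

End L2_limit.

Section pairing.
Variables (R : realType) (n : nat).
Local Notation Re := complex.Re.
Local Notation Im := complex.Im.
Notation V := 'rV[R]_n.
Notation mu := (lebesgue_rV R n).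
Implicit Types f g phi : V -> R[i].

Lemma Re_sub (z w : R[i]) : Re (z - w) = Re z - Re w. Proof. by case: z; case: w. Qed.
Lemma Im_sub (z w : R[i]) : Im (z - w) = Im z - Im w. Proof. by case: z; case: w. Qed.

Definition cmeas f := measurable_fun setT (fun x => Re (f x)) /\
  measurable_fun setT (fun x => Im (f x)).

Lemma cmeasB f g : cmeas f -> cmeas g -> cmeas (fun x => f x - g x).
Proof.
move=> [fr fi] [gr gi]; split.
  by under eq_fun do rewrite Re_sub; exact: measurable_funB.
by under eq_fun do rewrite Im_sub; exact: measurable_funB.
Qed.

Lemma cmeasM f g : cmeas f -> cmeas g -> cmeas (fun x => f x * g x).
Proof.
move=> [fr fi] [gr gi]; split.
  by under eq_fun do rewrite Re_mul; apply: measurable_funB; exact: measurable_funM.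
by under eq_fun do rewrite Im_mul; apply: measurable_funD; exact: measurable_funM.
Qed.

Lemma in_L2_cmeas f : in_L2 f -> cmeas f.
Proof. by move=> /in_L2P[]. Qed.

Lemma nsq_le2 f g h : cmeas f -> cmeas g -> cmeas h ->
  (forall x, f x = g x - h x) -> (nsq f <= 2%:E * (nsq g + nsq h))%E.
Proof.
move=> [fr fi] [gr gi] [hr hi] E; rewrite (nsqD fr fi) (nsqD gr gi) (nsqD hr hi).
have Hr : forall x, `|Re (f x)| <= `|Re (g x)| + `|Re (h x)|.
  by move=> x; rewrite E Re_sub; exact: ler_normB.
have Hi : forall x, `|Im (f x)| <= `|Im (g x)| + `|Im (h x)|.
  by move=> x; rewrite E Im_sub; exact: ler_normB.
apply: le_trans (leeD (integral_sqr_le2 mu fr gr hr Hr) (integral_sqr_le2 mu fi gi hi Hi)) _.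
have p (u : V -> R) : (0 <= \int[mu]_x (u x ^+ 2)%:E)%E.
  by apply: integral_ge0 => x _; rewrite lee_fin sqr_ge0.
have H (a b c e : \bar R) : (0 <= a -> 0 <= b -> 0 <= c -> 0 <= e ->
    2%:E * (a + b) + 2%:E * (c + e) = 2%:E * (a + c + (b + e)))%E.
  by move=> a0 b0 c0 e0; rewrite (addeACA a c b e) [RHS]ge0_muleDr// adde_ge0.
by rewrite (H _ _ _ _ (p _) (p _) (p _) (p _)).
Qed.

Lemma schwartz_rapid f : schwartz f ->
  rapid (fun x => Re (f x)) /\ rapid (fun x => Im (f x)).
Proof.
by move=> sf; split => N m; have [C C0 [sr si]] := schwartz_smooth_le N m sf; exists C.
Qed.

Lemma schwartz_cdecaying f : schwartz f -> cdecaying f.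
Proof. by move=> /schwartz_rapid[rr ri]; split; exact: rapid_decaying. Qed.

Lemma schwartz_in_L2 f : schwartz f -> in_L2 f.
Proof.
move=> /[dup] sf /schwartz_rapid[rr ri]; apply/in_L2P; split.
- exact: rapid_meas.
- exact: rapid_meas.
- by rewrite (nsq_EFin (schwartz_cdecaying sf)) ltry.
Qed.

Lemma in_L2_sqr f : in_L2 f ->
  mu.-integrable setT (EFin \o (fun x => normc (f x) ^+ 2)) /\
  nsq f = (\int[mu]_x (normc (f x) ^+ 2))%:E.
Proof.
move=> /in_L2P[mr mi fin].
have E : (fun x => normc (f x) ^+ 2) = (fun x => Re (f x) ^+ 2 + Im (f x) ^+ 2).
  by apply/funext => x; rewrite normc_sqr.
have i2 : mu.-integrable setT (EFin \o (fun x => normc (f x) ^+ 2)).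
  apply/integrableP; split.
    by rewrite E; apply/measurable_EFinP; apply: measurable_funD; exact: measurable_funX.
  apply: le_lt_trans fin; rewrite /nsq (eq_integral (fun x => (normc (f x) ^+ 2)%:E)).
    by under [leRHS]eq_integral do rewrite -normc_sqr.
  by move=> x _ /=; rewrite ger0_norm ?sqr_ge0.
split => //; rewrite EFin_Rint// /nsq; apply: eq_integral => x _.
by rewrite normc_sqr.
Qed.

Lemma in_L2B f g : in_L2 f -> in_L2 g -> in_L2 (fun x => f x - g x).
Proof.
move=> lf lg; have mfg := cmeasB (in_L2_cmeas lf) (in_L2_cmeas lg).
apply/in_L2P; split; [exact: mfg.1|exact: mfg.2|].
apply: le_lt_trans (nsq_le2 mfg (in_L2_cmeas lf) (in_L2_cmeas lg) _) _ => //.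
by have [_ ->] := in_L2_sqr lf; have [_ ->] := in_L2_sqr lg; rewrite -EFinD -EFinM ltry.
Qed.

Lemma mul_le_sqr (t a b : R) : 0 < t -> a * b <= t * a ^+ 2 + t^-1 * b ^+ 2.
Proof.
move=> t0; rewrite -(ler_pM2l t0) -subr_ge0.
have tn : t != 0 by rewrite gt_eqF.
have -> : t * (t * a ^+ 2 + t^-1 * b ^+ 2) - t * (a * b) =
  (t * a - b / 2) ^+ 2 + 3 / 4 * b ^+ 2 by field.
apply: addr_ge0; first exact: sqr_ge0.
by apply: mulr_ge0; [rewrite divr_ge0|exact: sqr_ge0].
Qed.

Lemma integrable_pair f phi : in_L2 f -> in_L2 phi ->
  mu.-integrable setT (EFin \o (fun x => Re (f x * phi x))) /\
  mu.-integrable setT (EFin \o (fun x => Im (f x * phi x))).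
Proof.
move=> lf lp; have [mr mi] := cmeasM (in_L2_cmeas lf) (in_L2_cmeas lp).
have [i1 _] := in_L2_sqr lf; have [i2 _] := in_L2_sqr lp.
have bd x : normc (f x * phi x) <= normc (f x) ^+ 2 + normc (phi x) ^+ 2.
  rewrite ComplexField.Normc.normcM.
  by have := mul_le_sqr (normc (f x)) (normc (phi x)) ltr01; rewrite invr1 !mul1r.
split; apply: dom_integrable (integrable_add i1 i2) _ => // x; apply: le_trans (bd x).
  exact: Re_le_normc.
exact: Im_le_normc.
Qed.

(** Cauchy-Schwarz, in the form of a weighted arithmetic-geometric inequality;
    the weight t lets the term with f be small when f is. *)
Lemma pair_le f phi (t : R) : 0 < t -> in_L2 f -> in_L2 phi ->
  normc (cintegral mu setT (fun x => f x * phi x)) <=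
  2 * (t * \int[mu]_x (normc (f x) ^+ 2) + t^-1 * \int[mu]_x (normc (phi x) ^+ 2)).
Proof.
move=> t0 lf lp; have [mr mi] := cmeasM (in_L2_cmeas lf) (in_L2_cmeas lp).
have [i1 _] := in_L2_sqr lf; have [i2 _] := in_L2_sqr lp.
have j1 := integrable_scale t i1; have j2 := integrable_scale t^-1 i2.
have ij := integrable_add j1 j2.
have E : \int[mu]_x (t * normc (f x) ^+ 2 + t^-1 * normc (phi x) ^+ 2) =
    t * \int[mu]_x (normc (f x) ^+ 2) + t^-1 * \int[mu]_x (normc (phi x) ^+ 2).
  by rewrite (RintegralD measurableT j1 j2) !RintegralZl.
have bd x : normc (f x * phi x) <= t * normc (f x) ^+ 2 + t^-1 * normc (phi x) ^+ 2.
  by rewrite ComplexField.Normc.normcM; exact: mul_le_sqr.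
apply: le_trans (normc_le _) _; rewrite mulr_natl mulr2n -E; apply: lerD => /=.
  by apply: dom_Rintegral ij _ => // x; exact: le_trans (Re_le_normc _) (bd x).
by apply: dom_Rintegral ij _ => // x; exact: le_trans (Im_le_normc _) (bd x).
Qed.

Lemma cintegral_lin (c : R[i]) f phi psi : in_L2 f -> in_L2 phi -> in_L2 psi ->
  cintegral mu setT (fun x => f x * (c * phi x + psi x)) =
  c * cintegral mu setT (fun x => f x * phi x) + cintegral mu setT (fun x => f x * psi x).
Proof.
move=> lf lp ls; have [r1 i1] := integrable_pair lf lp; have [r2 i2] := integrable_pair lf ls.
have E x : f x * (c * phi x + psi x) = c * (f x * phi x) + f x * psi x by ring.
have ReD (z w : R[i]) : Re (z + w) = Re z + Re w by case: z; case: w.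
have ImD (z w : R[i]) : Im (z + w) = Im z + Im w by case: z; case: w.
apply/eqP; rewrite eq_complex; apply/andP; split; apply/eqP.
- rewrite [RHS]ReD [X in X + _]Re_mul /=.
  transitivity (\int[mu]_x (Re c * Re (f x * phi x) + - Im c * Im (f x * phi x) +
      1 * Re (f x * psi x) + 0 * Re (f x * psi x))).
    apply: eq_Rintegral => x _; rewrite E ReD [Re (c * _)]Re_mul; ring.
  by rewrite Rint_lin4//; ring.
- rewrite [RHS]ImD [X in X + _]Im_mul /=.
  transitivity (\int[mu]_x (Re c * Im (f x * phi x) + Im c * Re (f x * phi x) +
      1 * Im (f x * psi x) + 0 * Im (f x * psi x))).
    apply: eq_Rintegral => x _; rewrite E ImD [Im (c * _)]Im_mul; ring.
  by rewrite Rint_lin4//; ring.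
Qed.

End pairing.

Section extension.
Variables (R : realType) (n : nat).
Local Notation Re := complex.Re.
Local Notation Im := complex.Im.
Notation V := 'rV[R]_n.
Notation mu := (lebesgue_rV R n).
Notation C := ((R[i])^o).

Lemma schwartz_approx (f : V -> R[i]) (e : R) : in_L2 f -> 0 < e ->
  exists psi : schwartzFun R n, (nsq (fun x => (f x - psi x)%R) <= e%:E)%E.
Proof.
move=> lf e0; have [fr fi] := in_L2_cmeas lf.
have [i2 _] := in_L2_sqr lf.
have ir : mu.-integrable setT (EFin \o (fun x => Re (f x) ^+ 2)).
  apply: dom_integrable i2 _ => [|x]; first exact: measurable_funX.
  by rewrite ger0_norm ?sqr_ge0// normc_sqr lerDl sqr_ge0.
have ii : mu.-integrable setT (EFin \o (fun x => Im (f x) ^+ 2)).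
  apply: dom_integrable i2 _ => [|x]; first exact: measurable_funX.
  by rewrite ger0_norm ?sqr_ge0// normc_sqr lerDr sqr_ge0.
have e2 : 0 < e / 2 by rewrite divr_gt0.
have [u ru Hu] := (rapid_dense fr ir).2 _ e2.
have [v rv Hv] := (rapid_dense fi ii).2 _ e2.
have sw : schwartz (fun x => u x +i* v x) by exact: rapid_schwartz.
exists (SchwartzFun sw).
rewrite nsqD; first last.
- by under eq_fun do rewrite Im_sub; apply: measurable_funB => //; exact: rapid_meas.
- by under eq_fun do rewrite Re_sub; apply: measurable_funB => //; exact: rapid_meas.
rewrite [e](_ : e = e / 2 + e / 2); last by field.
rewrite EFinD; apply: leeD.
  by under eq_integral do rewrite Re_sub.
by under eq_integral do rewrite Im_sub.
Qed.

(** The error is proportional to the squared norm of f, so that all bounds below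
    remain multiples of this norm. *)
Lemma schwartz_approx_seq (f : V -> R[i]) : in_L2 f ->
  exists psi : nat -> schwartzFun R n, forall k,
    (nsq (fun x => (f x - psi k x)%R) <= (\int[mu]_x (normc (f x) ^+ 2) * (2 ^- k) ^+ 2)%:E)%E.
Proof.
move=> lf; have [_ nf] := in_L2_sqr lf.
set N := \int[mu]_x (normc (f x) ^+ 2) in nf *.
have N0 : 0 <= N by apply: Rintegral_ge0 => x _; exact: sqr_ge0.
(* if f vanishes almost everywhere, psi = 0 is the only possible choice *)
have [N0'|Np] := eqVneq N 0.
  have s0 : schwartz (fun _ : V => 0 +i* 0 : R[i]).
    by apply: rapid_schwartz; exact: rapid0.
  exists (fun=> SchwartzFun s0) => k.
  have -> : nsq (fun x => (f x - SchwartzFun s0 x)%R) = nsq f.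
    by apply: eq_integral => x _; rewrite Re_sub Im_sub /= !subr0.
  by rewrite nf N0' mul0r.
have H k : exists psi : schwartzFun R n,
    (nsq (fun x => (f x - psi x)%R) <= (N * (2 ^- k) ^+ 2)%:E)%E.
  apply: schwartz_approx => //; apply: mulr_gt0; first by rewrite lt0r Np.
  by rewrite exprn_gt0// invr_gt0 exprn_gt0.
have [psi Hpsi] := boolp.choice H; by exists psi.
Qed.

(** pair_le with the weight t = 2^k. *)
Lemma regular_dist_cvg (g : V -> R[i]) (f : nat -> V -> R[i]) (B : R) :
  in_L2 g -> (forall k, in_L2 (f k)) ->
  (forall k, nsq (fun x => (g x - f k x)%R) <= (B * (2 ^- k) ^+ 2)%:E)%E ->
  forall phi : schwartzFun R n,
  (regular_dist (f k) phi : C) @[k --> \oo] --> (regular_dist g phi : C).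
Proof.
move=> lg lf H phi; apply: cvg_normc => e e0.
have lp := schwartz_in_L2 (sfunP phi).
set P := \int[mu]_x (normc (phi x) ^+ 2).
have P0 : 0 <= P by apply: Rintegral_ge0 => x _; exact: sqr_ge0.
have bd k : normc (regular_dist g phi - regular_dist (f k) phi) <= 2 * (B + P) * 2 ^- k.
  have lgf := in_L2B lg (lf k); have [_ E] := in_L2_sqr lgf.
  have := H k; rewrite E lee_fin => Hk.
  have -> : regular_dist g phi - regular_dist (f k) phi =
      cintegral mu setT (fun x => (g x - f k x) * phi x).
    have sw (u : V -> R[i]) : cintegral mu setT (fun x => u x * phi x) =
        cintegral mu setT (fun x => phi x * u x).
      by congr cintegral; apply/funext => x; rewrite mulrC.
    rewrite /regular_dist (sw g) (sw (f k)) (sw (fun x => g x - f k x)).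
    have -> : (fun x => phi x * (g x - f k x)) = (fun x => phi x * (-1 * f k x + g x)).
      by apply/funext => x; ring.
    by rewrite (cintegral_lin (-1) lp (lf k) lg) mulN1r addrC.
  have a0 : 0 < (2 ^+ k : R) by rewrite exprn_gt0.
  apply: le_trans (pair_le a0 lgf lp) _; rewrite -mulrA ler_pM2l// mulrDl.
  apply: lerD; last by rewrite mulrC.
  apply: le_trans (ler_wpM2l (ltW a0) Hk) _.
  have : 2 ^+ k != 0 :> R by rewrite gt_eqF.
  by move: (2 ^+ k) => a an; rewrite (_ : a * _ = B / a)//; field.
have K0 : 0 <= B + P.
  have := le_trans (normc_ge0 _) (bd 0).
  by rewrite expr0 invr1 mulr1 pmulr_rge0.
have d0 : 0 < e / (2 * (B + P) + 1) by rewrite divr_gt0// ltr_wpDl// mulr_ge0.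
have /cvgrPdist_le/(_ _ d0) := @cvg_harmonic R.
apply: filterS => k; rewrite sub0r normrN ger0_norm ?invr_ge0// => Hk.
apply: le_trans (bd k) _.
apply: (@le_trans _ _ ((2 * (B + P) + 1) * k.+1%:R^-1)).
  apply: ler_pM; rewrite ?mulr_ge0 ?invr_ge0 ?exprn_ge0 ?lerDl//.
  rewrite lef_pV2 ?posrE ?exprn_gt0// -natrX ler_nat.
  exact: ltn_expl.
by rewrite mulrC -ler_pdivlMr// ltr_wpDl// mulr_ge0.
Qed.

(** The seminorm with 2 n powers of the bracket dominates phi by a multiple of
    wgt, which is square integrable. *)
Lemma regular_dist_tempered (f : V -> R[i]) : in_L2 f -> tempered (regular_dist f).
Proof.
move=> lf; split.
  move=> c phi psi h E; rewrite /regular_dist.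
  rewrite -(cintegral_lin c lf (schwartz_in_L2 (sfunP phi)) (schwartz_in_L2 (sfunP psi))).
  by congr cintegral; apply/funext => x; rewrite E.
have [i2 _] := in_L2_sqr lf; have [iw _] := wgt_int R n.
set N := \int[mu]_x (normc (f x) ^+ 2); set W := \int[mu]_x wgt x.
exists (2 * n)%N, (2 * (N + W)) => phi M HM.
have lp := schwartz_in_L2 (sfunP phi).
have [mr mi] := cmeasM (in_L2_cmeas lf) (in_L2_cmeas lp).
have M0 : 0 <= M.
  apply: le_trans (HM [::] 0 _) => //; rewrite mulr_ge0 ?normc_ge0// exprn_ge0//.
  exact: le_trans ler01 (japanese_ge1 _).
have phiw x : normc (phi x) <= M * wgt x.
  have := HM [::] x isT; rewrite /cpartials/= => Hx.
  have {}Hx : japanese x ^+ (2 * n) * normc (phi x) <= M.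
    by apply: le_trans Hx; case: (phi x).
  apply: le_trans (ler_wpM2r (wgt_ge0 x) Hx); rewrite mulrAC.
  by rewrite ler_peMl ?normc_ge0// wgt_japanese.
have bd x : normc (f x * phi x) <= M * (normc (f x) ^+ 2 + wgt x).
  rewrite ComplexField.Normc.normcM.
  apply: le_trans (ler_wpM2l (normc_ge0 _) (phiw x)) _; rewrite mulrCA ler_wpM2l//.
  have := mul_le_sqr (normc (f x)) (wgt x) ltr01; rewrite invr1 !mul1r.
  move=> /le_trans; apply; rewrite lerD2l expr2 ler_piMl ?wgt_ge0//.
  exact: wgt_le1.
have ij := integrable_scale M (integrable_add i2 iw).
have E : \int[mu]_x (M * (normc (f x) ^+ 2 + wgt x)) = M * (N + W).
  by rewrite RintegralZl ?(RintegralD measurableT i2 iw)//; exact: integrable_add.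
apply: le_trans (normc_le _) _.
have -> : 2 * (N + W) * M = M * (N + W) + M * (N + W) by ring.
rewrite -E; apply: lerD => /=.
  by apply: dom_Rintegral ij _ => // x; exact: le_trans (Re_le_normc _) (bd x).
by apply: dom_Rintegral ij _ => // x; exact: le_trans (Im_le_normc _) (bd x).
Qed.

Variables (A : (V -> R[i]) -> V -> R[i]) (K : R).
Hypothesis K0 : 0 <= K.
Hypothesis AB : forall (psi phi : schwartzFun R n) x,
  A (fun y => psi y - phi y) x = A psi x - A phi x.
Hypothesis AL2 : forall u : V -> R[i], cdecaying u ->
  cmeas (A u) /\ (nsq (A u) <= K%:E * nsq u)%E.

Let cdecB (psi phi : schwartzFun R n) : cdecaying (fun y => psi y - phi y).
Proof.
have [pr pi'] := schwartz_cdecaying (sfunP psi).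
have [qr qi] := schwartz_cdecaying (sfunP phi); split.
  by under eq_fun do rewrite Re_sub; exact: decayingB.
by under eq_fun do rewrite Im_sub; exact: decayingB.
Qed.

Lemma operator_in_L2 (psi : schwartzFun R n) : in_L2 (A psi).
Proof.
have dp := schwartz_cdecaying (sfunP psi).
have [[mr mi] H] := AL2 dp; apply/in_L2P; split => //.
by apply: le_lt_trans H _; rewrite nsq_EFin// -EFinM ltry.
Qed.

(** A bounded operator on the dense subspace of Schwartz functions has its
    weakly continuous extension given by L^2 limits. The constant 8 K is K times
    4, from |psi_k|^2 <= 4 |f|^2, times 2, from the separate treatment of real
    and imaginary parts. *)
Theorem extension_L2 (T : {ptws (schwartzFun R n) -> C} -> {ptws (schwartzFun R n) -> C})
    (f : V -> R[i]) :
  tempered_extension A T -> in_L2 f ->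
  exists g, [/\ in_L2 g, T (regular_dist f) = regular_dist g &
    (nsq g <= (8 * K)%:E * nsq f)%E].
Proof.
move=> [_ _ cT TA] lf; have [psi Hpsi] := schwartz_approx_seq lf.
have [_ nf] := in_L2_sqr lf.
set N := \int[mu]_x (normc (f x) ^+ 2) in nf Hpsi *.
have N0 : 0 <= N by apply: Rintegral_ge0 => x _; exact: sqr_ge0.
have lpsi k := schwartz_in_L2 (sfunP (psi k)).
pose q (k : nat) : R := (2 ^- k) ^+ 2.
have q1 k : q k <= 1.
  by rewrite exprn_ile1 ?invr_ge0 ?exprn_ge0// invf_le1 ?exprn_gt0// exprn_ege1// ler1n.
have qle k l : (k <= l)%N -> q l <= q k.
  move=> kl; rewrite lerXn2r ?nnegrE ?invr_ge0 ?exprn_ge0//.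
  by rewrite lef_pV2 ?posrE ?exprn_gt0// ler_weXn2l// ler1n.
have H1 k l : (k <= l)%N -> (nsq (fun x => (psi l x - psi k x)%R) <= (4 * N * q k)%:E)%E.
  move=> kl; have mfk := cmeasB (in_L2_cmeas lf) (in_L2_cmeas (lpsi k)).
  have mfl := cmeasB (in_L2_cmeas lf) (in_L2_cmeas (lpsi l)).
  apply: le_trans (nsq_le2 (cmeasB (in_L2_cmeas (lpsi l)) (in_L2_cmeas (lpsi k))) mfk mfl _) _.
    by move=> x; ring.
  apply: le_trans (lee_wpmul2l _ (leeD (Hpsi k) (Hpsi l))) _ => //.
  have -> : 4 * N * q k = 2 * (N * q k + N * q k) by ring.
  by rewrite -EFinD -EFinM lee_fin ler_pM2l// lerD2l ler_wpM2l// qle.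
have H2 k : (nsq (psi k) <= (4 * N)%:E)%E.
  have mfk := cmeasB (in_L2_cmeas lf) (in_L2_cmeas (lpsi k)).
  apply: le_trans (nsq_le2 (in_L2_cmeas (lpsi k)) (in_L2_cmeas lf) mfk _) _.
    by move=> x; ring.
  rewrite nf; apply: le_trans (lee_wpmul2l _ (leeD (lexx _) (Hpsi k))) _ => //.
  have -> : 4 * N = 2 * (N + N) by ring.
  by rewrite -EFinD -EFinM lee_fin ler_pM2l// lerD2l ler_piMr// q1.
pose h k := A (psi k); have lh k : in_L2 (h k) by exact: operator_in_L2.
have mh k := in_L2_cmeas (lh k).
have D1 k l : (k <= l)%N -> (nsq (fun x => (h l x - h k x)%R) <= (K * (4 * N) * q k)%:E)%E.
  move=> kl; have [_ H] := AL2 (cdecB (psi l) (psi k)).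
  have E : nsq (fun x => (h l x - h k x)%R) = nsq (A (fun y => (psi l y - psi k y)%R)).
    by congr nsq; apply/funext => x; rewrite AB.
  rewrite E; apply: le_trans H _; rewrite -mulrA EFinM.
  by apply: lee_wpmul2l; [rewrite lee_fin|exact: H1].
have D2 k : (nsq (h k) <= (K * (4 * N))%:E)%E.
  have [_ H] := AL2 (schwartz_cdecaying (sfunP (psi k))).
  by apply: le_trans H _; rewrite EFinM; apply: lee_wpmul2l; [rewrite lee_fin|exact: H2].
have leR (u : V -> R[i]) B : cmeas u -> (nsq u <= B)%E ->
    (\int[mu]_x (Re (u x) ^+ 2)%:E <= B)%E.
  move=> [ur ui]; rewrite (nsqD ur ui); apply: le_trans; rewrite leeDl//.
  by apply: integral_ge0 => x _; rewrite lee_fin sqr_ge0.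
have leI (u : V -> R[i]) B : cmeas u -> (nsq u <= B)%E ->
    (\int[mu]_x (Im (u x) ^+ 2)%:E <= B)%E.
  move=> [ur ui]; rewrite (nsqD ur ui); apply: le_trans; rewrite leeDr//.
  by apply: integral_ge0 => x _; rewrite lee_fin sqr_ge0.
have [gr mgr [Hr1 Hr2]] : exists2 g : V -> R, measurable_fun setT g &
    (forall k, \int[mu]_x ((g x - Re (h k x))%R ^+ 2)%:E <= (K * (4 * N) * q k)%:E)%E /\
    (\int[mu]_x (g x ^+ 2)%:E <= (K * (4 * N))%:E)%E.
  apply: L2_limit => [k|k l kl|k]; first exact: (mh k).1.
    rewrite (eq_integral (fun x => (Re (h l x - h k x) ^+ 2)%:E)).
      exact: (leR _ _ (cmeasB (mh l) (mh k)) (D1 _ _ kl)).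
    by move=> x _; rewrite Re_sub.
  exact: leR (D2 k).
have [gi mgi [Hi1 Hi2]] : exists2 g : V -> R, measurable_fun setT g &
    (forall k, \int[mu]_x ((g x - Im (h k x)) ^+ 2)%:E <= (K * (4 * N) * q k)%:E)%E /\
    (\int[mu]_x (g x ^+ 2)%:E <= (K * (4 * N))%:E)%E.
  apply: L2_limit => [k|k l kl|k]; first exact: (mh k).2.
    rewrite (eq_integral (fun x => (Im (h l x - h k x) ^+ 2)%:E)).
      exact: (leI _ _ (cmeasB (mh l) (mh k)) (D1 _ _ kl)).
    by move=> x _; rewrite Im_sub.
  exact: leI (D2 k).
pose g x := gr x +i* gi x.
have mg : cmeas g by split.
have ng : (nsq g <= (8 * K)%:E * nsq f)%E.
  rewrite nf (nsqD mg.1 mg.2); apply: le_trans (leeD Hr2 Hi2) _.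
  by rewrite -EFinD -EFinM lee_fin (_ : 8 * K * N = K * (4 * N) + K * (4 * N))//; ring.
have lg : in_L2 g.
  apply/in_L2P; split; [exact: mg.1|exact: mg.2|].
  by apply: le_lt_trans ng _; rewrite nf -EFinM ltry.
have gh k : (nsq (fun x => (g x - h k x)%R) <= (2 * (K * (4 * N)) * q k)%:E)%E.
  have mgh := cmeasB mg (mh k).
  rewrite (nsqD mgh.1 mgh.2).
  have -> : 2 * (K * (4 * N)) * q k = K * (4 * N) * q k + K * (4 * N) * q k by ring.
  rewrite EFinD; apply: leeD.
    by under eq_integral do rewrite Re_sub.
  by under eq_integral do rewrite Im_sub.
exists g; split => //; apply/funext => phi.
have Tf := regular_dist_tempered lf.
have c1 := @ptws_seq_continuous R n _ T (fun k => regular_dist (psi k)) (regular_dist f)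
  cT Tf (fun k => regular_dist_tempered (lpsi k)) (regular_dist_cvg lf lpsi Hpsi) phi.
apply: (cvgC_unique c1).
have -> : (fun k => T (regular_dist (psi k)) phi) = (fun k => regular_dist (h k) phi).
  by apply/funext => k; rewrite TA.
exact: regular_dist_cvg lg lh gh phi.
Qed.

End extension.

Theorem proposition6 (R : realType) (n : nat) (hbar rho : R)
    (a : 'rV[R]_(n + n) -> R[i]) :
  0 < hbar <= 1 -> 0 < rho <= 1 -> shubin 0 rho a ->
  L2_bounded (op_BJ hbar a).
Proof.
move=> /andP[h0 _] /andP[/ltW rho0 _] sa.
have [K K0 HK] := op_BJ_L2 h0 rho0 sa.
have AL2 (u : 'rV[R]_n -> R[i]) : cdecaying u ->
    cmeas (op_BJ hbar a u) /\ (nsq (op_BJ hbar a u) <= K%:E * nsq u)%E.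
  by move=> /HK[m1 m2 H]; split.
have AB (psi phi : schwartzFun R n) x : op_BJ hbar a (fun y => psi y - phi y) x =
    op_BJ hbar a psi x - op_BJ hbar a phi x.
  exact: (op_BJB h0 rho0 sa _ (schwartz_cdecaying (sfunP psi)) (schwartz_cdecaying (sfunP phi))).
have K8 : 0 <= 8 * K by rewrite mulr_ge0.
exists (Num.sqrt (8 * K)); first exact: sqrtr_ge0.
split => [psi|T TE f lf].
  split; first exact: (operator_in_L2 AL2).
  apply: L2norm_le; first exact: sqrtr_ge0.
  rewrite sqr_sqrtr//; have [_ H] := AL2 _ (schwartz_cdecaying (sfunP psi)).
  apply: le_trans H _; apply: lee_wpmul2r; first exact: nsq_ge0.
  by rewrite lee_fin ler_peMl// ler1n.
have [g [lg Tg ng]] := extension_L2 K0 AB AL2 TE lf.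
exists g; split => //; apply: L2norm_le; first exact: sqrtr_ge0.
by rewrite sqr_sqrtr.
Qed.
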